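(* Let $Q := (0,1)\times(0,1) \subset \mathbb{R}^2$. There exist two smooth densities $f, g : \overline{Q} \to \mathbb{R}$ (i.e. $f,g \in C^\infty(\overline{Q})$, positive), bounded away from zero and satisfying the mass balance condition $\|f\|_{L^1(Q)} = \|g\|_{L^1(Q)}$, such that the optimal transport $T$ taking $f$ to $g$ is of class $C^{2,\alpha}(\overline{Q})$ for every $\alpha \in (0,1)$ but is not of class $C^3(\overline{Q})$.
   Context: The optimal transport taking $f$ to $g$ (densities on $Q$ with equal mass) is the a.e. unique map $T$ minimizing $\int_Q |x - T(x)|^2 f(x)\,dx$ among measurable maps with $T_{\#}(f\,dx) = g\,dy$; by Brenier's theorem $T = \nabla u$ a.e. for a convex function $u$. Regularity statements about $T$ refer to its continuous representative on $\overline{Q}$. $C^{k}(\overline{Q})$ denotes functions (or maps) whose derivatives up to order $k$ extend continuously to $\overline{Q}$, and $C^{k,\alpha}(\overline{Q})$ those for which in addition the $k$-th order derivatives are $\alpha$-Hölder continuous on $\overline{Q}$. *)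

(* Defs.v *)
From HB Require Import structures.
From mathcomp Require Import all_boot all_order all_algebra.
From mathcomp Require Import all_classical all_reals all_analysis.

Set Implicit Arguments.
Unset Strict Implicit.
Unset Printing Implicit Defensive.

Import Order.TTheory GRing.Theory Num.Theory.
Import numFieldNormedType.Exports.
Local Open Scope classical_set_scope.
Local Open Scope ring_scope.

(* The carrier R * R, with the sigma-algebras on which lebesgue_measure and its
   product are defined; on R itself inference picks another measure display. *)
Notation plane R := (measurableTypeR R * measurableTypeR R)%type.
Notation leb2 R := (@lebesgue_measure R \x @lebesgue_measure R)%E.

Section defs.
Context {R : realType}.

Definition openQ : set (R * R) := `]0, 1[ `*` `]0, 1[.
Definition closedQ : set (R * R) := `[0, 1] `*` `[0, 1].

(* The library norm on R * R is the maximum norm. *)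
Definition enorm (x : R * R) : R := Num.sqrt (x.1 ^+ 2 + x.2 ^+ 2).

Definition basis_vec (i : 'I_2) : R * R :=
  if i == ord0 then (1, 0) else (0, 1).

(* iter_partial [:: i1; ...; im] h = d_i1 (... (d_im h)). On the open set openQ
   it depends only on the values of h on openQ. *)
Definition iter_partial (w : seq 'I_2) (h : R * R -> R) : R * R -> R :=
  foldr (fun i k => 'D_(basis_vec i) k) h w.

Definition continuous_extension (h hbar : R * R -> R) : Prop :=
  {within closedQ, continuous hbar} /\ (forall x, openQ x -> hbar x = h x).

(* Only the values of h on closedQ matter: its partial derivatives are taken on
   openQ, and the first clause ties its boundary values to the interior ones. *)
Definition Ck (k : nat) (h : R * R -> R) : Prop :=
  [/\ {within closedQ, continuous h},
      forall w i x, (size w < k)%N -> openQ x ->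
        derivable (iter_partial w h) x (basis_vec i) &
      forall w, (size w <= k)%N ->
        exists hbar, continuous_extension (iter_partial w h) hbar].

Definition Ckalpha (k : nat) (alpha : R) (h : R * R -> R) : Prop :=
  Ck k h /\
  forall w, size w = k -> exists hbar,
    continuous_extension (iter_partial w h) hbar /\
    exists C : R, forall x y, closedQ x -> closedQ y ->
      `|hbar x - hbar y| <= C * enorm (x - y) `^ alpha.

Definition Cinfty (h : R * R -> R) : Prop := forall k, Ck k h.

Definition Ck_map (k : nat) (T : R * R -> R * R) : Prop :=
  Ck k (fun x => (T x).1) /\ Ck k (fun x => (T x).2).

Definition Ckalpha_map (k : nat) (alpha : R) (T : R * R -> R * R) : Prop :=
  Ckalpha k alpha (fun x => (T x).1) /\ Ckalpha k alpha (fun x => (T x).2).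

Local Open Scope ereal_scope.

(* A |-> \int_(A /\ Q) f(x) dx *)
Definition density_mass (f : R * R -> R) (A : set (plane R)) : \bar R :=
  \int[leb2 R]_(x in openQ `&` A) (f x)%:E.

Definition transports (f g : R * R -> R) (T : R * R -> R * R) : Prop :=
  measurable_fun (openQ : set (plane R)) (T : plane R -> plane R) /\
  forall B : set (plane R), measurable B ->
    pushforward (density_mass f) (T : plane R -> plane R) B = density_mass g B.

Definition transport_cost (f : R * R -> R) (T : R * R -> R * R) : \bar R :=
  \int[leb2 R]_(x in openQ) (enorm (x - T x) ^+ 2 * f x)%:E.

Definition is_minimizer (f g : R * R -> R) (T : R * R -> R * R) : Prop :=
  transports f g T /\
  forall S, transports f g S -> transport_cost f T <= transport_cost f S.

(* T is the minimizer: any other one agrees with it a.e. on Q. *)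
Definition optimal_transport (f g : R * R -> R) (T : R * R -> R * R) : Prop :=
  is_minimizer f g T /\
  forall S, is_minimizer f g S ->
    S = T %[ae leb2 R in openQ].

End defs.

(* Main.v *)
(** For g = 1 the optimal map is the gradient of u = |x|^2 / 2 + v, and f is det D^2 u; v is
    chosen small and singular only at the corner 0. In polar coordinates its
    leading term is r^4 (log r cos 4s - s sin 4s - 2 pi cos s (sin s)^3): it satisfies the Neumann
    conditions on both sides of the corner and its Laplacian - 12 pi x_1 x_2 is smooth, but its
    fourth derivatives grow like log r. The remaining error of the Monge-Ampere determinant is
    removed order by order with terms r^(2k) (log r)^i b(s) that satisfy the Neumann conditions,
    and a Borel summation of these terms, cut off near the corner, makes
    det D^2 u - 1 + 12 pi x_1 x_2 vanish to infinite order at 0, so f is smooth up to the corner.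
    By the Neumann conditions grad u preserves the sides of the square, so the integral of
    a(T_1) b(T_2) det DT is a boundary flux that does not depend on v, and T pushes f to 1.
    Optimality and uniqueness follow from the convex duality between u and its conjugate. *)

Require Import Defs.
From HB Require Import structures.
From mathcomp Require Import all_boot all_order all_algebra.
From mathcomp Require Import all_classical all_reals all_analysis.
From mathcomp Require Import measurable_realfun ring lra.

Import Order.TTheory GRing.Theory Num.Theory.
Import numFieldNormedType.Exports.
Local Open Scope classical_set_scope.
Local Open Scope ring_scope.

Set Implicit Arguments.
Unset Strict Implicit.
Unset Printing Implicit Defensive.

(** The obstruction at a right angle is a resonance. If [v] were C^4 up to the corner with d_2 v = 0
    on x_2 = 0 and d_1 v = 0 on x_1 = 0, then d_1 d_2 of its Laplacian would vanish at the corner,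
    since d_1^3 d_2 v and d_1 d_2^3 v are tangential derivatives of zero boundary data. So the
    linearised equation with right-hand side - 12 pi x_1 x_2 has no C^4 solution: its degree-4
    solution meets r^4 cos 4s, the homogeneous Neumann solution of the same degree, and a logarithm
    appears. The value 12 pi normalises the coefficient of r^4 log r cos 4s to 1. Third derivatives
    of [v], second ones of [T], behave like r log r, which is alpha-Hoelder for every alpha < 1.

    Two choices keep the analysis elementary. Smoothness is measured on the open half-plane x_1 +
    x_2 > 0, which contains the closed square without its corner, so the sides need no one-sided
    derivatives. The terms of the expansion are finite sums of products a(log r) b(s), so that their
    derivatives and estimates reduce to calculus in one variable. *)

Section Smooth1.
Context {R : realType}.
Implicit Types (a b : R -> R).

Lemma is_derive_mul (V : normedModType R) (f g : V -> R) x v (df dg : R) :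
  is_derive x v f df -> is_derive x v g dg ->
  is_derive x v (fun y => f y * g y) (df * g x + f x * dg).
Proof.
move=> fd gd; have := is_deriveM fd gd => h; apply: (is_derive_eq h).
by rewrite -![_ *: _]/(_ * _); ring.
Qed.

Lemma is_derive_add (V : normedModType R) (f g : V -> R) x v (df dg : R) :
  is_derive x v f df -> is_derive x v g dg ->
  is_derive x v (fun y => f y + g y) (df + dg).
Proof. by move=> fd gd; exact: is_deriveD. Qed.

(** A differentiable function of one variable is continuous, so iterated differentiability alone
    describes smoothness. The finite levels are kept because the closure properties go by induction
    on them. *)
Fixpoint diffn (n : nat) (a : R -> R) : Prop :=
  if n is m.+1 then (forall x, derivable a x 1) /\ diffn m (derive1 a) else True.

Definition smooth1 (a : R -> R) := forall n, diffn n a.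

Lemma diffnW n a : diffn n.+1 a -> diffn n a.
Proof. by elim: n a => [//|n IH] a [da ha]; split=> //; exact: IH. Qed.

Lemma diffn_is_derive n a a' : (forall x : R, is_derive x 1 a (a' x)) ->
  diffn n a' -> diffn n.+1 a.
Proof.
move=> aa' ha; split=> [x|]; first exact: ex_derive.
suff -> : (derive1 a) = a' by [].
by apply/funext => x; rewrite derive1E; exact: derive_val.
Qed.

Lemma smooth1_is_derive a a' : (forall x : R, is_derive x 1 a (a' x)) ->
  smooth1 a' -> smooth1 a.
Proof. by move=> aa' ha [//|n]; exact: diffn_is_derive (ha n). Qed.

Lemma smooth1_derivable a : smooth1 a -> forall x, derivable a x 1.
Proof. by move=> /(_ 1%N)[]. Qed.

Lemma smooth1_isd a (x : R) : smooth1 a -> is_derive x 1 a ((derive1 a) x).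
Proof.
by move=> sa; rewrite derive1E; apply: derivableP; exact: smooth1_derivable.
Qed.

Lemma smooth1_derive a : smooth1 a -> smooth1 (derive1 a).
Proof. by move=> sa n; have [] := sa n.+1. Qed.

Lemma smooth1_cont a : smooth1 a -> continuous a.
Proof.
by move=> sa x; apply/differentiable_continuous/derivable1_diffP/smooth1_derivable.
Qed.

Lemma smooth1_cst (c : R) : smooth1 (fun=> c).
Proof.
move=> n; elim: n c => [//|n IH] c.
by apply: (diffn_is_derive (a' := fun=> 0)) ; exact: IH.
Qed.

Lemma smooth1_id : smooth1 id.
Proof. by apply: (@smooth1_is_derive _ (fun=> 1)); exact: smooth1_cst. Qed.

Lemma derive1M_smooth a b : smooth1 a -> smooth1 b ->
  derive1 (fun t => a t * b t) = fun t => (derive1 a) t * b t + a t * (derive1 b) t.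
Proof.
move=> sa sb; apply/funext => x; rewrite !derive1E deriveM; try exact: smooth1_derivable.
by rewrite -![_ *: _]/(_ * _); ring.
Qed.

Lemma diffnD n a b : diffn n a -> diffn n b -> diffn n (fun t => a t + b t).
Proof.
elim: n a b => [//|n IH] a b [da ha] [db hb].
apply: (diffn_is_derive (a' := fun t => (derive1 a) t + (derive1 b) t)); last exact: IH.
by move=> x; rewrite !derive1E; apply: is_deriveD; exact: derivableP.
Qed.

Lemma diffnM n a b : diffn n a -> diffn n b -> diffn n (fun t => a t * b t).
Proof.
elim: n a b => [//|n IH] a b ha hb; have [[da ha'] [db hb']] := (ha, hb).
apply: (diffn_is_derive (a' := fun t => derive1 a t * b t + a t * derive1 b t)).
  by move=> x; apply: is_derive_mul; rewrite derive1E; exact: derivableP.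
by apply: diffnD; apply: IH => //; exact: diffnW.
Qed.

Lemma smooth1D a b : smooth1 a -> smooth1 b -> smooth1 (fun t => a t + b t).
Proof. by move=> sa sb n; exact: diffnD. Qed.

Lemma smooth1M a b : smooth1 a -> smooth1 b -> smooth1 (fun t => a t * b t).
Proof. by move=> sa sb n; exact: diffnM. Qed.

Lemma smooth1Z c a : smooth1 a -> smooth1 (fun t => c * a t).
Proof. by apply: smooth1M; exact: smooth1_cst. Qed.

Lemma smooth1N a : smooth1 a -> smooth1 (fun t => - a t).
Proof.
move=> sa; have -> : (fun t => - a t) = (fun t => -1 * a t).
  by apply/funext => t; rewrite mulN1r.
exact: smooth1Z.
Qed.

Lemma smooth1X a n : smooth1 a -> smooth1 (fun t => a t ^+ n).
Proof.
move=> sa; elim: n => [|n IH].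
  by have -> : (fun t => a t ^+ 0) = fun=> 1 by []; exact: smooth1_cst.
have -> : (fun t => a t ^+ n.+1) = fun t => a t * a t ^+ n.
  by apply/funext => t; rewrite exprS.
exact: smooth1M.
Qed.

Lemma is_derive_comp1 a b (x a' b' : R) : is_derive (b x) 1 a a' -> is_derive x 1 b b' ->
  is_derive x 1 (fun t => a (b t)) (a' * b').
Proof.
move=> ha hb; apply: is_derive_eq; rewrite /= mulrC //.
Qed.

Lemma smooth1_comp a b : smooth1 a -> smooth1 b -> smooth1 (fun t => a (b t)).
Proof.
move=> sa sb n; elim: n a sa => [//|n IH] a sa.
apply: (diffn_is_derive (a' := fun t => (derive1 a) (b t) * (derive1 b) t)).
  by move=> x; apply: is_derive_comp1; exact: smooth1_isd.
by apply: diffnM; [apply: IH|]; exact: smooth1_derive.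
Qed.

Lemma smooth1_expR : smooth1 expR.
Proof.
elim=> [//|n IH]; apply: (diffn_is_derive (a' := expR)) => // x.
Qed.

Lemma smooth1_cos_sin : smooth1 cos /\ smooth1 sin.
Proof.
suff H n : diffn n (@cos R) /\ diffn n (@sin R) by split=> n; have [] := H n.
elim: n => [//|n [IHc IHs]]; split; last first.
  exact: (@diffn_is_derive _ _ cos).
apply: (@diffn_is_derive _ _ (fun t => - sin t)).
have -> : (fun t : R => - sin t) = (fun t => -1 * sin t).
  by apply/funext => t; rewrite mulN1r.
by apply: diffnM => //; exact: smooth1_cst.
Qed.

Definition smooth1_cos := smooth1_cos_sin.1.
Definition smooth1_sin := smooth1_cos_sin.2.

Lemma smooth1_expM (c : R) : smooth1 (fun t => expR (c * t)).
Proof.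
apply: smooth1_comp; first exact: smooth1_expR.
by apply: smooth1Z; exact: smooth1_id.
Qed.

End Smooth1.

(** * Antiderivatives on the whole line *)

Section Antiderivative.
Context {R : realType}.
Implicit Types (a b : R -> R) (x y z : R).

(** Integrating from the base point [-1] makes 0 an interior point, so that this half and its
    reflection overlap on []-1, 1[] and can be glued. *)
Lemma antiderivative_gtN1 a : continuous a ->
  exists A : R -> R, A 0 = 0 /\ forall x : R, -1 < x -> is_derive x 1 A (a x).
Proof.
move=> ca.
pose F (x : R) : R := (\int[@lebesgue_measure R]_(t in `[(-1)%R, x]) a t)%R.
have dF (x : R) : -1 < x -> is_derive x 1 F (a x).
  move=> x1.
  have xx1 : x < x + 1 by rewrite ltrDl.
  have ia : (@lebesgue_measure R).-integrable `[(-1)%R, x + 1] (EFin \o a).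
    apply: continuous_compact_integrable; first exact: segment_compact.
    exact: continuous_subspaceT.
  have [h1 h2] := continuous_FTC1_closed xx1 ia x1 (ca x).
  by apply: DeriveDef => //; rewrite -derive1E.
exists (fun x => F x + - F 0); split=> [|x x1]; first by rewrite subrr.
have h := is_derive_add (dF _ x1) (is_derive_cst (- F 0) x 1).
by apply: (is_derive_eq h); rewrite addr0.
Qed.

Lemma eq_antiderivative (A B a : R -> R) (l r : R) :
  (forall x : R, l < x < r -> is_derive x 1 A (a x)) ->
  (forall x : R, l < x < r -> is_derive x 1 B (a x)) ->
  l < 0 < r -> A 0 = B 0 -> forall x : R, l < x < r -> A x = B x.
Proof.
move=> dA dB /andP[l0 r0] AB0 x /andP[lx xr].
pose D x := A x - B x.
have dD y : l < y < r -> is_derive y 1 D 0.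
  move=> ly; have := is_deriveB (dA _ ly) (dB _ ly); rewrite subrr; exact.
have cD y z : l < y -> z < r -> {within `[y, z], continuous D}.
  move=> ly zr; apply: derivable_within_continuous => u.
  rewrite in_itv/= => /andP[yu uz].
  have lur : l < u < r by rewrite (lt_le_trans ly yu) (le_lt_trans uz zr).
  by have := dD _ lur => ?; exact: ex_derive.
suff : D x = 0 by move/subr0_eq.
have D0 : D 0 = 0 by rewrite /D AB0 subrr.
have [x0|x0|->] := ltgtP x 0; last exact: D0.
  have [] := @MVT _ D (fun=> 0) _ _ x0 _ (cD _ _ lx r0).
    move=> y; rewrite in_itv/= => /andP[xy y0]; apply: dD.
    by rewrite (lt_trans lx xy) (lt_trans y0 r0).
  by move=> c _; rewrite D0 mul0r => /eqP; rewrite sub0r oppr_eq0 => /eqP.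
have [] := @MVT _ D (fun=> 0) _ _ x0 _ (cD _ _ l0 xr).
  move=> y; rewrite in_itv/= => /andP[xy y0]; apply: dD.
  by rewrite (lt_trans l0 xy) (lt_trans y0 xr).
by move=> c _; rewrite D0 mul0r subr0.
Qed.

(** The right half [A] and the reflected half [B'] have the same derivative on []-1, 1[] and both
    vanish at 0, so they agree there; the case distinction at 0 is therefore locally one of the
    two. *)
Lemma antiderivative a : continuous a ->
  exists A : R -> R, A 0 = 0 /\ forall x : R, is_derive x 1 A (a x).
Proof.
move=> ca.
have [A [A0 dA]] := antiderivative_gtN1 ca.
have caN : continuous (fun x => a (- x)).
  by move=> x; apply: (@continuous_comp _ _ _ -%R a); [exact: opp_continuous|exact: ca].
have [B [B0 dB]] := antiderivative_gtN1 caN.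
pose B' x := - B (- x).
have dB' (x : R) : x < 1 -> is_derive x 1 B' (a x).
  move=> x1; have x1' : -1 < - x by rewrite ltrN2.
  have := dB _ x1'; rewrite opprK => h.
  have h2 := is_derive_comp1 h (is_deriveNid (x : R) (1 : R)).
  have := is_deriveN h2; rewrite mulrN1 opprK; exact.
have AB : forall x, -1 < x < 1 -> A x = B' x.
  apply: (@eq_antiderivative _ _ a) => [x /andP[? _]|x /andP[_ ?]||].
  - exact: dA.
  - exact: dB'.
  - by rewrite ltrN10 ltr01.
  - by rewrite A0 /B' oppr0 B0 oppr0.
exists (fun x => if 0 <= x then A x else B' x); rewrite lexx A0; split=> // x.
have [x1|x1] := ltP x 1.
  apply: near_eq_is_derive (dB' _ x1); near=> y.
  have y1 : y < 1 by near: y; exact: lt_nbhsl.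
  case: ifPn => // y0; apply/esym/AB; rewrite y1 andbT.
  exact: lt_le_trans y0.
apply: near_eq_is_derive (dA x _); last exact: lt_le_trans x1.
near=> y.
have y0 : 0 < y by near: y; apply: lt_nbhsr; exact: lt_le_trans x1.
by rewrite (ltW y0).
Unshelve. all: by end_near. Qed.

Lemma smooth1_antiderivative a : smooth1 a ->
  exists A : R -> R, [/\ A 0 = 0, smooth1 A & derive1 A = a].
Proof.
move=> sa; have [A [A0 dA]] := antiderivative (smooth1_cont sa).
exists A; split=> //; first exact: smooth1_is_derive dA sa.
by apply/funext => x; have := dA x => ?; rewrite derive1E derive_val.
Qed.

End Antiderivative.

(** * Flat functions and a smooth step *)

Section Bump.
Context {R : realType}.
Implicit Types (x y : R) (P : {poly R}).

(** Each monomial is handled by one term of the exponential series: y^i / i! is at most exp y for y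
    >= 0. *)
Lemma poly_expN_bounded P :
  exists C : R, forall y, 0 <= y -> `|P.[y]| * expR (- y) <= C.
Proof.
exists (\sum_(i < size P) `|P`_i| * i`!%:R) => y y0.
rewrite horner_coef (le_trans (ler_wpM2r (expR_ge0 _) (ler_norm_sum _ _ _)))//.
rewrite mulr_suml; apply: ler_sum => i _.
rewrite normrM -mulrA ler_wpM2l// ger0_norm ?exprn_ge0// expRN.
rewrite ler_pdivrMr ?expR_gt0//.
have fi : (0 : R) < (nat_of_ord i)`!%:R by rewrite ltr0n fact_gt0.
case: (nat_of_ord i) fi => [|n] fi; first by rewrite fact0 mul1r expr0 -expR0 ler_expR.
rewrite mulrC -ler_pdivrMr//; apply: le_trans (expR_ge1Dxn n y0).
by rewrite lerDr.
Qed.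

Lemma is_derive0_sqr (f : R -> R) (C : R) :
  (forall h, `|f h| <= C * h ^+ 2) -> is_derive (0 : R) 1 f 0.
Proof.
move=> fC.
have C0 : 0 <= C by have := le_trans (normr_ge0 _) (fC 1); rewrite expr1n mulr1.
have f0 : f 0 = 0.
  by apply/eqP; rewrite -normr_le0; have := fC 0; rewrite expr0n/= mulr0.
have H : h^-1 *: (f (h *: 1 + 0) - f 0) @[h --> 0^'] --> (0 : R).
  have C1 : 0 < C + 1 by rewrite ltr_wpDl.
  apply/cvgr0Pnorm_lt => e e0; near=> h.
  have hn0 : h != 0 by near: h; exact: nbhs_dnbhs_neq.
  rewrite f0 subr0 addr0 [_%:A]mulr1 -[_ *: _]/(_ * _) normrM normfV.
  rewrite mulrC ltr_pdivrMr ?normr_gt0//.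
  apply: (le_lt_trans (fC h)); rewrite -[h ^+ 2]real_normK ?num_real// expr2 mulrA.
  rewrite ltr_pM2r ?normr_gt0//.
  apply: (@le_lt_trans _ _ ((C + 1) * `|h|)).
    by rewrite ler_wpM2r// lerDl.
  rewrite [(C + 1) * _]mulrC -ltr_pdivlMr//; near: h; apply: dnbhs0_lt; exact: divr_gt0.
apply: DeriveDef; first by apply/cvg_ex; exists 0.
exact: cvg_lim H.
Unshelve. all: by end_near. Qed.

(** This family is stable under differentiation, which replaces P by X^2 (P - P'). Smoothness of
    exp(-1/x), extended by 0, thus becomes an induction over all polynomials at once. *)
Definition poly_expN P x : R := if 0 < x then P.[x^-1] * expR (- x^-1) else 0.

Lemma poly_expN_is_derive P x :
  is_derive x 1 (poly_expN P) (poly_expN ('X ^+ 2 * (P - P^`())) x).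
Proof.
have [x0|x0|->] := ltgtP x 0.
- rewrite {2}/poly_expN ltNge (ltW x0)/=.
  apply: near_eq_is_derive (is_derive_cst (0 : R) x 1).
  near=> y; have y0 : y < 0 by near: y; exact: lt_nbhsl.
  by rewrite /poly_expN ltNge (ltW y0).
- have xn0 : x != 0 by rewrite gt_eqF.
  apply: (@near_eq_is_derive _ _ _ (fun y => P.[y^-1] * expR (- y^-1))).
    near=> y; have y0 : 0 < y by near: y; exact: lt_nbhsr.
    by rewrite /poly_expN y0.
  rewrite /poly_expN x0.
  have dV : is_derive x 1 (fun y : R => y^-1) (- x ^- 2).
    have di : derivable (id : R -> R) x 1 by exact: derivable_id.
    apply: DeriveDef; first exact: (@derivableV _ _ id x 1 xn0 di).
    by rewrite (@deriveV _ _ id x 1 xn0 di) derive_id [_%:A]mulr1.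
  have h1 : is_derive x 1 (fun y => P.[y^-1]) (P^`().[x^-1] * - x ^- 2).
    exact: is_derive_comp1 (is_derive_poly P x^-1) dV.
  have h2 : is_derive x 1 (fun y : R => expR (- y^-1)) (expR (- x^-1) * x ^- 2).
    apply: (is_derive_comp1 (b := fun y => - y^-1)) .
    by have := is_deriveN dV; rewrite opprK; exact.
  apply: (is_derive_eq (is_derive_mul h1 h2)).
  rewrite hornerM hornerXn hornerD hornerN exprVn; ring.
- have -> : poly_expN ('X^2 * (P - P^`())) 0 = 0 by rewrite /poly_expN ltxx.
  (* The extra factor X^2 turns boundedness into the bound C h^2 at the origin. *)
  have [C HC] := poly_expN_bounded ('X ^+ 2 * P).
  have C0 : 0 <= C.
    by apply: le_trans (HC 0 _) => //; rewrite mulr_ge0// expR_ge0.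
  apply: (@is_derive0_sqr _ C) => h; rewrite /poly_expN.
  case: ifPn => h0; last by rewrite normr0 mulr_ge0// sqr_ge0.
  have := HC h^-1; rewrite invr_ge0 => /(_ (ltW h0)).
  rewrite hornerM hornerXn normrM normrX normfV (gtr0_norm h0) => H.
  rewrite normrM (ger0_norm (expR_ge0 _)) -ler_pdivrMr ?exprn_gt0//.
  by apply: le_trans H; rewrite exprVn mulrC mulrA.
Unshelve. all: by end_near. Qed.

Lemma smooth1_poly_expN P : smooth1 (poly_expN P).
Proof.
move=> n; elim: n P => [//|n IH] P.
exact: diffn_is_derive (poly_expN_is_derive P) (IH _).
Qed.

Definition flat x : R := poly_expN 1 x.

Lemma smooth1_flat : smooth1 flat. Proof. exact: smooth1_poly_expN. Qed.

Lemma flatE x : flat x = if 0 < x then expR (- x^-1) else 0.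
Proof. by rewrite /flat /poly_expN hornerC mul1r. Qed.

Lemma flat_le0 x : x <= 0 -> flat x = 0.
Proof. by rewrite flatE ltNge => ->. Qed.

Lemma flat_ge0 x : 0 <= flat x.
Proof. by rewrite flatE; case: ifP => _ //; exact: expR_ge0. Qed.

Lemma flat_gt0 x : 0 < x -> 0 < flat x.
Proof. by rewrite flatE => ->; exact: expR_gt0. Qed.

Lemma flat_lt1 x : flat x < 1.
Proof.
rewrite flatE; case: ifPn => // x0.
by rewrite expR_lt1 oppr_lt0 invr_gt0.
Qed.

Lemma flat1_gt0 : 0 < flat 1. Proof. exact: flat_gt0. Qed.

(** The ratio [flat x / flat 1] is 0 for x <= 0 and at least 1 for x >= 1. Applying [flat] once more
    to its complement gives a smooth passage from 1 to 0 without integrating a bump. *)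
Definition step x : R := flat (1 - flat x / flat 1) / flat 1.

Lemma smooth1_step : smooth1 step.
Proof.
have -> : step = fun x => (flat 1)^-1 * flat (1 + - ((flat 1)^-1 * flat x)).
  by apply/funext => x; rewrite /step mulrC [_^-1 * flat x]mulrC.
apply: smooth1Z; apply: (smooth1_comp smooth1_flat).
apply: smooth1D; first exact: smooth1_cst.
apply: smooth1N; apply: smooth1Z; exact: smooth1_flat.
Qed.

Lemma step_le0 x : x <= 0 -> step x = 1.
Proof.
by move=> x0; rewrite /step (flat_le0 x0) mul0r subr0 divff// gt_eqF// flat1_gt0.
Qed.

Lemma step_ge1 x : 1 <= x -> step x = 0.
Proof.
move=> x1; have x0 : 0 < x := lt_le_trans ltr01 x1.
suff h : 1 - flat x / flat 1 <= 0 by rewrite /step (flat_le0 h) mul0r.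
rewrite subr_le0 ler_pdivlMr ?flat1_gt0// mul1r.
by rewrite !flatE ltr01 x0 ler_expR lerN2 lef_pV2// posrE.
Qed.

End Bump.

(** * Smooth functions on the half-plane x_1 + x_2 > 0 *)

Section HalfPlane.
Context {R : realType}.
Implicit Types (x y : R * R) (h k : R * R -> R) (i : 'I_2) (w : seq 'I_2).

(** An open neighbourhood of the closed square minus its corner that avoids the negative x_1-axis,
    where the angle jumps. On the sides of the square all partial derivatives are then two-sided. *)
Definition halfplane : set (R * R) := [set x | 0 < x.1 + x.2].

Lemma open_halfplane : open halfplane.
Proof.
have -> : halfplane = (fun x => x.1 + x.2) @^-1` [set y : R | 0 < y] by [].
apply: open_comp; last exact: open_gt.
move=> x _; apply: (@continuousD _ _ _ fst snd); [exact: cvg_fst|exact: cvg_snd].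
Qed.

Lemma near_halfplane x : halfplane x -> \near x, halfplane x.
Proof. by move=> Hx; apply: open_nbhs_nbhs; split=> //; exact: open_halfplane. Qed.

Lemma closedQ_halfplane x : closedQ x -> x != 0 -> halfplane x.
Proof.
case: x => x1 x2; rewrite /closedQ /halfplane /= !in_itv/=.
move=> -[/andP[x10 _] /andP[x20 _]] xn0; rewrite lt_neqAle addr_ge0// andbT eq_sym.
apply: contra xn0; rewrite paddr_eq0// => /andP[/eqP-> /eqP->] //.
Qed.

Lemma openQ_closedQ x : openQ x -> closedQ x.
Proof.
rewrite /openQ /closedQ /= !in_itv/= => -[/andP[a b] /andP[c d]].
by rewrite !ltW.
Qed.

Lemma openQ_halfplane x : openQ x -> halfplane x.
Proof.
by rewrite /openQ /halfplane /= !in_itv/= => -[/andP[a _] /andP[c _]]; exact: addr_gt0.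
Qed.

Lemma near_openQ x : openQ x -> \near x, openQ x.
Proof.
by case: x => a b [/= ha hb]; exists (`]0, 1[%classic, `]0, 1[%classic) => //; split; apply: open_nbhs_nbhs; split.
Qed.

(** Continuity is demanded at every level because in the plane the existence of partial derivatives
    does not imply it. *)
Fixpoint diffOm (n : nat) h : Prop :=
  (forall x, halfplane x -> {for x, continuous h}) /\
  if n is m.+1 then forall i,
    (forall x, halfplane x -> derivable h x (basis_vec i)) /\
    diffOm m ('D_(basis_vec i) h)
  else True.

Definition smoothOm h := forall n, diffOm n h.

Lemma near_eq_D i h k x : (\near x, h x = k x) ->
  \near x, 'D_(basis_vec i) h x = 'D_(basis_vec i) k x.
Proof.
by move=> /near_join; apply: filterS => y hk; exact: near_eq_derive.
Qed.

Lemma near_eq_iter w h k x : (\near x, h x = k x) ->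
  \near x, iter_partial w h x = iter_partial w k x.
Proof. by move=> hk; elim: w => [//|i w IH] /=; exact: near_eq_D. Qed.

Lemma near_eq_continuous h k x : (\near x, h x = k x) ->
  {for x, continuous k} -> {for x, continuous h}.
Proof.
move=> hk ck; rewrite /prop_for /continuous_at (nbhs_singleton hk).
apply: cvg_trans ck; apply: near_eq_cvg; apply: filterS hk => y ->//.
Qed.

Lemma diffOm_near n h :
  (forall x, halfplane x -> exists2 k, diffOm n k & \near x, h x = k x) ->
  diffOm n h.
Proof.
have hC m h' : (forall x, halfplane x -> exists2 k, diffOm m k & \near x, h' x = k x) ->
    forall x, halfplane x -> {for x, continuous h'}.
  move=> hl x Hx; have [k dk hk] := hl x Hx; apply: (near_eq_continuous hk).
  by case: m dk {hl} => [|m] [ck _]; exact: ck.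
elim: n h => [|n IH] h hloc; (split; first exact: hC hloc) => // i; split=> [x Hx|].
  have [k [_ dk] hk] := hloc x Hx; apply: (near_eq_derivable (f := k)).
    by apply: filterS hk.
  by have [+ _] := dk i; exact.
apply: IH => x Hx; have [k [_ dk] hk] := hloc x Hx.
by exists ('D_(basis_vec i) k); [have [] := dk i|exact: near_eq_D].
Qed.

Lemma diffOm_eq n h k : (forall x, halfplane x -> h x = k x) ->
  diffOm n k -> diffOm n h.
Proof.
move=> hk dk; apply: diffOm_near => x Hx; exists k => //.
by apply: filterS (near_halfplane Hx) => y; exact: hk.
Qed.

Lemma diffOmW n h : diffOm n.+1 h -> diffOm n h.
Proof.
elim: n h => [|n IH] h [ch dh]; first by split.
by split=> // i; split; have [//] := dh i => _; exact: IH.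
Qed.

(** Serves the Borel sum, which near each point coincides with a finite partial sum. *)
Lemma smoothOm_near h :
  (forall x, halfplane x -> exists2 k, smoothOm k & \near x, h x = k x) ->
  smoothOm h.
Proof.
move=> hloc n; apply: diffOm_near => x Hx; have [k sk hk] := hloc x Hx.
by exists k.
Qed.

Lemma smoothOm_cont h x : smoothOm h -> halfplane x -> {for x, continuous h}.
Proof. by move=> /(_ 0%N)[+ _]; exact. Qed.

Lemma smoothOm_derivable i h x : smoothOm h -> halfplane x ->
  derivable h x (basis_vec i).
Proof. by move=> /(_ 1%N)[_ /(_ i)[+ _]]; exact. Qed.

Lemma smoothOm_is_derive i h x : smoothOm h -> halfplane x ->
  is_derive x (basis_vec i) h ('D_(basis_vec i) h x).
Proof. by move=> sh Hx; apply: derivableP; exact: smoothOm_derivable. Qed.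

Lemma smoothOm_D i h : smoothOm h -> smoothOm ('D_(basis_vec i) h).
Proof. by move=> sh n; have [_ /(_ i)[]] := sh n.+1. Qed.

Lemma smoothOm_iter w h : smoothOm h -> smoothOm (iter_partial w h).
Proof. by move=> sh; elim: w => [//|i w IH] /=; exact: smoothOm_D. Qed.

Lemma smoothOm_eq h k : (forall x, halfplane x -> h x = k x) ->
  smoothOm k -> smoothOm h.
Proof. by move=> hk sk n; exact: diffOm_eq hk (sk n). Qed.

(** A coinduction principle: for a family closed under partial derivatives (constants, bilinear
    functions, functions [pol H]) no order of differentiation has to be counted. *)
Lemma smoothOm_coind (P : (R * R -> R) -> Prop) :
  (forall h, P h -> (forall x, halfplane x -> {for x, continuous h}) /\
     forall i, (forall x, halfplane x -> derivable h x (basis_vec i)) /\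
       exists2 k, P k & forall x, halfplane x -> 'D_(basis_vec i) h x = k x) ->
  forall h, P h -> smoothOm h.
Proof.
move=> HP h Ph n; elim: n h Ph => [|n IH] h /HP[ch dh]; split=> // i.
have [di [k Pk hk]] := dh i; split=> //.
by apply: (diffOm_eq hk); exact: IH.
Qed.

Lemma diffOmD n h k : diffOm n h -> diffOm n k -> diffOm n (fun x => h x + k x).
Proof.
have cD h' k' : (forall x, halfplane x -> {for x, continuous h'}) ->
    (forall x, halfplane x -> {for x, continuous k'}) ->
    forall x, halfplane x -> {for x, continuous (fun y => h' y + k' y)}.
  by move=> ch ck x Hx; apply: continuousD; [exact: ch|exact: ck].
elim: n h k => [|n IH] h k [ch dh] [ck dk]; split => //; try exact: cD.
move=> i; have [dhi hi] := dh i; have [dki ki] := dk i; split=> [x Hx|].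
  by apply: derivableD; [exact: dhi|exact: dki].
apply: (diffOm_eq _ (IH _ _ hi ki)) => x Hx.
by rewrite deriveD//; [exact: dhi|exact: dki].
Qed.

Lemma diffOmM n h k : diffOm n h -> diffOm n k -> diffOm n (fun x => h x * k x).
Proof.
have cM h' k' : (forall x, halfplane x -> {for x, continuous h'}) ->
    (forall x, halfplane x -> {for x, continuous k'}) ->
    forall x, halfplane x -> {for x, continuous (fun y => h' y * k' y)}.
  by move=> ch ck x Hx; apply: continuousM; [exact: ch|exact: ck].
elim: n h k => [|n IH] h k hh hk; have [[ch dh] [ck dk]] := (hh, hk);
  split => //; try exact: cM.
move=> i; have [dhi hi] := dh i; have [dki ki] := dk i; split=> [x Hx|].
  by apply: derivableM; [exact: dhi|exact: dki].
have h1 := IH _ _ (diffOmW hh) ki; have h2 := IH _ _ hi (diffOmW hk).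
apply: (diffOm_eq _ (diffOmD h1 h2)) => x Hx.
rewrite deriveM; [|exact: dhi|exact: dki].
by rewrite -![_ *: _]/(_ * _) [k x * _]mulrC.
Qed.

Lemma smoothOm_cst (c : R) : smoothOm (fun=> c).
Proof.
apply: (@smoothOm_coind (fun h => exists c, h = fun=> c)); last by exists c.
move=> _ [d ->]; split=> [x _|i]; first exact: cvg_cst.
split=> [x _|]; first exact: derivable_cst.
by exists (fun=> 0) => [|x _]; [exists 0|exact: derive_cst].
Qed.

Lemma smoothOmD h k : smoothOm h -> smoothOm k -> smoothOm (fun x => h x + k x).
Proof. by move=> sh sk n; exact: diffOmD. Qed.

Lemma smoothOmM h k : smoothOm h -> smoothOm k -> smoothOm (fun x => h x * k x).
Proof. by move=> sh sk n; exact: diffOmM. Qed.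

Lemma smoothOmB h k : smoothOm h -> smoothOm k -> smoothOm (fun x => h x - k x).
Proof.
move=> sh sk; have -> : (fun x => h x - k x) = (fun x => h x + -1 * k x).
  by apply/funext => x; rewrite mulN1r.
by apply: smoothOmD => //; apply: smoothOmM => //; exact: smoothOm_cst.
Qed.

Lemma iter_partial_rcons w i h :
  iter_partial (rcons w i) h = iter_partial w ('D_(basis_vec i) h).
Proof. by rewrite /iter_partial foldr_rcons. Qed.

Lemma iter_partial_eq w h k : (forall x, halfplane x -> h x = k x) ->
  forall x, halfplane x -> iter_partial w h x = iter_partial w k x.
Proof.
move=> hk x Hx; have : \near x, h x = k x.
  by apply: filterS (near_halfplane Hx) => y; exact: hk.
by move=> /(@near_eq_iter w h k x)/nbhs_singleton.
Qed.

Lemma partialD i h k x : smoothOm h -> smoothOm k -> halfplane x ->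
  'D_(basis_vec i) (fun y => h y + k y) x =
  'D_(basis_vec i) h x + 'D_(basis_vec i) k x.
Proof. by move=> sh sk Hx; rewrite deriveD//; exact: smoothOm_derivable. Qed.

Lemma partialM i h k x : smoothOm h -> smoothOm k -> halfplane x ->
  'D_(basis_vec i) (fun y => h y * k y) x =
  'D_(basis_vec i) h x * k x + h x * 'D_(basis_vec i) k x.
Proof.
move=> sh sk Hx; rewrite deriveM; try exact: smoothOm_derivable.
by rewrite -![_ *: _]/(_ * _); ring.
Qed.

Lemma iter_partialD w h k : smoothOm h -> smoothOm k ->
  forall x, halfplane x ->
  iter_partial w (fun y => h y + k y) x = iter_partial w h x + iter_partial w k x.
Proof.
elim/last_ind: w h k => [//|w i IH] h k sh sk x Hx.
rewrite !iter_partial_rcons -IH//; try exact: smoothOm_D.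
by apply: iter_partial_eq => // y Hy; exact: partialD.
Qed.

End HalfPlane.

(** * Polar coordinates on the half-plane *)

Section Polar.
Context {R : realType}.
Implicit Types (x y : R * R) (i : 'I_2) (a b : R -> R) (H K : R -> R -> R).

Lemma is_derive_line (V : normedModType R) (f : V -> R) (x v : V) (d : R) :
  is_derive x v f d <-> is_derive (0 : R) 1 (fun h : R => f (h *: v + x)) d.
Proof.
have E : derivable f x v <-> derivable (fun h : R => f (h *: v + x)) 0 1.
  exact: derivable1P.
have D : 'D_v f x = 'D_1 (fun h : R => f (h *: v + x)) 0.
  rewrite /derive; set g1 := fun h => h^-1 *: _; set g2 := fun h => h^-1 *: _.
  suff -> : g1 = g2 by [].
  by rewrite funeqE /g1 /g2 => h /=; rewrite addr0 scale0r add0r [_%:A]mulr1.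
by split=> -[fx fd]; apply: DeriveDef; rewrite -?fd ?D//; apply/E.
Qed.

Lemma is_derive_compV (V : normedModType R) a (b : V -> R) (p v : V) (da db : R) :
  is_derive (b p) 1 a da -> is_derive p v b db ->
  is_derive p v (fun z => a (b z)) (da * db).
Proof.
move=> ha /is_derive_line hb; apply/is_derive_line.
apply: (@is_derive_comp1 _ a (fun h : R => b (h *: v + p)) 0 da db) => //.
by rewrite scale0r add0r.
Qed.

Lemma is_derive_fst x v : is_derive x v (fun y : R * R => y.1) v.1.
Proof.
apply/is_derive_line => /=.
have h := is_derive_add (is_derive_mul (is_derive_id (0 : R) 1)
  (is_derive_cst v.1 (0 : R) 1)) (is_derive_cst x.1 (0 : R) 1).
by apply: (is_derive_eq h); rewrite /cst mul1r mulr0 !addr0.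
Qed.

Lemma is_derive_snd x v : is_derive x v (fun y : R * R => y.2) v.2.
Proof.
apply/is_derive_line => /=.
have h := is_derive_add (is_derive_mul (is_derive_id (0 : R) 1)
  (is_derive_cst v.2 (0 : R) 1)) (is_derive_cst x.2 (0 : R) 1).
by apply: (is_derive_eq h); rewrite /cst mul1r mulr0 !addr0.
Qed.

Definition logr x : R := ln (enorm x).
(** The half-angle formula tan(s/2) = x_2 / (x_1 + r). Unlike atan(x_2 / x_1) it is one smooth
    expression on the whole half-plane, including the axis x_1 = 0. *)
Definition ang x : R := 2 * atan (x.2 / (x.1 + enorm x)).

Lemma sqnorm_gt0 x : halfplane x -> 0 < x.1 ^+ 2 + x.2 ^+ 2.
Proof.
rewrite /halfplane /= => h.
rewrite lt_neqAle addr_ge0 ?sqr_ge0// andbT eq_sym paddr_eq0 ?sqr_ge0//.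
by rewrite !sqrf_eq0; apply/negP => /andP[/eqP x1 /eqP x2]; move: h; rewrite x1 x2 addr0 ltxx.
Qed.

Lemma enorm_gt0 x : halfplane x -> 0 < enorm x.
Proof. by move=> Hx; rewrite sqrtr_gt0 sqnorm_gt0. Qed.

Lemma sqr_enorm x : enorm x ^+ 2 = x.1 ^+ 2 + x.2 ^+ 2.
Proof. by rewrite sqr_sqrtr// addr_ge0// sqr_ge0. Qed.

Lemma expR_logr x : halfplane x -> expR (logr x) = enorm x.
Proof. by move=> Hx; rewrite lnK// posrE enorm_gt0. Qed.

Lemma halfplane_fst_enorm x : halfplane x -> 0 < x.1 + enorm x.
Proof.
move=> Hx; have r0 := enorm_gt0 Hx; have [x1|x1] := leP 0 x.1.
  by rewrite ltr_wpDl.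
suff : - x.1 < enorm x by lra.
rewrite -(@ltr_pXn2r _ 2) ?nnegrE ?oppr_ge0 ?ltW// sqr_enorm sqrrN ltrDl.
by rewrite exprn_gt0//; move: Hx; rewrite /halfplane/= => h; lra.
Qed.

Lemma enorm_is_derive x v : halfplane x ->
  is_derive x v enorm ((x.1 * v.1 + x.2 * v.2) / enorm x).
Proof.
move=> Hx; have r0 := enorm_gt0 Hx.
have h1 := is_derive_fst x v; have h2 := is_derive_snd x v.
have h := is_derive_add (is_derive_mul h1 h1) (is_derive_mul h2 h2).
have x0 : 0 < x.1 * x.1 + x.2 * x.2 by rewrite -!expr2 sqnorm_gt0.
have := is_derive_compV (b := fun y : R * R => y.1 * y.1 + y.2 * y.2) (is_derive1_sqrt x0) h.
have -> : (fun y : R * R => Num.sqrt (y.1 * y.1 + y.2 * y.2)) = enorm by [].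
move=> {}h; apply: (is_derive_eq h).
have -> : Num.sqrt (x.1 * x.1 + x.2 * x.2) = enorm x by [].
rewrite invfM; field; by rewrite gt_eqF.
Qed.

Lemma cos_sin_atan (q : R) :
  cos (2 * atan q) = (1 - q ^+ 2) / (1 + q ^+ 2) /\ sin (2 * atan q) = 2 * q / (1 + q ^+ 2).
Proof.
have q1 : 0 < 1 + q ^+ 2 by rewrite ltr_wpDr// sqr_ge0.
have c0 : cos (atan q) != 0.
  by rewrite cos_atan invr_neq0// gt_eqF// sqrtr_gt0.
have cE : cos (atan q) ^+ 2 = (1 + q ^+ 2)^-1.
  by rewrite cos_atan exprVn sqr_sqrtr// ltW.
have sE : sin (atan q) = q * cos (atan q).
  by rewrite -{2}[q]atanK /tan divfK.
have -> : 2 * atan q = atan q *+ 2 by rewrite mulr_natl.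
rewrite cos_mulr2n sin_mulr2n sE mulrCA -expr2 cE; split.
  by field; rewrite gt_eqF.
by rewrite -mulr_natl mulrA.
Qed.

Lemma ang_cos_sin x : halfplane x ->
  cos (ang x) = x.1 / enorm x /\ sin (ang x) = x.2 / enorm x.
Proof.
move=> Hx; have r0 := enorm_gt0 Hx; have xr0 := halfplane_fst_enorm Hx.
have rE := sqr_enorm x.
set r := enorm x in r0 xr0 rE *.
(* This identity evaluates 1 + tan^2(s/2), the denominator in the double-angle formulas. *)
have D : (x.1 + r) ^+ 2 + x.2 ^+ 2 = 2 * r * (x.1 + r).
  have -> : x.2 ^+ 2 = r ^+ 2 - x.1 ^+ 2 by rewrite rE; ring.
  by ring.
have E : 1 + (x.2 / (x.1 + r)) ^+ 2 = 2 * r / (x.1 + r).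
  have -> : 1 + (x.2 / (x.1 + r)) ^+ 2 = ((x.1 + r) ^+ 2 + x.2 ^+ 2) / (x.1 + r) ^+ 2.
    by field; rewrite gt_eqF.
  by rewrite D; field; rewrite gt_eqF.
have [-> ->] := cos_sin_atan (x.2 / (x.1 + r)); rewrite E; split; last first.
  by field; rewrite !gt_eqF.
have -> : 1 - (x.2 / (x.1 + r)) ^+ 2 = 2 - (1 + (x.2 / (x.1 + r)) ^+ 2) by ring.
by rewrite E; field; rewrite !gt_eqF.
Qed.

(** [dircos i] and [dirsin i] are the components of e_i in the frame (e_r, e_theta). With t = log r
    this gives d_i = exp(-t) (dircos i d_t + dirsin i d_s), the operator [polD] below. *)
Definition dircos i : R -> R := if i == ord0 then cos else sin.
Definition dirsin i : R -> R := if i == ord0 then (fun s => - sin s) else cos.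

Lemma smooth1_dircos i : smooth1 (dircos i).
Proof. by rewrite /dircos; case: ifP => _; [exact: smooth1_cos|exact: smooth1_sin]. Qed.

Lemma smooth1_dirsin i : smooth1 (dirsin i).
Proof.
rewrite /dirsin; case: ifP => _; last exact: smooth1_cos.
by apply: smooth1N; exact: smooth1_sin.
Qed.

Lemma logr_is_derive i x : halfplane x ->
  is_derive x (basis_vec i) logr (expR (- logr x) * dircos i (ang x)).
Proof.
move=> Hx; have r0 := enorm_gt0 Hx.
have h := is_derive_compV (b := enorm) (is_derive1_ln r0) (enorm_is_derive (basis_vec i) Hx).
apply: (is_derive_eq h); rewrite expRN expR_logr//.
have [cE sE] := ang_cos_sin Hx.
rewrite /dircos /basis_vec; case: ifP => _ /=; rewrite ?cE ?sE; ring.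
Qed.

Lemma ang_is_derive i x : halfplane x ->
  is_derive x (basis_vec i) ang (expR (- logr x) * dirsin i (ang x)).
Proof.
move=> Hx; have r0 := enorm_gt0 Hx; have xr0 := halfplane_fst_enorm Hx.
set v := basis_vec i.
have d0 : x.1 + enorm x != 0 by rewrite gt_eqF.
have h1 := is_derive_add (is_derive_fst x v) (enorm_is_derive v Hx).
have dV : is_derive (x.1 + enorm x) 1 (fun z : R => z^-1) (- (x.1 + enorm x) ^- 2).
  have := @is_deriveV R id _ _ _ d0 (is_derive_id _ _) => /(_ 1) h.
  by apply: (is_derive_eq h); rewrite [_%:A]mulr1.
have h2 := is_derive_mul (is_derive_snd x v)
  (is_derive_compV (b := fun y : R * R => y.1 + enorm y) dV h1).
have h := is_derive_mul (is_derive_cst (2 : R) x v)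
  (is_derive_compV (b := fun y : R * R => y.2 / (y.1 + enorm y)) (is_derive1_atan (x.2 / (x.1 + enorm x))) h2).
apply: (is_derive_eq h); rewrite {h h1 h2} /cst mul0r add0r expRN expR_logr//.
have [cE sE] := ang_cos_sin Hx.
have rE := sqr_enorm x.
set r := enorm x in r0 xr0 rE d0 cE sE *.
have D : (x.1 + r) ^+ 2 + x.2 ^+ 2 = 2 * r * (x.1 + r).
  have -> : x.2 ^+ 2 = r ^+ 2 - x.1 ^+ 2 by rewrite rE; ring.
  by ring.
have -> : (1 + (x.2 / (x.1 + r)) ^+ 2)^-1 = (x.1 + r) / (2 * r).
  have -> : 1 + (x.2 / (x.1 + r)) ^+ 2 = ((x.1 + r) ^+ 2 + x.2 ^+ 2) / (x.1 + r) ^+ 2.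
    by field; rewrite gt_eqF.
  by rewrite D; field; rewrite !gt_eqF.
rewrite /dirsin /v /basis_vec; case: ifP => _ /=; rewrite ?cE ?sE.
  by field; rewrite !gt_eqF.
have -> : x.1 / r = (x.1 * r) / r ^+ 2 by field; rewrite gt_eqF.
have x2E : x.2 * x.2 = r ^+ 2 - x.1 ^+ 2 by rewrite rE; ring.
have -> : 2 * ((x.1 + r) / (2 * r) *
    (1 * (x.1 + r)^-1 + x.2 * (- (x.1 + r) ^- 2 * (0 + (x.1 * 0 + x.2 * 1) / r)))) =
    ((x.1 + r) * r - x.2 * x.2) / (r ^+ 2 * (x.1 + r)).
  by field; rewrite !gt_eqF.
by rewrite x2E; field; rewrite !gt_eqF.
Qed.

End Polar.

(** * Finite sums of products a(log r) b(angle) *)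

Section Tensor.
Context {R : realType}.
Implicit Types (x : R * R) (i : 'I_2) (a b : R -> R) (H K : R -> R -> R)
  (P : (R -> R) -> Prop) (t s : R).

(** Separated variables make d_t and d_s act on one factor each, so existence and commutation of
    mixed derivatives need no two-variable theorem. The class [P] of the radial factors carries the
    order of vanishing at the corner. *)
Inductive tens P : (R -> R -> R) -> Prop :=
| tens0 : tens P (fun _ _ => 0)
| tensS a b H : P a -> smooth1 b -> tens P H ->
    tens P (fun t s => a t * b s + H t s).

Lemma tens1 P a b : P a -> smooth1 b -> tens P (fun t s => a t * b s).
Proof.
move=> Pa sb; have -> : (fun t s => a t * b s) = (fun t s => a t * b s + 0).
  by apply/funext => t; apply/funext => s; rewrite addr0.
by apply: (@tensS P a b (fun _ _ => 0)) => //; exact: tens0.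
Qed.

Lemma tens_eq P H K : H = K -> tens P K -> tens P H. Proof. by move=> ->. Qed.

Lemma tensD P H K : tens P H -> tens P K -> tens P (fun t s => H t s + K t s).
Proof.
move=> + PK; elim=> [|a b H' Pa sb _ IH].
  by apply: tens_eq PK; apply/funext => t; apply/funext => s; rewrite add0r.
apply: tens_eq (tensS Pa sb IH).
by apply/funext => t; apply/funext => s; rewrite addrA.
Qed.

Lemma tens_sub P P' H : (forall a, P a -> P' a) -> tens P H -> tens P' H.
Proof.
move=> PP'; elim=> [|a b H' Pa sb _ IH]; first exact: tens0.
by apply: tensS => //; exact: PP'.
Qed.

Lemma tensM P P' P'' H K : (forall a a', P a -> P' a' -> P'' (fun t => a t * a' t)) ->
  tens P H -> tens P' K -> tens P'' (fun t s => H t s * K t s).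
Proof.
move=> PP + PK; elim=> [|a b H' Pa sb _ IH].
  apply: tens_eq (tens0 _).
  by apply/funext => t; apply/funext => s; rewrite mul0r.
have {}PK : tens P'' (fun t s => a t * b s * K t s).
  elim: PK => [|a' b' K' Pa' sb' _ IHK].
    apply: tens_eq (tens0 _).
    by apply/funext => t; apply/funext => s; rewrite mulr0.
  apply: tens_eq (tensS (PP _ _ Pa Pa') (smooth1M sb sb') IHK).
  by apply/funext => t; apply/funext => s; ring.
apply: tens_eq (tensD PK IH).
by apply/funext => t; apply/funext => s; ring.
Qed.

Lemma tensMb P b H : smooth1 b -> tens P H -> tens P (fun t s => b s * H t s).
Proof.
move=> sb; elim=> [|a b' H' Pa sb' _ IH].
  apply: tens_eq (tens0 _).
  by apply/funext => t; apply/funext => s; rewrite mulr0.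
apply: tens_eq (tensS Pa (smooth1M sb sb') IH).
by apply/funext => t; apply/funext => s; ring.
Qed.

Lemma tensMa P P' a H : (forall a', P a' -> P' (fun t => a t * a' t)) ->
  tens P H -> tens P' (fun t s => a t * H t s).
Proof.
move=> PP'; elim=> [|a' b' H' Pa sb' _ IH].
  apply: tens_eq (tens0 _).
  by apply/funext => t; apply/funext => s; rewrite mulr0.
apply: tens_eq (tensS (PP' _ Pa) sb' IH).
by apply/funext => t; apply/funext => s; ring.
Qed.

Lemma tensZ P (c : R) H : tens P H -> tens P (fun t s => c * H t s).
Proof. by move=> PH; apply: (tensMb (smooth1_cst c) PH). Qed.

Lemma tensN P H : tens P H -> tens P (fun t s => - H t s).
Proof.
move=> PH; apply: tens_eq (tensZ (-1) PH).
by apply/funext => t; apply/funext => s; rewrite mulN1r.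
Qed.

Lemma tensB P H K : tens P H -> tens P K -> tens P (fun t s => H t s - K t s).
Proof. by move=> PH PK; exact: (tensD PH (tensN PK)). Qed.

Definition dT H : R -> R -> R := fun t s => derive1 (fun t' => H t' s) t.
Definition dS H : R -> R -> R := fun t s => derive1 (H t) s.

Lemma derive1_is (f : R -> R) (t d : R) : is_derive t 1 f d -> derive1 f t = d.
Proof. by move=> h; rewrite derive1E derive_val. Qed.

Lemma tens_dT H t s : tens smooth1 H -> is_derive t 1 (fun t' => H t' s) (dT H t s).
Proof.
move=> sH; suff [d hd] : exists d, is_derive t 1 (fun t' => H t' s) d.
  by apply: (is_derive_eq hd); rewrite /dT (derive1_is hd).
elim: sH => [|a b H' sa sb _ [d IH]]; first by exists 0; exact: is_derive_cst.
exists (derive1 a t * b s + a t * 0 + d).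
apply: is_derive_add IH.
exact: is_derive_mul (smooth1_isd t sa) (is_derive_cst (b s) t 1).
Qed.

Lemma tens_dS H t s : tens smooth1 H -> is_derive s 1 (H t) (dS H t s).
Proof.
move=> sH; suff [d hd] : exists d, is_derive s 1 (H t) d.
  by apply: (is_derive_eq hd); rewrite /dS (derive1_is hd).
elim: sH => [|a b H' sa sb _ [d IH]]; first by exists 0; exact: is_derive_cst.
exists (0 * b s + a t * derive1 b s + d).
apply: is_derive_add IH.
exact: is_derive_mul (is_derive_cst (a t) s 1) (smooth1_isd s sb).
Qed.

Lemma dTD H K : tens smooth1 H -> tens smooth1 K ->
  dT (fun t s => H t s + K t s) = fun t s => dT H t s + dT K t s.
Proof.
move=> sH sK; apply/funext => t; apply/funext => s; apply: derive1_is.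
by apply: is_derive_add; exact: tens_dT.
Qed.

Lemma dSD H K : tens smooth1 H -> tens smooth1 K ->
  dS (fun t s => H t s + K t s) = fun t s => dS H t s + dS K t s.
Proof.
move=> sH sK; apply/funext => t; apply/funext => s; apply: derive1_is.
by apply: is_derive_add; exact: tens_dS.
Qed.

Lemma dTM H K : tens smooth1 H -> tens smooth1 K ->
  dT (fun t s => H t s * K t s) = fun t s => dT H t s * K t s + H t s * dT K t s.
Proof.
move=> sH sK; apply/funext => t; apply/funext => s; apply: derive1_is.
by apply: is_derive_mul; exact: tens_dT.
Qed.

Lemma dSM H K : tens smooth1 H -> tens smooth1 K ->
  dS (fun t s => H t s * K t s) = fun t s => dS H t s * K t s + H t s * dS K t s.
Proof.
move=> sH sK; apply/funext => t; apply/funext => s; apply: derive1_is.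
by apply: is_derive_mul; exact: tens_dS.
Qed.

Lemma dTa a : smooth1 a -> dT (fun t _ => a t) = fun t _ => derive1 a t.
Proof. by []. Qed.

Lemma dSa a : dS (fun t _ => a t) = fun _ _ => 0.
Proof.
by apply/funext => t; apply/funext => s; apply: derive1_is; exact: is_derive_cst.
Qed.

Lemma dTb b : dT (fun _ s => b s) = fun _ _ => 0.
Proof.
by apply/funext => t; apply/funext => s; apply: derive1_is; exact: is_derive_cst.
Qed.

Lemma dSb b : dS (fun _ s => b s) = fun _ s => derive1 b s.
Proof. by []. Qed.

Lemma tens_a P a : P a -> tens P (fun t _ => a t).
Proof.
move=> Pa; apply: tens_eq (tens1 Pa (smooth1_cst 1)).
by apply/funext => t; apply/funext => s; rewrite mulr1.
Qed.

Lemma tens_b P b : P (fun=> 1) -> smooth1 b -> tens P (fun _ s => b s).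
Proof.
move=> P1 sb; apply: tens_eq (tens1 P1 sb).
by apply/funext => t; apply/funext => s; rewrite mul1r.
Qed.

Lemma dTgen a b : smooth1 a ->
  dT (fun t s => a t * b s) = fun t s => derive1 a t * b s.
Proof.
move=> sa; apply/funext => t; apply/funext => s; apply: derive1_is.
have h := is_derive_mul (smooth1_isd t sa) (is_derive_cst (b s) t 1).
by apply: (is_derive_eq h); rewrite mulr0 addr0.
Qed.

Lemma dSgen a b : smooth1 b ->
  dS (fun t s => a t * b s) = fun t s => a t * derive1 b s.
Proof.
move=> sb; apply/funext => t; apply/funext => s; apply: derive1_is.
have h := is_derive_mul (is_derive_cst (a t) s 1) (smooth1_isd s sb).
by apply: (is_derive_eq h); rewrite mul0r add0r.
Qed.

Lemma tens_smooth_gen a b : smooth1 a -> smooth1 b -> tens smooth1 (fun t s => a t * b s).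
Proof. by move=> sa sb; exact: tens1. Qed.

Definition dclosed P := forall a, P a -> smooth1 a /\ P (derive1 a).

Lemma dclosed_smooth P H : dclosed P -> tens P H -> tens smooth1 H.
Proof. by move=> dP; apply: tens_sub => a /dP[]. Qed.

Lemma tensdT P H : dclosed P -> tens P H -> tens P (dT H).
Proof.
move=> dP; elim=> [|a b H' Pa sb PH IH].
  by rewrite dTb; exact: tens0.
have [sa Pa'] := dP _ Pa.
have sg := tens_smooth_gen sa sb; have sH := dclosed_smooth dP PH.
rewrite (dTD sg sH) (dTgen b sa); exact: tensS.
Qed.

Lemma tensdS P H : dclosed P -> tens P H -> tens P (dS H).
Proof.
move=> dP; elim=> [|a b H' Pa sb PH IH].
  by rewrite dSa; exact: tens0.
have [sa Pa'] := dP _ Pa.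
have sg := tens_smooth_gen sa sb; have sH := dclosed_smooth dP PH.
rewrite (dSD sg sH) (dSgen a sb); apply: tensS => //; exact: smooth1_derive.
Qed.

Lemma dclosed_smooth1 : dclosed smooth1.
Proof. by move=> a sa; split=> //; exact: smooth1_derive. Qed.

Lemma dTdS H : tens smooth1 H -> dT (dS H) = dS (dT H).
Proof.
elim=> [|a b H' sa sb sH IH]; first by rewrite dSa !dTb dSa.
have sg := tens_smooth_gen sa sb.
have sa' := smooth1_derive sa; have sb' := smooth1_derive sb.
have sSg := tens_smooth_gen sa sb'; have sTg := tens_smooth_gen sa' sb.
have sSH := tensdS dclosed_smooth1 sH; have sTH := tensdT dclosed_smooth1 sH.
rewrite (dSD sg sH) (dTD sg sH) (dSgen a sb) (dTgen b sa).
rewrite (dTD sSg sSH) (dSD sTg sTH) (dTgen (derive1 b) sa) (dSgen (derive1 a) sb).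
by rewrite IH.
Qed.

Definition pol H x : R := H (logr x) (ang x).

Definition polD i H : R -> R -> R := fun t s =>
  expR (- t) * (dircos i s * dT H t s + dirsin i s * dS H t s).

Lemma smooth1_expN : smooth1 (fun t => expR (- t)).
Proof.
by apply: smooth1_comp; [exact: smooth1_expR|apply: smooth1N; exact: smooth1_id].
Qed.

Lemma tens_polD P P' i H : dclosed P ->
  (forall a, P a -> P' (fun t => expR (- t) * a t)) ->
  tens P H -> tens P' (polD i H).
Proof.
move=> dP PP' PH; apply: (tensMa PP'); apply: tensD.
  by apply: tensMb; [exact: smooth1_dircos|exact: tensdT].
by apply: tensMb; [exact: smooth1_dirsin|exact: tensdS].
Qed.

Lemma tens_polD_smooth i H : tens smooth1 H -> tens smooth1 (polD i H).
Proof.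
apply: tens_polD; first exact: dclosed_smooth1.
by move=> a sa; apply: smooth1M => //; exact: smooth1_expN.
Qed.

Lemma pol_is_derive i H x : tens smooth1 H -> halfplane x ->
  is_derive x (basis_vec i) (pol H) (pol (polD i H) x).
Proof.
move=> sH Hx; elim: sH => [|a b H' sa sb sH IH].
  rewrite /pol /polD dTb dSa !mulr0 addr0 mulr0; exact: is_derive_cst.
have h1 := is_derive_compV (smooth1_isd (logr x) sa) (logr_is_derive i Hx).
have h2 := is_derive_compV (smooth1_isd (ang x) sb) (ang_is_derive i Hx).
have h := is_derive_add (is_derive_mul h1 h2) IH.
apply: (is_derive_eq h); rewrite /pol /polD.
have sg := tens_smooth_gen sa sb.
rewrite (dTD sg sH) (dSD sg sH) (dTgen b sa) (dSgen a sb); ring.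
Qed.

Lemma enorm_continuous : continuous (@enorm R).
Proof.
move=> x; apply: (@continuous_comp _ _ _ (fun y : R * R => y.1 ^+ 2 + y.2 ^+ 2) Num.sqrt).
  apply: (@continuousD _ _ _ (fun y : R * R => y.1 ^+ 2) (fun y : R * R => y.2 ^+ 2)).
    by apply: (@continuousM _ _ fst fst); exact: cvg_fst.
  by apply: (@continuousM _ _ snd snd); exact: cvg_snd.
exact: sqrt_continuous.
Qed.

Lemma logr_continuous x : halfplane x -> {for x, continuous logr}.
Proof.
move=> Hx; have -> : @logr R = @ln R \o @enorm R by [].
apply: continuous_comp; first exact: enorm_continuous.
by apply: continuous_ln; exact: enorm_gt0.
Qed.

Lemma ang_continuous x : halfplane x -> {for x, continuous ang}.
Proof.
move=> Hx; have -> : @ang R = fun y => 2 * atan (y.2 / (y.1 + enorm y)) by [].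
apply: continuousM; first exact: cvg_cst.
have -> : (fun y : R * R => atan (y.2 / (y.1 + enorm y))) =
  @atan R \o (fun y => y.2 / (y.1 + enorm y)) by [].
apply: continuous_comp; last exact: continuous_atan.
apply: continuousM; first exact: cvg_snd.
apply: continuousV; first by rewrite gt_eqF// halfplane_fst_enorm.
by apply: (@continuousD _ _ _ fst enorm); [exact: cvg_fst|exact: enorm_continuous].
Qed.

Lemma pol_continuous H x : tens smooth1 H -> halfplane x -> {for x, continuous (pol H)}.
Proof.
move=> sH Hx; have cl := logr_continuous Hx; have ca := ang_continuous Hx.
elim: sH => [|a b H' sa sb sH IH]; first exact: cvg_cst.
apply: (@continuousD _ _ _ (fun y => a (logr y) * b (ang y)) (pol H')); last exact: IH.
apply: (@continuousM _ _ (fun y => a (logr y)) (fun y => b (ang y))).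
  by apply: (@continuous_comp _ _ _ logr a) => //; exact: smooth1_cont.
by apply: (@continuous_comp _ _ _ ang b) => //; exact: smooth1_cont.
Qed.

Lemma smoothOm_pol H : tens smooth1 H -> smoothOm (pol H).
Proof.
move=> sH; apply: (@smoothOm_coind _ (fun h => exists2 H, tens smooth1 H & h = pol H)).
  move=> _ [K sK ->]; split=> [x Hx|i]; first exact: pol_continuous.
  split=> [x Hx|]; first by have := pol_is_derive i sK Hx => ?; exact: ex_derive.
  exists (pol (polD i K)).
    by exists (polD i K) => //; exact: tens_polD_smooth.
  by move=> x Hx; have := pol_is_derive i sK Hx => ?; exact: derive_val.
by exists H.
Qed.

Lemma partial_pol i H x : tens smooth1 H -> halfplane x ->
  'D_(basis_vec i) (pol H) x = pol (polD i H) x.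
Proof. by move=> sH Hx; have := pol_is_derive i sH Hx => ?; exact: derive_val. Qed.

End Tensor.

(** * The Hessian determinant in polar coordinates *)

Section Hessian.
Context {R : realType}.
Implicit Types (x : R * R) (i j : 'I_2) (a b : R -> R) (H K : R -> R -> R) (t s : R).

Lemma derive1_dircos i : derive1 (@dircos R i) = dirsin i.
Proof.
apply/funext => s; rewrite /dircos /dirsin; case: ifP => _; apply: derive1_is.
Qed.

Lemma derive1_dirsin i : derive1 (@dirsin R i) = fun s => - dircos i s.
Proof.
apply/funext => s; rewrite /dircos /dirsin; case: ifP => _; apply: derive1_is.
Qed.

Lemma derive1_expN : derive1 (fun t => expR (- t)) = fun t => - expR (- t).
Proof.
apply/funext => t; apply: derive1_is.
have h := is_derive_comp1 (is_derive_expR (- t)) (is_deriveNid t 1).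
by apply: (is_derive_eq h); rewrite mulrN1.
Qed.


Lemma polDD i j H t s : tens smooth1 H ->
  polD j (polD i H) t s = expR (- t) * expR (- t) *
   (dircos i s * dircos j s * dT (dT H) t s +
    (dircos j s * dirsin i s + dirsin j s * dircos i s) * (dT (dS H) t s - dS H t s) +
    dirsin i s * dirsin j s * dS (dS H) t s +
    (dirsin i s * dirsin j s - dircos i s * dircos j s) * dT H t s).
Proof.
move=> sH; have d1 := @dclosed_smooth1 R.
have sT := tensdT d1 sH; have sS := tensdS d1 sH.
have sc := @smooth1_dircos R i; have ss := @smooth1_dirsin R i.
have one : smooth1 (fun=> 1 : R) by exact: smooth1_cst.
have tc := tens_b (P := smooth1) one sc; have ts := tens_b (P := smooth1) one ss.
have te := tens_a (P := smooth1) (@smooth1_expN R).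
have tcT := tensMb sc sT; have tsS := tensMb ss sS; have tsum := tensD tcT tsS.
have -> : polD i H = (fun t s => expR (- t) * (dircos i s * dT H t s + dirsin i s * dS H t s)).
  by [].
rewrite {1}/polD (dTM te tsum) (dSM te tsum) (dTD tcT tsS) (dSD tcT tsS).
rewrite (dTM tc sT) (dTM ts sS) (dSM tc sT) (dSM ts sS).
rewrite dTa ?dSa ?dTb ?dSb; last exact: smooth1_expN.
rewrite derive1_expN derive1_dircos derive1_dirsin -(dTdS sH).
move: (expR (- t)) (dT (dT H) t s) (dT (dS H) t s) (dS (dS H) t s) (dT H t s)
  (dS H t s) (dircos i s) (dircos j s) (dirsin i s) (dirsin j s) => e p q r u v c c' d d'.
ring.
Qed.

Lemma polDC i j H : tens smooth1 H -> polD j (polD i H) = polD i (polD j H).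
Proof.
move=> sH; apply/funext => t; apply/funext => s; rewrite !polDD//.
move: (expR (- t)) (dT (dT H) t s) (dT (dS H) t s) (dS (dS H) t s) (dT H t s)
  (dS H t s) (dircos i s) (dircos j s) (dirsin i s) (dirsin j s) => e p q r u v c c' d d'.
ring.
Qed.

(* The entries of the Hessian of pol H in the rotating frame (e_r, e_theta). *)
Definition hrr H : R -> R -> R := fun t s =>
  expR (- t) * expR (- t) * (dT (dT H) t s - dT H t s).
Definition hss H : R -> R -> R := fun t s =>
  expR (- t) * expR (- t) * (dS (dS H) t s + dT H t s).
Definition hrs H : R -> R -> R := fun t s =>
  expR (- t) * expR (- t) * (dT (dS H) t s - dS H t s).

Definition hdet H : R -> R -> R := fun t s =>
  (1 + hrr H t s) * (1 + hss H t s) - hrs H t s * hrs H t s.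

(** The passage to the frame (e_r, e_theta) is a rotation, which changes neither the trace nor the
    determinant of the Hessian; in the computation this is cos^2 + sin^2 = 1, used once in the trace
    and squared in the determinant. *)
Lemma hdetE H t s : tens smooth1 H ->
  (1 + polD 0 (polD 0 H) t s) * (1 + polD 1 (polD 1 H) t s) -
  polD 0 (polD 1 H) t s * polD 1 (polD 0 H) t s = hdet H t s.
Proof.
move=> sH; rewrite !polDD// /hdet /hrr /hss /hrs /dircos /dirsin /=.
have := cos2Dsin2 s.
move: (expR (- t)) (dT (dT H) t s) (dT (dS H) t s) (dS (dS H) t s) (dT H t s)
  (dS H t s) (cos s) (sin s) => e p q r u v c d E.
transitivity (1 + e * e * (c ^+ 2 + d ^+ 2) * (p + r) +
  (e * e * (c ^+ 2 + d ^+ 2)) ^+ 2 * ((p - u) * (r + u) - (q - v) ^+ 2)); first by ring.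
by rewrite E; ring.
Qed.

End Hessian.

(** * The Neumann problem for one homogeneous degree *)

Section FormalSolve.
Context {R : realType}.
Implicit Types (a b p : R -> R) (H K q : R -> R -> R) (t s : R).

Lemma is_derive_cosM (m s : R) : is_derive s 1 (fun s => cos (m * s)) (- (m * sin (m * s))).
Proof.
have h0 := is_derive_mul (is_derive_cst m s 1) (is_derive_id s 1).
have h := is_derive_comp1 (is_derive_cos (m * s)) h0.
by apply: (is_derive_eq h); rewrite /cst; ring.
Qed.

Lemma is_derive_sinM (m s : R) : is_derive s 1 (fun s => sin (m * s)) (m * cos (m * s)).
Proof.
have h0 := is_derive_mul (is_derive_cst m s 1) (is_derive_id s 1).
have h := is_derive_comp1 (is_derive_sin (m * s)) h0.
by apply: (is_derive_eq h); rewrite /cst; ring.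
Qed.

Lemma smooth1_cosM (m : R) : smooth1 (fun s => cos (m * s)).
Proof. by apply: (smooth1_comp smooth1_cos); apply: smooth1Z; exact: smooth1_id. Qed.

Lemma smooth1_sinM (m : R) : smooth1 (fun s => sin (m * s)).
Proof. by apply: (smooth1_comp smooth1_sin); apply: smooth1Z; exact: smooth1_id. Qed.

Lemma sin_natpi n : sin (n%:R * pi) = 0 :> R.
Proof.
elim: n => [|n IH]; first by rewrite mul0r sin0.
by rewrite -natr1 mulrDl mul1r sinDpi IH oppr0.
Qed.

(** Fredholm alternative: for m = 2k the function cos(ms) solves the homogeneous Neumann problem on
    [0, pi/2], so the component of [b] along it has to be removed before a solution exists. *)
Lemma neumann_ode (k : nat) b : smooth1 b -> (0 < k)%N ->
  let m : R := k.*2%:R in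
  exists (c : R) p, [/\ smooth1 p, derive1 p 0 = 0, derive1 p (pi / 2) = 0 &
    forall s, derive1 (derive1 p) s + m ^+ 2 * p s = b s - c * cos (m * s)].
Proof.
move=> sb k0 m.
have m0 : m != 0 by rewrite pnatr_eq0 -lt0n double_gt0.
have mE : m * (pi / 2) = k%:R * pi by rewrite /m -muln2 natrM; field.
have sc := smooth1_cosM m; have ss := smooth1_sinM m.
have [A [A0 sA dA]] := smooth1_antiderivative (smooth1M sb sc).
have [C [C0 sC dC]] := smooth1_antiderivative (smooth1M sc sc).
(* The integral of cos^2(ms) over [0, pi/2], read off from the explicit antiderivative [C'], since
   sin(m pi / 2) = sin(k pi) = 0. *)
have C1 : C (pi / 2) = pi / 4.
  pose C' s := 2^-1 * s + (2 * m)^-1 * (sin (m * s) * cos (m * s)).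
  have dC' s : is_derive s 1 C' (cos (m * s) * cos (m * s)).
    have h1 := is_derive_mul (is_derive_cst (2^-1 : R) s 1) (is_derive_id s 1).
    have h2 := is_derive_mul (is_derive_cst ((2 * m)^-1 : R) s 1)
      (is_derive_mul (is_derive_sinM m s) (is_derive_cosM m s)).
    apply: (is_derive_eq (is_derive_add h1 h2)); rewrite /cst.
    have := sin2cos2 (m * s).
    move: (sin _) (cos _) => u v E.
    have -> : m * v * v + u * - (m * u) = m * (v ^+ 2 - u ^+ 2) by ring.
    by rewrite E; field.
  have -> : C (pi / 2) = C' (pi / 2).
    have dCs s : is_derive s 1 C (cos (m * s) * cos (m * s)).
      by have := smooth1_isd s sC; rewrite dC.
    have := pihalf_lt2 R; have := pihalf_ge1 R => h1 h2.
    apply: (@eq_antiderivative _ C C' (fun s => cos (m * s) * cos (m * s)) (-1) 4) => //.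
    - by rewrite ltrN10 ltr0n.
    - by rewrite C0 /C' !mulr0 sin0 mul0r mulr0 addr0.
    - by apply/andP; split; lra.
  by rewrite /C' mE sin_natpi mul0r mulr0 addr0; field.
have pi0 := pi_gt0 R.
(* The projection coefficient of [b] on cos(ms): it makes [b1] orthogonal to cos(ms), that is
   [A1 (pi / 2) = 0]. *)
pose c := A (pi / 2) / (pi / 4).
pose b1 s := b s - c * cos (m * s).
have sb1 : smooth1 b1.
  by apply: smooth1D => //; apply: smooth1N; exact: smooth1Z.
pose A1 s := A s - c * C s.
have dA1 s : is_derive s 1 A1 (b1 s * cos (m * s)).
  have hA := smooth1_isd s sA; have hC := smooth1_isd s sC.
  have h := is_deriveB hA (is_derive_mul (is_derive_cst c s 1) hC).
  by apply: (is_derive_eq h); rewrite dA dC /b1 /cst; ring.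
have A10 : A1 0 = 0 by rewrite /A1 A0 C0 mulr0 subr0.
have A1p : A1 (pi / 2) = 0 by rewrite /A1 C1 /c; rewrite divfK ?subrr// gt_eqF// divr_gt0.
have [B [B0 sB dB]] := smooth1_antiderivative (smooth1M sb1 ss).
(* Variation of constants. The terms with [b1] cancel in the first derivative [p1], whose value at 0
   is [A1 0] and at pi/2 is [A1 (pi / 2)] up to sign, so both Neumann conditions hold. *)
pose p s := m^-1 * (sin (m * s) * A1 s - cos (m * s) * B s).
pose p1 s := cos (m * s) * A1 s + sin (m * s) * B s.
have hB s : is_derive s 1 B (b1 s * sin (m * s)) by have := smooth1_isd s sB; rewrite dB; exact.
have hc := is_derive_cosM m; have hs := is_derive_sinM m.
have hp s : is_derive s 1 p (p1 s).
  have h := is_derive_mul (is_derive_cst (m^-1 : R) s 1)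
    (is_deriveB (is_derive_mul (hs s) (dA1 s)) (is_derive_mul (hc s) (hB s))).
  apply: (is_derive_eq h); rewrite /p1 /cst.
  by move: (sin _) (cos _) (A1 s) (b1 s) (B s) => ? ? ? ? ?; field.
have hp1 s : is_derive s 1 p1 (b1 s - m ^+ 2 * p s).
  have h := is_derive_add (is_derive_mul (hc s) (dA1 s)) (is_derive_mul (hs s) (hB s)).
  apply: (is_derive_eq h); rewrite /p.
  have := sin2cos2 (m * s).
  move: (sin _) (cos _) (A1 s) (b1 s) (B s) => u v x y z E.
  have -> : - (m * u) * x + v * (y * v) + (m * v * z + u * (y * u)) =
    y * v ^+ 2 + y * u ^+ 2 - m * (u * x - v * z) by ring.
  by rewrite E; field.
have dp : derive1 p = p1 by apply/funext => s; exact: derive1_is.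
have sA1 : smooth1 A1.
  by apply: smooth1D => //; apply: smooth1N; exact: smooth1Z.
exists c, p; split.
- apply: smooth1Z; apply: smooth1D; first exact: smooth1M.
  by apply: smooth1N; exact: smooth1M.
- by rewrite dp /p1 A10 B0 !mulr0 addr0.
- by rewrite dp /p1 A1p mE sin_natpi mulr0 mul0r addr0.
- by move=> s; rewrite dp (derive1_is (hp1 s)) subrK.
Qed.

(** Polynomials in t of degree below [J] with coefficients smooth in s; the recursion exposes the
    top coefficient, which is the one solved for in each induction step. *)
Fixpoint tpoly (J : nat) q : Prop :=
  if J is J'.+1 then
    exists b q', [/\ smooth1 b, tpoly J' q' & q = fun t s => t ^+ J' * b s + q' t s]
  else q = fun _ _ => 0.

Lemma tpolyW J q : tpoly J q -> tpoly J.+1 q.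
Proof.
move=> Jq; exists (fun=> 0), q; split=> //; first exact: smooth1_cst.
by apply/funext => t; apply/funext => s; rewrite mulr0 add0r.
Qed.

Lemma tpoly_le J J' q : (J <= J')%N -> tpoly J q -> tpoly J' q.
Proof. by move=> /subnK <-; elim: (J' - J)%N => [//|n IH] /IH; exact: tpolyW. Qed.

Lemma tpolyD J q q' : tpoly J q -> tpoly J q' -> tpoly J (fun t s => q t s + q' t s).
Proof.
elim: J q q' => [|J IH] q q' /=.
  by move=> -> ->; apply/funext => t; apply/funext => s; rewrite addr0.
move=> [b [r [sb Jr ->]]] [b' [r' [sb' Jr' ->]]].
exists (fun s => b s + b' s), (fun t s => r t s + r' t s); split.
- exact: smooth1D.
- exact: IH.
- by apply/funext => t; apply/funext => s; ring.
Qed.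

Lemma tpolyZ J b q : smooth1 b -> tpoly J q -> tpoly J (fun t s => b s * q t s).
Proof.
move=> sb; elim: J q => [|J IH] q /=.
  by move=> ->; apply/funext => t; apply/funext => s; rewrite mulr0.
move=> [b' [r [sb' Jr ->]]].
exists (fun s => b s * b' s), (fun t s => b s * r t s); split.
- exact: smooth1M.
- exact: IH.
- by apply/funext => t; apply/funext => s; ring.
Qed.

Lemma tpoly1 J b : smooth1 b -> tpoly J.+1 (fun t s => t ^+ J * b s).
Proof.
move=> sb; exists b, (fun _ _ => 0); split=> //.
  by elim: J => [//|J IH]; exact: tpolyW.
by apply/funext => t; apply/funext => s; rewrite addr0.
Qed.

Lemma smooth1_exp n : smooth1 (fun t : R => t ^+ n).
Proof. by apply: smooth1X; exact: smooth1_id. Qed.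

Lemma derive1_exp n : derive1 (fun t : R => t ^+ n) = fun t => n%:R * t ^+ n.-1.
Proof.
by apply/funext => t; rewrite exp_derive1.
Qed.

Lemma tpoly_tens J q : tpoly J q -> tens smooth1 q.
Proof.
elim: J q => [|J IH] q /=; first by move=> ->; exact: tens0.
by move=> [b [r [sb Jr ->]]]; apply: tensS (IH _ Jr) => //; exact: smooth1_exp.
Qed.

(* exp(-mt) (d_t^2 + d_s^2) exp(mt) *)
Definition mode_laplacian (m : R) H : R -> R -> R := fun t s =>
  dT (dT H) t s + 2 * m * dT H t s + m ^+ 2 * H t s + dS (dS H) t s.

Lemma mode_laplacianD m H K : tens smooth1 H -> tens smooth1 K ->
  mode_laplacian m (fun t s => H t s + K t s) =
  fun t s => mode_laplacian m H t s + mode_laplacian m K t s.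
Proof.
move=> sH sK; have d1 := @dclosed_smooth1 R.
apply/funext => t; apply/funext => s; rewrite /mode_laplacian.
rewrite (dTD sH sK) (dSD sH sK) (dTD (tensdT d1 sH) (tensdT d1 sK)).
rewrite (dSD (tensdS d1 sH) (tensdS d1 sK)).
move: (dT (dT H) t s) (dT (dT K) t s) (dS (dS H) t s) (dS (dS K) t s) (dT H t s) (dT K t s).
by move=> *; ring.
Qed.

Lemma mode_laplacian_gen m n b : smooth1 b ->
  mode_laplacian m (fun t s => t ^+ n * b s) = fun t s =>
    n%:R * n.-1%:R * t ^+ n.-2 * b s + 2 * m * n%:R * t ^+ n.-1 * b s +
    t ^+ n * (derive1 (derive1 b) s + m ^+ 2 * b s).
Proof.
move=> sb; apply/funext => t; apply/funext => s; rewrite /mode_laplacian.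
rewrite (dTgen b (smooth1_exp n)) (dSgen _ sb) (dSgen _ (smooth1_derive sb)).
rewrite (dTgen b (smooth1_derive (smooth1_exp n))) derive1_exp.
have -> : derive1 (fun t : R => n%:R * t ^+ n.-1) = fun t => n%:R * (n.-1%:R * t ^+ n.-2).
  have h := derive1M_smooth (smooth1_cst (n%:R : R)) (smooth1_exp n.-1).
  rewrite h derive1_exp; apply/funext => t'.
  rewrite [X in X * _](_ : _ = 0) ?mul0r ?add0r//.
  by apply: derive1_is; exact: is_derive_cst.
move: (derive1 (derive1 b) s) (t ^+ n.-2) (t ^+ n.-1) (t ^+ n) (b s).
by move=> *; ring.
Qed.

(** The top coefficient is solved by [neumann_ode]; the resonant remainder c cos(ms) is absorbed by
    a term t^(J+1) cos(ms), which raises the degree in t = log r by one. What is left has lower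
    degree in t and goes to the induction hypothesis. *)
Lemma neumann_mode (k J : nat) q : (0 < k)%N -> tpoly J q ->
  exists P, [/\ tpoly J.+1 P, (forall t, dS P t 0 = 0 /\ dS P t (pi / 2) = 0) &
    mode_laplacian k.*2%:R P = q].
Proof.
move=> k0; set m : R := k.*2%:R.
have m0 : m != 0 by rewrite pnatr_eq0 -lt0n double_gt0.
elim: J q => [|J IH] q.
  move=> /= ->; exists (fun _ _ => 0); split.
  - exact: (tpolyW (J := 0)).
  - by move=> t; rewrite dSa.
  - have T0 : dT (fun _ _ => 0 : R) = fun _ _ => 0 by exact: (dTb (fun=> 0)).
    have S0 : dS (fun _ _ => 0 : R) = fun _ _ => 0 by exact: (dSa (fun=> 0)).
    by apply/funext => t; apply/funext => s; rewrite /mode_laplacian T0 S0 T0 S0 !mulr0 !addr0.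
move=> [b [q' [sb Jq' ->]]].
have [c [p [sp p0 p1 pE]]] := neumann_ode sb k0.
have nz : 2 * m * J.+1%:R != 0.
  by rewrite mulf_neq0 ?pnatr_eq0// mulf_neq0// pnatr_eq0.
(* Since cos(ms) is annihilated by d_s^2 + m^2, the leading effect of [mode_laplacian] on t^(J+1)
   cos(ms) is 2 m (J+1) t^J cos(ms), from the first-order term. *)
pose c' := c / (2 * m * J.+1%:R).
have sc := smooth1_cosM m.
have scc := smooth1Z c' sc.
pose P0 t s := t ^+ J.+1 * (c' * cos (m * s)) + t ^+ J * p s.
pose rest t s := J.+1%:R * J%:R * (t ^+ J.-1 * (c' * cos (m * s))) +
   (J%:R * J.-1%:R * (t ^+ J.-2 * p s) + 2 * m * J%:R * (t ^+ J.-1 * p s)).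
have sg0 := tens_smooth_gen (smooth1_exp J.+1) scc.
have sg1 := tens_smooth_gen (smooth1_exp J) sp.
have LP0 : mode_laplacian m P0 = fun t s => t ^+ J * b s + rest t s.
  rewrite (mode_laplacianD m sg0 sg1) (mode_laplacian_gen m _ scc) (mode_laplacian_gen m _ sp).
  apply/funext => t; apply/funext => s.
  have {}pE : derive1 (derive1 p) s = b s - c * cos (m * s) - m ^+ 2 * p s.
    by rewrite -(pE s) addrK.
  set D := derive1 (derive1 p) s in pE *; rewrite {D}pE.
  have -> : derive1 (derive1 (fun s => c' * cos (m * s))) s = - m ^+ 2 * (c' * cos (m * s)).
    have -> : derive1 (fun s => c' * cos (m * s)) = fun s => - (c' * m) * sin (m * s).
      apply/funext => u; apply: derive1_is.
      have h := is_derive_mul (is_derive_cst c' u 1) (is_derive_cosM m u).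
      by apply: (is_derive_eq h); rewrite /cst; ring.
    apply: derive1_is.
    have h := is_derive_mul (is_derive_cst (- (c' * m)) s 1) (is_derive_sinM m s).
    by apply: (is_derive_eq h); rewrite /cst; ring.
  rewrite /rest /= -/m.
  have -> : c = c' * (2 * m * J.+1%:R).
    by rewrite /c' divfK.
  move: (t ^+ J.-2) (t ^+ J.-1) (t ^+ J.+1) (t ^+ J) (cos (m * s)) (p s) (b s).
  by move=> *; ring.
have Jrest : tpoly J rest.
  rewrite /rest; case: (J) => [|n].
    by apply/funext => t; apply/funext => s; ring.
  apply: tpolyD; first by apply: (tpolyZ (smooth1_cst _)); exact: tpoly1.
  apply: tpolyD; last by apply: (tpolyZ (smooth1_cst _)); exact: tpoly1.
  apply: (tpolyZ (smooth1_cst _)); apply: (tpoly_le (J := n.-1.+1)).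
    by case: n.
  exact: tpoly1.
have Jq1 : tpoly J (fun t s => q' t s + -1 * rest t s).
  by apply: tpolyD => //; exact: (tpolyZ (smooth1_cst (-1))).
have [P1 [JP1 nP1 LP1]] := IH _ Jq1.
have JP0 : tpoly J.+2 P0.
  apply: tpolyD; first exact: tpoly1.
  by apply: tpolyW; exact: tpoly1.
exists (fun t s => P0 t s + P1 t s); split.
- by apply: tpolyD => //; exact: tpolyW.
- have sP0 := tpoly_tens JP0; have sP1 := tpoly_tens JP1.
  move=> t; rewrite (dSD sP0 sP1) (dSD sg0 sg1) (dSgen _ scc) (dSgen _ sp).
  have -> : derive1 (fun s => c' * cos (m * s)) = fun s => - (c' * m) * sin (m * s).
    apply/funext => u; apply: derive1_is.
    have h := is_derive_mul (is_derive_cst c' u 1) (is_derive_cosM m u).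
    by apply: (is_derive_eq h); rewrite /cst; ring.
  have [-> ->] := nP1 t; rewrite p0 p1 mulr0 sin0.
  have -> : m * (pi / 2) = k%:R * pi by rewrite /m -muln2 natrM; field.
  by rewrite sin_natpi !mulr0 !addr0.
- rewrite (mode_laplacianD m (tpoly_tens JP0) (tpoly_tens JP1)) LP0 LP1.
  by apply/funext => t; apply/funext => s; ring.
Qed.

End FormalSolve.

(** * Expansions in r^(2j) (log r)^i and one correction step *)

Section FormalSeries.
Context {R : realType}.
Implicit Types (a b p : R -> R) (H K S q : R -> R -> R) (t s : R) (i j k n N J : nat).

(** With t = log r the summands are r^(2j) (log r)^i. The order [k] counts powers of r^2, as only
    even degrees occur in the expansion. *)
Inductive expoly k : (R -> R) -> Prop :=
| expoly0 : expoly k (fun=> 0)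
| expolyS (c : R) j i a : (k <= j)%N -> expoly k a ->
    expoly k (fun t => c * (expR (j.*2%:R * t) * t ^+ i) + a t).

Lemma expoly_eq k a b : a =1 b -> expoly k b -> expoly k a.
Proof. by move=> ab; have -> : a = b by apply/funext. Qed.

Lemma expoly1 k (c : R) j i : (k <= j)%N ->
  expoly k (fun t => c * (expR (j.*2%:R * t) * t ^+ i)).
Proof.
move=> kj; apply: expoly_eq (expolyS c i kj (expoly0 k)) => t.
by rewrite addr0.
Qed.

Lemma expolyD k a b : expoly k a -> expoly k b -> expoly k (fun t => a t + b t).
Proof.
move=> + kb; elim=> [|c j i a' kj _ IH].
  by apply: expoly_eq kb => t; rewrite add0r.
by apply: expoly_eq (expolyS c i kj IH) => t; rewrite addrA.
Qed.

Lemma expoly_le k l a : (k <= l)%N -> expoly l a -> expoly k a.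
Proof.
move=> kl; elim=> [|c j i a' lj _ IH]; first exact: expoly0.
by apply: expolyS => //; exact: leq_trans lj.
Qed.

Lemma expolyM k l a b : expoly k a -> expoly l b -> expoly (k + l) (fun t => a t * b t).
Proof.
move=> + lb; elim=> [|c j i a' kj _ IH].
  by apply: expoly_eq (expoly0 _) => t; rewrite mul0r.
suff h : expoly (k + l) (fun t => c * (expR (j.*2%:R * t) * t ^+ i) * b t).
  by apply: expoly_eq (expolyD h IH) => t; ring.
elim: lb {IH} => [|c' j' i' b' lj _ IH].
  by apply: expoly_eq (expoly0 _) => t; rewrite mulr0.
have h := expoly1 (c * c') (i + i') (leq_add kj lj).
apply: expoly_eq (expolyD h IH) => t; rewrite doubleD natrD mulrDl expRD exprD; ring.
Qed.

Lemma expoly_expN k a : expoly k.+1 a -> expoly k (fun t => expR (- t) * expR (- t) * a t).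
Proof.
elim=> [|c [//|j] i a' kj _ IH].
  by apply: expoly_eq (expoly0 _) => t; rewrite mulr0.
apply: expoly_eq (expolyS c i (kj : (k <= j)%N) IH) => t.
have -> : j.+1.*2%:R * t = t + t + j.*2%:R * t :> R.
  by rewrite doubleS -addn2 natrD; ring.
rewrite 2!expRD; have := expRxMexpNx_1 t.
move: (expR t) (expR (- t)) (expR (j.*2%:R * t)) => u v w uv.
transitivity (c * (w * t ^+ i) * (u * v) ^+ 2 + v * v * a' t); first by ring.
by rewrite uv expr1n mulr1.
Qed.

Lemma is_derive_expM (c t : R) : is_derive t 1 (fun t => expR (c * t)) (c * expR (c * t)).
Proof.
have h0 := is_derive_mul (is_derive_cst c t 1) (is_derive_id t 1).
have h := is_derive_comp1 (is_derive_expR (c * t)) h0.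
by apply: (is_derive_eq h); rewrite /cst; ring.
Qed.

Lemma expoly_dclosed k : dclosed (expoly k).
Proof.
move=> a ka; suff [a' ka' ha] : exists2 a', expoly k a' &
    smooth1 a /\ forall t, is_derive t 1 a (a' t).
  by have [sa da] := ha; split=> //; apply: expoly_eq ka' => t; exact: derive1_is.
elim: ka => [|c j i a0 kj _ [a' ka' [sa da]]].
  exists (fun=> 0); first exact: expoly0.
  by split=> [|t]; [exact: smooth1_cst|exact: is_derive_cst].
pose e := j.*2%:R : R.
exists (fun t => c * e * (expR (e * t) * t ^+ i) +
  (c * i%:R * (expR (e * t) * t ^+ i.-1) + a' t)).
  exact: expolyS kj (expolyS _ _ kj ka').
split=> [|t].
  apply: smooth1D => //; apply: smooth1Z; apply: smooth1M; first exact: smooth1_expM.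
  exact: smooth1_exp.
have hX : is_derive t 1 (fun t => t ^+ i) (i%:R * t ^+ i.-1).
  by have := smooth1_isd t (@smooth1_exp R i); rewrite derive1_exp.
have h := is_derive_add (is_derive_mul (is_derive_cst c t 1)
  (is_derive_mul (is_derive_expM e t) hX)) (da t).
apply: (is_derive_eq h); rewrite /cst.
by move: (expR _) (t ^+ _) (t ^+ _.-1) (a' t) => *; ring.
Qed.

Definition formal k := tens (expoly k).

Lemma formal_smooth k H : formal k H -> tens smooth1 H.
Proof. by apply: dclosed_smooth; exact: expoly_dclosed. Qed.

Lemma formal_le k l H : (k <= l)%N -> formal l H -> formal k H.
Proof. by move=> kl; apply: tens_sub => a; exact: expoly_le. Qed.

Lemma formalM k l H K : formal k H -> formal l K -> formal (k + l) (fun t s => H t s * K t s).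
Proof. by apply: tensM => a b; exact: expolyM. Qed.

Lemma formal_dT k H : formal k H -> formal k (dT H).
Proof. by apply: tensdT; exact: expoly_dclosed. Qed.

Lemma formal_dS k H : formal k H -> formal k (dS H).
Proof. by apply: tensdS; exact: expoly_dclosed. Qed.

Lemma formal_expN k H : formal k.+1 H ->
  formal k (fun t s => expR (- t) * expR (- t) * H t s).
Proof. by apply: tensMa => a; exact: expoly_expN. Qed.

Lemma formal_hrr k H : formal k.+1 H -> formal k (hrr H).
Proof.
move=> kH; apply: formal_expN; apply: tensB; last exact: formal_dT.
by apply: formal_dT; exact: formal_dT.
Qed.

Lemma formal_hss k H : formal k.+1 H -> formal k (hss H).
Proof.
move=> kH; apply: formal_expN; apply: tensD; last exact: formal_dT.
by apply: formal_dS; exact: formal_dS.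
Qed.

Lemma formal_hrs k H : formal k.+1 H -> formal k (hrs H).
Proof.
move=> kH; apply: formal_expN; apply: tensB; last exact: formal_dS.
by apply: formal_dT; exact: formal_dS.
Qed.

Lemma formal_tpoly k J q : tpoly J q -> formal k (fun t s => expR (k.*2%:R * t) * q t s).
Proof.
elim: J q => [|J IH] q /=.
  move=> ->; apply: tens_eq (tens0 _).
  by apply/funext => t; apply/funext => s; rewrite mulr0.
move=> [b [q' [sb Jq' ->]]].
have h := expoly1 1 J (leqnn k).
apply: tens_eq (tensS h sb (IH _ Jq')).
by apply/funext => t; apply/funext => s; ring.
Qed.

Lemma formal_leading k H : formal k H -> exists J q H',
  [/\ tpoly J q, formal k.+1 H' & H = fun t s => expR (k.*2%:R * t) * q t s + H' t s].
Proof.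
have gen a b : expoly k a -> smooth1 b -> exists J q H',
    [/\ tpoly J q, formal k.+1 H' &
     (fun t s => a t * b s) = fun t s => expR (k.*2%:R * t) * q t s + H' t s].
  move=> + sb; elim=> [|c j i a' kj _ [J [q [H' [Jq kH' E]]]]].
    exists 0%N, (fun _ _ => 0), (fun _ _ => 0); split=> //; first exact: tens0.
    by apply/funext => t; apply/funext => s; rewrite mul0r mulr0 addr0.
  have E' t s : a' t * b s = expR (k.*2%:R * t) * q t s + H' t s.
    exact: (congr1 (fun f => f t s) E).
  move: kj; rewrite leq_eqVlt => /predU1P[kj|kj].
    exists (maxn i.+1 J), (fun t s => c * (t ^+ i * b s) + q t s), H'; split=> //.
      apply: tpolyD; last by apply: tpoly_le Jq; exact: leq_maxr.
      apply: (tpolyZ (smooth1_cst c)); apply: tpoly_le (tpoly1 i sb).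
      exact: leq_maxl.
    by apply/funext => t; apply/funext => s; rewrite mulrDl E' -kj; ring.
  exists J, q, (fun t s => c * (expR (j.*2%:R * t) * t ^+ i) * b s + H' t s).
  split=> //; first by apply: tensS => //; exact: expoly1.
  by apply/funext => t; apply/funext => s; rewrite mulrDl E'; ring.
elim=> [|a b H' ka sb _ [J [q [K [Jq kK ->]]]]].
  exists 0%N, (fun _ _ => 0), (fun _ _ => 0); split=> //; first exact: tens0.
  by apply/funext => t; apply/funext => s; rewrite mulr0 addr0.
have [J' [q' [K' [Jq' kK' E]]]] := gen a b ka sb.
exists (maxn J J'), (fun t s => q t s + q' t s), (fun t s => K t s + K' t s); split.
- by apply: tpolyD; [apply: tpoly_le Jq; exact: leq_maxl|apply: tpoly_le Jq'; exact: leq_maxr].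
- exact: tensD.
- apply/funext => t; apply/funext => s.
  have -> : a t * b s = expR (k.*2%:R * t) * q' t s + K' t s.
    exact: (congr1 (fun f => f t s) E).
  ring.
Qed.

Lemma hrrD H K t s : tens smooth1 H -> tens smooth1 K ->
  hrr (fun t s => H t s + K t s) t s = hrr H t s + hrr K t s.
Proof.
move=> sH sK; have d1 := @dclosed_smooth1 R; rewrite /hrr.
rewrite (dTD sH sK) (dTD (tensdT d1 sH) (tensdT d1 sK)).
by move: (dT (dT H) t s) (dT (dT K) t s) (dT H t s) (dT K t s) => *; ring.
Qed.

Lemma hssD H K t s : tens smooth1 H -> tens smooth1 K ->
  hss (fun t s => H t s + K t s) t s = hss H t s + hss K t s.
Proof.
move=> sH sK; have d1 := @dclosed_smooth1 R; rewrite /hss.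
rewrite (dTD sH sK) (dSD sH sK) (dSD (tensdS d1 sH) (tensdS d1 sK)).
by move: (dS (dS H) t s) (dS (dS K) t s) (dT H t s) (dT K t s) => *; ring.
Qed.

Lemma hrsD H K t s : tens smooth1 H -> tens smooth1 K ->
  hrs (fun t s => H t s + K t s) t s = hrs H t s + hrs K t s.
Proof.
move=> sH sK; have d1 := @dclosed_smooth1 R; rewrite /hrs.
rewrite (dSD sH sK) (dTD (tensdS d1 sH) (tensdS d1 sK)).
by move: (dT (dS H) t s) (dT (dS K) t s) (dS H t s) (dS K t s) => *; ring.
Qed.

(** The first-order terms of [hrr] and [hss] cancel, so their sum is exp(-2t) (d_t^2 + d_s^2). The
    factor exp(-2t) lowers the exponent by one unit, and conjugation by the remaining exponential is
    [mode_laplacian]. *)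
Lemma laplacian_mode k P t s : tens smooth1 P ->
  let H := fun t s => expR (k.+1.*2%:R * t) * P t s in
  hrr H t s + hss H t s = expR (k.*2%:R * t) * mode_laplacian k.+1.*2%:R P t s.
Proof.
move=> sP H; pose m : R := k.+1.*2%:R; have d1 := @dclosed_smooth1 R.
have se := tens_a (P := smooth1) (smooth1_expM m).
have de : dT (fun t _ => expR (m * t)) = fun t _ => m * expR (m * t).
  apply/funext => u; apply/funext => v; apply: derive1_is; exact: is_derive_expM.
have dSe : dS (fun t _ : R => expR (m * t)) = fun _ _ => 0 by exact: dSa.
have dTH K : tens smooth1 K -> dT (fun t s => expR (m * t) * K t s) =
    fun t s => expR (m * t) * (m * K t s + dT K t s).
  move=> sK; rewrite (dTM se sK) de; apply/funext => u; apply/funext => v.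
  by move: (dT K u v) (K u v) => *; ring.
have dSH K : tens smooth1 K -> dS (fun t s => expR (m * t) * K t s) =
    fun t s => expR (m * t) * dS K t s.
  move=> sK; rewrite (dSM se sK) dSe; apply/funext => u; apply/funext => v.
  by move: (dS K u v) (K u v) => *; ring.
have sTP := tensdT d1 sP; have smP := tensZ m sP.
have sK := tensD smP sTP.
have h1 : dT H = fun t s => expR (m * t) * (m * P t s + dT P t s) by exact: dTH.
have h2 : dT (dT H) = fun t s => expR (m * t) *
    (m * (m * P t s + dT P t s) + dT (fun t s => m * P t s + dT P t s) t s).
  by rewrite h1 (dTH _ sK).
have dTmP : dT (fun t s => m * P t s) = fun t s => m * dT P t s.
  apply/funext => u; apply/funext => v; apply: derive1_is.
  have h := is_derive_mul (is_derive_cst m u 1) (tens_dT u v sP).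
  by apply: (is_derive_eq h); rewrite mul0r add0r.
have h3 : dS (dS H) = fun t s => expR (m * t) * dS (dS P) t s.
  by rewrite (dSH _ sP) (dSH _ (tensdS d1 sP)).
rewrite /hrr /hss h3 h2 h1 (dTD smP sTP) dTmP /mode_laplacian -/m.
have -> : m * t = t + t + k.*2%:R * t by rewrite /m doubleS -addn2 natrD; ring.
rewrite 2!expRD; have := expRxMexpNx_1 t.
move: (dT (dT P) t s) (dS (dS P) t s) (dT P t s) (P t s).
move: (expR t) (expR (- t)) (expR (k.*2%:R * t)) => u v w p q r z uv.
transitivity ((u * v) ^+ 2 * w * (p + 2 * m * r + m ^+ 2 * z + q)); first by ring.
by rewrite uv expr1n mul1r.
Qed.

Definition hdet_error S : R -> R -> R := fun t s =>
  hdet S t s - 1 + 12 * pi * (expR (2 * t) * (cos s * sin s)).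

Lemma hdet_errorD S H : tens smooth1 S -> tens smooth1 H ->
  hdet_error (fun t s => S t s + H t s) = fun t s =>
   hdet_error S t s + (hrr H t s + hss H t s) +
   (hrr S t s * hss H t s + hrr H t s * hss S t s + -2 * (hrs S t s * hrs H t s) +
    (hrr H t s * hss H t s - hrs H t s * hrs H t s)).
Proof.
move=> sS sH; apply/funext => t; apply/funext => s.
rewrite /hdet_error /hdet hrrD// hssD// hrsD//.
by move: (hrr _ _ _) (hss _ _ _) (hrs _ _ _) (hrr _ _ _) (hss _ _ _) (hrs _ _ _) => *; ring.
Qed.

(** The Laplacian of [H] cancels the leading part of the error. All other new terms are harmless:
    the Hessian of [S] has order 1 and that of [H] order N + 2, so the cross terms and the
    determinant of the Hessian of [H] have order at least N + 3. *)
Lemma formal_step N S : formal 2 S -> formal N.+2 (hdet_error S) ->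
  exists H, [/\ formal N.+3 H, (forall t, dS H t 0 = 0 /\ dS H t (pi / 2) = 0) &
    formal N.+3 (hdet_error (fun t s => S t s + H t s))].
Proof.
move=> kS kE; have [J [q [E' [Jq kE' EE]]]] := formal_leading kE.
have Jq' := tpolyZ (smooth1_cst (-1)) Jq.
have [P [JP nP LP]] := neumann_mode (k := N.+3) isT Jq'.
pose H t s := expR (N.+3.*2%:R * t) * P t s.
have kH : formal N.+3 H by exact: formal_tpoly JP.
have sP := tpoly_tens JP.
have lapH t s : hrr H t s + hss H t s = - (expR (N.+2.*2%:R * t) * q t s).
  by rewrite (laplacian_mode N.+2 t s sP) LP; ring.
exists H; split=> // [t|].
  have se := tens_a (P := smooth1) (smooth1_expM (N.+3.*2%:R : R)).
  rewrite (dSM se sP) dSa; have [-> ->] := nP t.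
  by rewrite !mulr0 !mul0r addr0.
rewrite (hdet_errorD (formal_smooth kS) (formal_smooth kH)).
apply: tens_eq (_ : tens (expoly N.+3) (fun t s => E' t s +
   (hrr S t s * hss H t s + hrr H t s * hss S t s + -2 * (hrs S t s * hrs H t s) +
    (hrr H t s * hss H t s - hrs H t s * hrs H t s)))).
  apply/funext => t; apply/funext => s; rewrite lapH EE.
  by move: (hrr _ _ _) (hss _ _ _) (hrs _ _ _) (hrr _ _ _) (hss _ _ _) (hrs _ _ _) => *; ring.
have kr := formal_hrr kH; have ks := formal_hss kH; have krs := formal_hrs kH.
have lr := formal_hrr kS; have ls := formal_hss kS; have lrs := formal_hrs kS.
apply: tensD => //; apply: tensD.
  apply: tensD; first apply: tensD.
  - by apply: formal_le (formalM lr ks); rewrite add1n.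
  - by apply: formal_le (formalM kr ls); rewrite addn1.
  - by apply: tensZ; apply: formal_le (formalM lrs krs); rewrite add1n.
apply: tensB.
  by apply: formal_le (formalM kr ks); rewrite addnS ltnS addSn ltnS leq_addr.
by apply: formal_le (formalM krs krs); rewrite addnS ltnS addSn ltnS leq_addr.
Qed.

End FormalSeries.

(** * The leading term and the full formal solution *)

Section FormalSolution.
Context {R : realType}.
Implicit Types (a b p : R -> R) (H K S q : R -> R -> R) (t s : R) (i j k n N J : nat).

Definition lead_ang s : R := - (s * sin (4 * s)) - 2 * pi * (cos s * sin s ^+ 3).

(* r^4 (log r cos 4s - s sin 4s) is the real part of z^4 log z, and the other
   term is a multiple of x1 x2^3, which restores the Neumann condition at
   s = pi / 2. *)
Definition lead : R -> R -> R := fun t s =>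
  expR (2.*2%:R * t) * (t * cos (4 * s) + lead_ang s).

Lemma smooth1_lead_ang : smooth1 lead_ang.
Proof.
apply: smooth1D; apply: smooth1N.
  by apply: smooth1M; [exact: smooth1_id|exact: smooth1_sinM].
apply: smooth1Z; apply: smooth1M; first exact: smooth1_cos.
by apply: smooth1X; exact: smooth1_sin.
Qed.

Lemma is_derive_sinX n s : is_derive s 1 (fun s : R => sin s ^+ n) (n%:R * sin s ^+ n.-1 * cos s).
Proof.
have hX := smooth1_isd (sin s) (@smooth1_exp R n); rewrite derive1_exp in hX.
exact: (is_derive_comp1 hX (is_derive_sin s)).
Qed.

Definition lead_ang1 s : R := - (sin (4 * s) + s * (4 * cos (4 * s))) -
  2 * pi * (3 * cos s ^+ 2 * sin s ^+ 2 - sin s ^+ 4).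

Lemma lead_ang_is_derive s : is_derive s 1 lead_ang (lead_ang1 s).
Proof.
have h1 := is_deriveN (is_derive_mul (is_derive_id s 1) (is_derive_sinM 4 s)).
have h2 := is_derive_mul (is_derive_cst (2 * pi : R) s 1)
  (is_derive_mul (is_derive_cos s) (is_derive_sinX 3 s)).
apply: (is_derive_eq (is_deriveB h1 h2)); rewrite /lead_ang1 /cst /=.
by move: (sin (4 * s)) (cos (4 * s)) (sin s) (cos s) => *; ring.
Qed.

Lemma lead_ang1_is_derive s : is_derive s 1 lead_ang1
  (- (8 * cos (4 * s) - 16 * (s * sin (4 * s))) -
   2 * pi * (6 * cos s ^+ 3 * sin s - 10 * cos s * sin s ^+ 3)).
Proof.
have hc := is_derive_cosM 4 s.
have h1 := is_deriveN (is_derive_add (is_derive_sinM 4 s) (is_derive_mul (is_derive_id s 1)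
  (is_derive_mul (is_derive_cst (4 : R) s 1) hc))).
have hcos2 := is_derive_mul (is_derive_cos s) (is_derive_cos s).
have h2 := is_derive_mul (is_derive_cst (2 * pi : R) s 1)
  (is_deriveB (is_derive_mul (is_derive_mul (is_derive_cst (3 : R) s 1) hcos2) (is_derive_sinX 2 s))
    (is_derive_sinX 4 s)).
have -> : lead_ang1 = fun s => - (sin (4 * s) + s * (4 * cos (4 * s))) -
  2 * pi * (3 * (cos s * cos s) * sin s ^+ 2 - sin s ^+ 4) by [].
apply: (is_derive_eq (is_deriveB h1 h2)); rewrite /cst /=.
by move: (sin (4 * s)) (cos (4 * s)) (sin s) (cos s) => *; ring.
Qed.

Definition lead_poly : R -> R -> R := fun t s =>
  t ^+ 1 * cos (4 * s) + (t ^+ 0 * lead_ang s).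

Lemma leadE : lead = fun t s => expR (2.*2%:R * t) * lead_poly t s.
Proof. by apply/funext => t; apply/funext => s; rewrite /lead_poly expr0 mul1r expr1. Qed.

Lemma tpoly_lead : tpoly 2 lead_poly.
Proof.
exists (fun s => cos (4 * s)), (fun t s => t ^+ 0 * lead_ang s); split=> //.
  exact: smooth1_cosM.
exact: tpoly1 smooth1_lead_ang.
Qed.

Lemma formal_lead : formal 2 lead.
Proof. by rewrite leadE; apply: formal_tpoly tpoly_lead. Qed.

(** The real part of z^4 log z is harmonic, and the Laplacian of - 2 pi x_1 x_2^3 is - 12 pi x_1
    x_2. The constant 2 pi, and with it 12 pi, is forced by the Neumann condition at s = pi/2. *)
Lemma lead_laplacian t s :
  hrr lead t s + hss lead t s = - (12 * pi * (expR (2 * t) * (cos s * sin s))).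
Proof.
rewrite leadE (laplacian_mode 1 t s (tpoly_tens tpoly_lead)).
have sc := @smooth1_cosM R 4; have sl := smooth1_lead_ang.
have sg1 := tens_smooth_gen (@smooth1_exp R 1) sc.
have sg0 := tens_smooth_gen (@smooth1_exp R 0) sl.
rewrite (mode_laplacianD _ sg1 sg0) (mode_laplacian_gen _ 1 sc) (mode_laplacian_gen _ 0 sl).
have -> : derive1 lead_ang = lead_ang1.
  by apply/funext => u; apply: derive1_is; exact: lead_ang_is_derive.
rewrite (derive1_is (lead_ang1_is_derive s)).
have -> : derive1 (derive1 (fun s => cos (4 * s))) s = - 16 * cos (4 * s).
  have -> : derive1 (fun s => cos (4 * s)) = fun s : R => -4 * sin (4 * s).
    apply/funext => u; apply: derive1_is.
    by apply: (is_derive_eq (is_derive_cosM 4 u)); ring.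
  apply: derive1_is.
  have h := is_derive_mul (is_derive_cst (-4 : R) s 1) (is_derive_sinM 4 s).
  by apply: (is_derive_eq h); rewrite /cst; ring.
rewrite /lead_ang /=.
have := sin2cos2 s.
have -> : 1.*2%:R * t = 2 * t by [].
move: (sin (4 * s)) (cos (4 * s)) (sin s) (cos s) (expR (2 * t)) (@pi R) => u v x y e w E.
rewrite ?expr0 ?expr1.
transitivity (e * (- (12 * w) * (y * x) * (x ^+ 2 + y ^+ 2))); last first.
  by rewrite E; ring.
have -> : 2.*2%:R = 4 :> R by [].
ring.
Qed.

(** The Laplacian of [lead] cancels the prescribed term, so the error is just the determinant of the
    Hessian of [lead], a combination of products of two factors of order 1. *)
Lemma formal_lead_error : formal 2 (hdet_error lead).
Proof.
have k1 := formal_hrr formal_lead; have k2 := formal_hss formal_lead.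
have k3 := formal_hrs formal_lead.
apply: tens_eq (tensB (formalM k1 k2) (formalM k3 k3)).
apply/funext => t; apply/funext => s; rewrite /hdet_error /hdet.
have := lead_laplacian t s; move: (12 * pi * _) => z.
by move: (hrr lead t s) (hss lead t s) (hrs lead t s) => x y w E; rewrite -[z]opprK -E; ring.
Qed.

Lemma lead_neumann t : dS lead t 0 = 0 /\ dS lead t (pi / 2) = 0.
Proof.
have E s : dS lead t s = expR (2.*2%:R * t) * (t * (- (4 * sin (4 * s))) + lead_ang1 s).
  apply: derive1_is.
  have h := is_derive_mul (is_derive_cst (expR (2.*2%:R * t)) s 1)
    (is_derive_add (is_derive_mul (is_derive_cst t s 1) (is_derive_cosM 4 s)) (lead_ang_is_derive s)).
  by apply: (is_derive_eq h); rewrite /cst; ring.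
rewrite !E /lead_ang1; split.
  by rewrite !mulr0 sin0 !expr0n /= !(mulr0, mul0r, subr0, addr0, oppr0).
rewrite cos_pihalf sin_pihalf !expr1n expr0n /=.
have -> : 4 * (pi / 2) = pi *+ 2 :> R by rewrite -mulr_natl; field.
by rewrite sin2pi cos2pi; field.
Qed.

Definition psum (h : nat -> R -> R -> R) N : R -> R -> R :=
  fun t s => \sum_(n < N.+1) h n t s.

Lemma formal_solution : exists h : nat -> R -> R -> R,
  [/\ h 0%N = lead, (forall n, formal n.+2 (h n)),
   (forall n t, dS (h n) t 0 = 0 /\ dS (h n) t (pi / 2) = 0) &
   forall N, formal N.+2 (hdet_error (psum h N))].
Proof.
(* The hypotheses of [formal_step] are put inside the predicate, so that every pair has a witness
   and choice yields a total correction function, which is then iterated. *)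
pose good (NS : nat * (R -> R -> R)) H :=
  formal 2 NS.2 -> formal NS.1.+2 (hdet_error NS.2) ->
  [/\ formal NS.1.+3 H, (forall t, dS H t 0 = 0 /\ dS H t (pi / 2) = 0) &
    formal NS.1.+3 (hdet_error (fun t s => NS.2 t s + H t s))].
have /choice[step stepP] : forall NS, exists H, good NS H.
  move=> [N S]; have [h1|h1] := pselect (formal 2 S); last by exists S.
  have [h2|h2] := pselect (formal N.+2 (hdet_error S)); last by exists S.
  by have [H HP] := formal_step h1 h2; exists H.
pose S_ := fix S_ n := if n is n'.+1 then
  fun t s => S_ n' t s + step (n', S_ n') t s else lead.
pose h n := if n is n'.+1 then step (n', S_ n') else lead.
have SP N : formal 2 (S_ N) /\ formal N.+2 (hdet_error (S_ N)).
  elim: N => [|N [IH1 IH2]]; first by split; [exact: formal_lead|exact: formal_lead_error].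
  have [h1 h2 h3] := stepP (N, S_ N) IH1 IH2; split=> //.
  by apply: tensD => //; exact: formal_le h1.
exists h; split=> //.
- case=> [|n]; first exact: formal_lead.
  by have [] := stepP (n, S_ n) (SP n).1 (SP n).2.
- case=> [|n]; first exact: lead_neumann.
  by have [] := stepP (n, S_ n) (SP n).1 (SP n).2.
- move=> N; suff -> : psum h N = S_ N by exact: (SP N).2.
  apply/funext => t; apply/funext => s; rewrite /psum.
  elim: N => [|N IH]; first by rewrite big_ord_recl big_ord0 addr0.
  by rewrite big_ord_recr /= IH.
Qed.

End FormalSolution.

(** * Weighted derivative bounds near the corner *)

Section WeightedBounds.
Context {R : realType}.
Implicit Types (x y : R * R) (h g : R * R -> R) (w : seq 'I_2) (i : 'I_2)
  (a b : R -> R) (H K : R -> R -> R) (t s m C : R) (k n : nat) (Z : set (R * R)).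

Definition corner : set (R * R) := [set x | [/\ closedQ x, x != 0 & logr x < 0]].

Lemma corner_halfplane : corner `<=` @halfplane R.
Proof. by move=> x [cx xn0 _]; exact: closedQ_halfplane. Qed.

(** One power of r is lost per derivative, the scaling of functions homogeneous of degree m. Weights
    add under products, and a logarithm costs only an arbitrarily small part of m. *)
Definition wb Z k m C h := forall w x, (size w <= k)%N -> Z x ->
  `|iter_partial w h x| <= C * expR ((m - (size w)%:R) * logr x).

Lemma wb_rec Z k m C h : (forall x, Z x -> `|h x| <= C * expR (m * logr x)) ->
  (forall i, wb Z k (m - 1) C ('D_(basis_vec i) h)) -> wb Z k.+1 m C h.
Proof.
move=> h0 hD w x; case/lastP: w => [|w i] sw Zx; first by rewrite subr0; exact: h0.
rewrite iter_partial_rcons size_rcons -natr1.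
have -> : m - ((size w)%:R + 1) = m - 1 - (size w)%:R by ring.
by apply: hD => //; move: sw; rewrite size_rcons.
Qed.

Lemma wb0 Z k m C h x : wb Z k m C h -> Z x -> `|h x| <= C * expR (m * logr x).
Proof. by move=> wh Zx; have := wh [::] x isT Zx; rewrite subr0. Qed.

Lemma wbD1 Z k m C h i : wb Z k.+1 m C h -> wb Z k (m - 1) C ('D_(basis_vec i) h).
Proof.
move=> wh w x sw Zx; have := wh (rcons w i) x; rewrite size_rcons => /(_ sw Zx).
rewrite iter_partial_rcons -natr1.
by have -> : m - ((size w)%:R + 1) = m - 1 - (size w)%:R by ring.
Qed.

Lemma wbWk Z k k' m C h : (k' <= k)%N -> wb Z k m C h -> wb Z k' m C h.
Proof. by move=> kk wh w x sw; apply: wh; exact: leq_trans kk. Qed.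

Lemma wbWC Z k m C C' h : C <= C' -> wb Z k m C h -> wb Z k m C' h.
Proof.
move=> CC wh w x sw Zx; apply: le_trans (wh w x sw Zx) _.
by rewrite ler_wpM2r// expR_ge0.
Qed.

Lemma wbWZ Z Z' k m C h : Z' `<=` Z -> wb Z k m C h -> wb Z' k m C h.
Proof. by move=> ZZ wh w x sw /ZZ; exact: wh. Qed.

Lemma wbWm Z k m m' C h : Z `<=` corner -> 0 <= C -> m' <= m ->
  wb Z k m C h -> wb Z k m' C h.
Proof.
move=> ZZ C0 mm wh w x sw Zx; apply: le_trans (wh w x sw Zx) _.
have [_ _ t0] := ZZ _ Zx.
by rewrite ler_wpM2l// ler_expR ler_wnM2r ?lerB// ltW.
Qed.

Lemma wb_eq Z k m C h g : Z `<=` @halfplane R ->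
  (forall x, halfplane x -> h x = g x) -> wb Z k m C g -> wb Z k m C h.
Proof.
move=> ZH hg wg w x sw Zx; rewrite (iter_partial_eq w hg); first exact: wg.
exact: ZH.
Qed.

Lemma wb_near Z k m C h g : (forall x, Z x -> \near x, h x = g x) ->
  wb Z k m C g -> wb Z k m C h.
Proof.
move=> hg wg w x sw Zx.
by have /nbhs_singleton -> := near_eq_iter w (hg x Zx); exact: wg.
Qed.

Lemma wb_add Z k m C C' h g : Z `<=` @halfplane R -> smoothOm h -> smoothOm g ->
  wb Z k m C h -> wb Z k m C' g -> wb Z k m (C + C') (fun x => h x + g x).
Proof.
move=> ZH sh sg wh wg w x sw Zx; rewrite iter_partialD//; last exact: ZH.
by rewrite mulrDl (le_trans (ler_normD _ _))// lerD//; [exact: wh|exact: wg].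
Qed.

(** The factor [2 ^+ k] counts the terms of Leibniz's rule: each derivative splits the product into
    two products of the same total weight. *)
Lemma wb_mul Z k m m' C C' h g : Z `<=` @halfplane R -> smoothOm h -> smoothOm g ->
  0 <= C -> 0 <= C' -> wb Z k m C h -> wb Z k m' C' g ->
  wb Z k (m + m') (2 ^+ k * (C * C')) (fun x => h x * g x).
Proof.
move=> ZH + + C0 C'0; elim: k m m' h g => [|k IH] m m' h g sh sg wh wg.
  move=> [|//] x _ Zx /=; rewrite subr0 mulrDl expRD expr0 mul1r normrM mulrACA.
  by rewrite ler_pM//; [exact: wb0 wh Zx|exact: wb0 wg Zx].
have CC : 0 <= C * C' by exact: mulr_ge0.
apply: wb_rec => [x Zx|i].
  rewrite mulrDl expRD normrM.
  apply: (@le_trans _ _ (1 * (C * C' * (expR (m * logr x) * expR (m' * logr x))))).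
    by rewrite mul1r mulrACA ler_pM//; [exact: wb0 wh Zx|exact: wb0 wg Zx].
  rewrite -[X in _ <= X]mulrA ler_wpM2r//.
    by rewrite mulr_ge0// mulr_ge0// expR_ge0.
  by rewrite exprn_ege1// ler1n.
have sDh := smoothOm_D i sh; have sDg := smoothOm_D i sg.
apply: (wb_eq ZH (g := fun x => 'D_(basis_vec i) h x * g x + h x * 'D_(basis_vec i) g x)).
  by move=> x Hx; exact: partialM.
have -> : 2 ^+ k.+1 * (C * C') = 2 ^+ k * (C * C') + 2 ^+ k * (C * C').
  by rewrite exprS; ring.
apply: wb_add => //; try exact: smoothOmM.
  have -> : m + m' - 1 = m - 1 + m' by ring.
  by apply: IH => //; [exact: wbD1|exact: wbWk wg].
have -> : m + m' - 1 = m + (m' - 1) by ring.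
by apply: IH => //; [exact: wbWk wh|exact: wbD1].
Qed.

Lemma iter_partial0 w : iter_partial w (fun=> 0 : R) = fun=> 0.
Proof. by elim: w => [//|i w IH] /=; rewrite IH; apply/funext => x; exact: derive_cst. Qed.

Lemma wb_cst Z k C : Z `<=` corner -> wb Z k 0 `|C| (fun=> C).
Proof.
move=> ZZ; have D0 i : 'D_(basis_vec i) (fun=> C) = (fun=> 0 : R).
  by apply/funext => x; exact: derive_cst.
move=> w x sw Zx; case/lastP: w sw => [|w i] sw.
  by rewrite subr0 mul0r expR0 mulr1.
by rewrite iter_partial_rcons D0 iter_partial0 normr0 mulr_ge0// expR_ge0.
Qed.

Lemma ang_itv x : closedQ x -> x != 0 -> 0 <= ang x <= pi / 2.
Proof.
move=> cx xn0; have Hx := closedQ_halfplane cx xn0.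
have xr := halfplane_fst_enorm Hx; have rE := sqr_enorm x.
move: cx; rewrite /closedQ/= !in_itv/= => -[/andP[x1 _] /andP[x2 _]].
rewrite /ang; set q := _ / _.
have q0 : 0 <= q by rewrite divr_ge0// ltW.
have q1 : q <= 1.
  rewrite ler_pdivrMr// mul1r.
  have : x.2 <= enorm x.
    rewrite -(@ler_pXn2r _ 2) ?nnegrE ?sqrtr_ge0// rE lerDr sqr_ge0//.
  by move=> /le_trans; apply; rewrite lerDr.
have := le_atan q0; have := le_atan q1; rewrite atan0 atan1; lra.
Qed.

Lemma smooth1_bounded b (l r : R) : l <= r -> smooth1 b ->
  exists2 C, 0 <= C & forall s, l <= s <= r -> `|b s| <= C.
Proof.
move=> lr sb; have cb : {within `[l, r], continuous (fun s => `|b s|)}.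
  apply: continuous_subspaceT => s.
  by apply: (@continuous_comp _ _ _ b Num.norm); [exact: smooth1_cont|exact: norm_continuous].
have [c _ hc] := EVT_max lr cb.
by exists `|b c| => // s ls; apply: hc; rewrite in_itv.
Qed.

(** Without powers of t the weight m is attained exactly. This is needed for the factor exp(-t) that
    appears when a cutoff is differentiated, where no loss is affordable. *)
Lemma exp_wb k m b : smooth1 b -> exists2 C, 0 <= C &
  wb corner k m C (pol (fun t s => expR (m * t) * b s)).
Proof.
have bnd m' b' : smooth1 b' -> exists2 C, 0 <= C & forall x, corner x ->
    `|pol (fun t s => expR (m' * t) * b' s) x| <= C * expR (m' * logr x).
  move=> sb'; have pi2 : 0 <= pi / 2 :> R by rewrite divr_ge0// pi_ge0.
  have [C C0 hC] := smooth1_bounded pi2 sb'; exists C => // x [cx xn0 _].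
  rewrite /pol normrM ger0_norm ?expR_ge0// mulrC ler_wpM2r ?expR_ge0//.
  by apply: hC; exact: ang_itv.
elim: k m b => [|k IH] m b sb; have [C0 C00 h0] := bnd m b sb.
  by exists C0 => // -[|//] x _ Zx; rewrite subr0; exact: h0.
have sD i : smooth1 (fun s => m * (dircos i s * b s) + dirsin i s * derive1 b s).
  apply: smooth1D; first by apply: smooth1Z; apply: smooth1M => //; exact: smooth1_dircos.
  by apply: smooth1M; [exact: smooth1_dirsin|exact: smooth1_derive].
have hD i : exists2 C, 0 <= C & wb corner k (m - 1) C
    ('D_(basis_vec i) (pol (fun t s => expR (m * t) * b s))).
  have [C C00' hC] := IH (m - 1) _ (sD i).
  exists C => //; apply: wb_eq hC; first exact: corner_halfplane.
  move=> x Hx.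
  have sg := tens_smooth_gen (@smooth1_expM R m) sb.
  rewrite partial_pol// /pol /polD (dTgen b (@smooth1_expM R m)) (dSgen _ sb).
  have -> : derive1 (fun t => expR (m * t)) (logr x) = m * expR (m * logr x).
    by apply: derive1_is; exact: is_derive_expM.
  have -> : (m - 1) * logr x = - logr x + m * logr x by ring.
  by rewrite expRD; ring.
have [C1 C10 h1] := hD 0; have [C2 C20 h2] := hD 1.
exists (C0 + C1 + C2); first by rewrite !addr_ge0.
apply: wb_rec => [x Zx|i].
  apply: le_trans (h0 x Zx) _; rewrite ler_wpM2r ?expR_ge0// -addrA lerDl addr_ge0//.
have [->|->] : i = 0 \/ i = 1 by case: i => [[|[|//]] hi]; [left|right]; exact/val_inj.
  apply: wbWC h1; lra.
apply: wbWC h2; lra.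
Qed.

(** A variant of [expoly] with real exponents: a single partial derivative lowers the exponent by 1
    and so leaves the even integers. *)
Inductive rexp (mu : R) : (R -> R) -> Prop :=
| rexp0 : rexp mu (fun=> 0)
| rexpS (c l : R) n a : mu <= l -> rexp mu a ->
    rexp mu (fun t => c * (expR (l * t) * t ^+ n) + a t).

Lemma rexp_eq mu a b : a =1 b -> rexp mu b -> rexp mu a.
Proof. by move=> ab; have -> : a = b by apply/funext. Qed.

Lemma rexp_dclosed mu : dclosed (rexp mu).
Proof.
move=> a ka; suff [a' ka' ha] : exists2 a', rexp mu a' &
    smooth1 a /\ forall t, is_derive t 1 a (a' t).
  by have [sa da] := ha; split=> //; apply: rexp_eq ka' => t; exact: derive1_is.
elim: ka => [|c l n a0 ml _ [a' ka' [sa da]]].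
  exists (fun=> 0); first exact: rexp0.
  by split=> [|t]; [exact: smooth1_cst|exact: is_derive_cst].
exists (fun t => c * l * (expR (l * t) * t ^+ n) +
  (c * n%:R * (expR (l * t) * t ^+ n.-1) + a' t)).
  exact: rexpS ml (rexpS _ _ ml ka').
split=> [|t].
  apply: smooth1D => //; apply: smooth1Z; apply: smooth1M; first exact: smooth1_expM.
  exact: smooth1_exp.
have hX : is_derive t 1 (fun t => t ^+ n) (n%:R * t ^+ n.-1).
  by have := smooth1_isd t (@smooth1_exp R n); rewrite derive1_exp.
have h := is_derive_add (is_derive_mul (is_derive_cst c t 1)
  (is_derive_mul (is_derive_expM l t) hX)) (da t).
apply: (is_derive_eq h); rewrite /cst.
by move: (expR _) (t ^+ _) (t ^+ _.-1) (a' t) => *; ring.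
Qed.

Lemma rexp_expN mu a : rexp mu a -> rexp (mu - 1) (fun t => expR (- t) * a t).
Proof.
elim=> [|c l n a' ml _ IH].
  by apply: rexp_eq (rexp0 _) => t; rewrite mulr0.
have ml' : mu - 1 <= l - 1 by rewrite lerD2r.
apply: rexp_eq (rexpS c n ml' IH) => t.
have -> : (l - 1) * t = - t + l * t by ring.
by rewrite expRD; ring.
Qed.

(** The strict gap pays for the logarithms: exp((l - m) t) t^n stays bounded as t goes to minus
    infinity. *)
Lemma rexp_bounded mu m a : m < mu -> rexp mu a ->
  exists2 C, 0 <= C & forall t, t <= 0 -> `|a t| <= C * expR (m * t).
Proof.
move=> mmu; elim=> [|c l n a' ml _ [C C0 hC]].
  by exists 0 => // t _; rewrite normr0 mul0r.
have d0 : 0 < l - m by rewrite subr_gt0; exact: lt_le_trans ml.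
have [C1 hC1] := @poly_expN_bounded R 'X^n.
have C10 : 0 <= C1.
  by apply: le_trans (hC1 0 (lexx _)); rewrite mulr_ge0// expR_ge0.
exists (`|c| * (C1 / (l - m) ^+ n) + C).
  by rewrite addr_ge0// mulr_ge0// divr_ge0// exprn_ge0// ltW.
move=> t t0; rewrite mulrDl (le_trans (ler_normD _ _))// lerD//; last exact: hC.
rewrite normrM -mulrA ler_wpM2l//.
have -> : l * t = (l - m) * t + m * t by ring.
rewrite expRD mulrAC normrM [X in _ * X <= _]ger0_norm ?expR_ge0// ler_wpM2r ?expR_ge0//.
rewrite ler_pdivlMr ?exprn_gt0//.
have y0 : 0 <= - ((l - m) * t) by rewrite -mulrN mulr_ge0 ?oppr_ge0// ltW.
apply: le_trans (hC1 _ y0); rewrite opprK hornerXn normrM ger0_norm ?expR_ge0//.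
rewrite [`|(- _) ^+ n|]normrX normrN normrM (gtr0_norm d0) exprMn normrX.
by rewrite le_eqVlt; apply/orP; left; apply/eqP; ring.
Qed.

Lemma tens_rexp_wb mu m k H : m < mu -> tens (rexp mu) H ->
  exists2 C, 0 <= C & wb corner k m C (pol H).
Proof.
have bnd m' mu' H' : m' < mu' -> tens (rexp mu') H' ->
    exists2 C, 0 <= C & forall x, corner x -> `|pol H' x| <= C * expR (m' * logr x).
  move=> mm; elim=> [|a b H'' ra sb _ [C C0 hC]].
    by exists 0 => // x _; rewrite normr0 mul0r.
  have pi2 : 0 <= pi / 2 :> R by rewrite divr_ge0// pi_ge0.
  have [C1 C10 hC1] := smooth1_bounded pi2 sb.
  have [C2 C20 hC2] := rexp_bounded mm ra.
  exists (C2 * C1 + C); first by rewrite addr_ge0// mulr_ge0.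
  move=> x Zx; have [cx xn0 t0] := Zx.
  rewrite /pol mulrDl (le_trans (ler_normD _ _))// lerD//; last exact: hC.
  rewrite normrM mulrAC ler_pM//; first by apply: hC2; exact: ltW.
  by apply: hC1; exact: ang_itv.
elim: k m mu H => [|k IH] m mu H mm rH; have [C0 C00 h0] := bnd _ _ _ mm rH.
  by exists C0 => // -[|//] x _ Zx; rewrite subr0; exact: h0.
have sH := dclosed_smooth (@rexp_dclosed mu) rH.
have hD i : exists2 C, 0 <= C & wb corner k (m - 1) C ('D_(basis_vec i) (pol H)).
  have rD : tens (rexp (mu - 1)) (polD i H).
    by apply: tens_polD rH; [exact: rexp_dclosed|exact: rexp_expN].
  have mm1 : m - 1 < mu - 1 by rewrite ltrD2r.
  have [C C1 hC] := IH _ _ _ mm1 rD.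
  exists C => //; apply: wb_eq hC; first exact: corner_halfplane.
  by move=> x Hx; exact: partial_pol.
have [C1 C10 h1] := hD 0; have [C2 C20 h2] := hD 1.
exists (C0 + C1 + C2); first by rewrite !addr_ge0.
apply: wb_rec => [x Zx|i].
  apply: le_trans (h0 x Zx) _; rewrite ler_wpM2r ?expR_ge0// -addrA lerDl addr_ge0//.
have [->|->] : i = 0 \/ i = 1 by case: i => [[|[|//]] hi]; [left|right]; exact/val_inj.
  apply: wbWC h1; lra.
apply: wbWC h2; lra.
Qed.

Lemma expoly_rexp k a : expoly k a -> rexp k.*2%:R a.
Proof.
elim=> [|c j n a' kj _ IH]; first exact: rexp0.
by apply: rexpS => //; rewrite ler_nat leq_double.
Qed.

Lemma formal_wb n m k H : m < n.*2%:R -> formal n H ->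
  exists2 C, 0 <= C & wb corner k m C (pol H).
Proof.
move=> mn kH; apply: (@tens_rexp_wb n.*2%:R) => //.
by apply: tens_sub kH => a; exact: expoly_rexp.
Qed.

(** Contains [step] and is closed under derivatives, with the left constant becoming 0; hence all
    derivatives of [step] are bounded. *)
Definition steplike b := [/\ smooth1 b, (exists c, forall t, t < 0 -> b t = c) &
  forall t, 1 < t -> b t = 0].

Lemma steplike_derive b : steplike b -> steplike (derive1 b).
Proof.
move=> [sb [c b0] b1]; split; first exact: smooth1_derive.
  exists 0 => t t0; apply: derive1_is; apply: near_eq_is_derive (is_derive_cst c t 1).
  by near=> u; apply/esym/b0; near: u; exact: lt_nbhsl.
move=> t t1; apply: derive1_is; apply: near_eq_is_derive (is_derive_cst (0 : R) t 1).
by near=> u; apply/esym/b1; near: u; exact: lt_nbhsr.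
Unshelve. all: by end_near. Qed.

Lemma steplike_bounded b : steplike b -> exists2 C, 0 <= C & forall t, `|b t| <= C.
Proof.
move=> [sb [c b0] b1]; have [C C0 hC] := smooth1_bounded (@ler01 R) sb.
exists (C + `|c|); first by rewrite addr_ge0.
move=> t; have [t0|t0] := ltP t 0; first by rewrite b0// lerDr.
have [t1|t1] := ltP 1 t; first by rewrite b1// normr0 addr_ge0.
by apply: le_trans (hC t _) _; [rewrite t0 t1|rewrite lerDl].
Qed.

Lemma steplike_step : steplike (@step R).
Proof.
split; first exact: smooth1_step.
  by exists 1 => t t0; apply: step_le0; exact: ltW.
by move=> t t1; apply: step_ge1; exact: ltW.
Qed.

Lemma smooth1_shift b (tau : R) : smooth1 b -> smooth1 (fun t => b (t - tau)).
Proof.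
move=> sb; apply: (smooth1_comp sb); apply: smooth1D; first exact: smooth1_id.
exact: smooth1_cst.
Qed.

Lemma derive1_shift b (tau : R) : smooth1 b ->
  derive1 (fun t => b (t - tau)) = fun t => derive1 b (t - tau).
Proof.
move=> sb; apply/funext => t; apply: derive1_is.
have h0 := is_derive_add (is_derive_id t (1 : R)) (is_derive_cst (- tau) t 1).
have h := is_derive_comp1 (b := fun u => u - tau) (smooth1_isd (t - tau) sb) h0.
by apply: (is_derive_eq h); rewrite addr0 mulr1.
Qed.

(** The constant does not depend on [tau]: a shift of log r is a dilation of the plane, and the
    weight-0 bounds are invariant under dilations. *)
Lemma steplike_wb k b : steplike b -> exists2 C, 0 <= C &
  forall tau, wb corner k 0 C (pol (fun t _ => b (t - tau))).
Proof.
elim: k b => [|k IH] b lb; have [C0 C00 h0] := steplike_bounded lb.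
  by exists C0 => // tau [|//] x _ _; rewrite subr0 mul0r expR0 mulr1; exact: h0.
have sb := let: And3 h _ _ := lb in h.
have [C1 C10 h1] := IH _ (steplike_derive lb).
have hD i : exists2 C, 0 <= C & forall tau, wb corner k (0 - 1) C
    ('D_(basis_vec i) (pol (fun t _ => b (t - tau)))).
  have [C2 C20 h2] := exp_wb k (-1) (@smooth1_dircos R i).
  exists (2 ^+ k * (C1 * C2)); first by rewrite mulr_ge0 ?exprn_ge0// mulr_ge0.
  move=> tau; have ss := smooth1_shift tau sb.
  apply: (wb_eq corner_halfplane (g := fun x => pol (fun t _ => derive1 b (t - tau)) x *
    pol (fun t s => expR (-1 * t) * dircos i s) x)).
    move=> x Hx; rewrite (partial_pol _ (tens_a (P := smooth1) ss))// /pol /polD dSa.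
    rewrite (dTa ss) derive1_shift// mulr0 addr0 mulN1r mulrA mulrC; congr (_ * _).
  apply: wb_mul => //; first exact: corner_halfplane.
    apply: smoothOm_pol; apply: tens_a; apply: smooth1_shift; exact: smooth1_derive.
  apply: smoothOm_pol; apply: tens_smooth_gen; [exact: smooth1_expM|exact: smooth1_dircos].
have [C2 C20 h2] := hD 0; have [C3 C30 h3] := hD 1.
exists (C0 + C2 + C3); first by rewrite !addr_ge0.
move=> tau; apply: wb_rec => [x Zx|i].
  by rewrite mul0r expR0 mulr1; apply: le_trans (h0 _) _; rewrite -addrA lerDl addr_ge0.
have [->|->] : i = 0 \/ i = 1 by case: i => [[|[|//]] hi]; [left|right]; exact/val_inj.
  apply: wbWC (h2 tau); lra.
apply: wbWC (h3 tau); lra.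
Qed.

End WeightedBounds.

(** * Borel summation of the formal solution *)

Section BorelSum.
Context {R : realType}.
Implicit Types (x y : R * R) (w : seq 'I_2) (i : 'I_2) (H K : R -> R -> R)
  (t s tau eta : R) (k n N M : nat) (h : nat -> R -> R -> R) (T : nat -> R).

Definition cutoff tau H : R -> R -> R := fun t s => step (t - tau) * H t s.

Lemma tens_cutoff tau H : tens smooth1 H -> tens smooth1 (cutoff tau H).
Proof.
apply: tensMa => a sa; apply: smooth1M => //; apply: smooth1_shift; exact: smooth1_step.
Qed.

Lemma near_logr_gt x t : halfplane x -> t < logr x -> \near x, t < logr x.
Proof. by move=> Hx tx; exact: (logr_continuous Hx (lt_nbhsr tx)). Qed.

Lemma near_logr_lt x t : halfplane x -> logr x < t -> \near x, logr x < t.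
Proof. by move=> Hx tx; exact: (logr_continuous Hx (lt_nbhsl tx)). Qed.

Lemma cutoff0 tau H t s : tau + 1 <= t -> cutoff tau H t s = 0.
Proof. by move=> tt; rewrite /cutoff step_ge1 ?mul0r// lerBrDr addrC. Qed.

Lemma cutoff1 tau H t s : t <= tau -> cutoff tau H t s = H t s.
Proof. by move=> tt; rewrite /cutoff step_le0 ?mul1r// subr_le0. Qed.

(** Up to logarithms [H] has size r^(2n+4), hence weight 2n + 7/2 at least. The spare factor r^(1/2)
    is at most exp((tau + 1) / 2) on the support of the cutoff, and this beats the constants, which
    are uniform in [tau]. *)
Lemma cutoff_wb n H eta : formal n.+2 H -> 0 < eta ->
  exists2 tau, tau <= - n.+2%:R & wb corner n.+3 (n.*2%:R + 3) eta (pol (cutoff tau H)).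
Proof.
move=> kH eta0; pose m : R := n.*2%:R + 3 + 2^-1.
have mn : m < n.+2.*2%:R.
  have -> : n.+2.*2%:R = n.*2%:R + 4 :> R by rewrite 2!doubleS -(addn4 n.*2) natrD.
  by rewrite /m; lra.
have [C1 C10 h1] := formal_wb n.+3 mn kH.
have [C2 C20 h2] := steplike_wb n.+3 (@steplike_step R).
pose C := 2 ^+ n.+3 * (C2 * C1) + 1.
have C0 : 0 < C by rewrite ltr_wpDl// mulr_ge0 ?exprn_ge0// mulr_ge0.
(* The first bound moves the supports to the corner, which makes the sum locally finite; the second
   solves C exp((tau + 1) / 2) <= eta. *)
pose tau := Num.min (- n.+2%:R) (2 * ln (eta / C) - 1).
have tau1 : tau <= - n.+2%:R by rewrite /tau ge_min lexx.
have tau2 : C * expR ((tau + 1) / 2) <= eta.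
  rewrite mulrC -ler_pdivlMr// -[leRHS]lnK ?posrE ?divr_gt0// ler_expR.
  by rewrite ler_pdivrMr// mulrC -lerBrDr /tau ge_min lexx orbT.
exists tau => // w x sw Zx; have Hx := corner_halfplane Zx.
have [tx|tx] := leP (logr x) (tau + 1); last first.
  have /nbhs_singleton -> : \near x, iter_partial w (pol (cutoff tau H)) x =
      iter_partial w (fun=> 0) x.
    apply: near_eq_iter; apply: filterS (near_logr_gt Hx tx) => y ty.
    by rewrite /pol cutoff0// ltW.
  by rewrite iter_partial0 normr0 mulr_ge0 ?expR_ge0// ltW.
have s1 : smoothOm (pol (fun t _ : R => step (t - tau))).
  by apply: smoothOm_pol; apply: tens_a; apply: smooth1_shift; exact: smooth1_step.
have s2 : smoothOm (pol H) by apply: smoothOm_pol; exact: formal_smooth kH.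
have hm := wb_mul corner_halfplane s1 s2 C20 C10 (h2 tau) h1.
have -> : iter_partial w (pol (cutoff tau H)) x =
  iter_partial w (fun x => pol (fun t _ => step (t - tau)) x * pol H x) x by [].
apply: le_trans (hm w x sw Zx) _; rewrite add0r.
have -> : (m - (size w)%:R) * logr x = logr x / 2 + (n.*2%:R + 3 - (size w)%:R) * logr x.
  by rewrite /m; field.
rewrite expRD mulrA ler_wpM2r ?expR_ge0//; apply: le_trans tau2.
have CC : 0 <= 2 ^+ n.+3 * (C2 * C1) by rewrite mulr_ge0 ?exprn_ge0// mulr_ge0.
apply: ler_pM => //; first by rewrite /C lerDl.
by rewrite ler_expR ler_wpM2r.
Qed.

Definition cutsum h T N : R -> R -> R :=
  fun t s => \sum_(n < N) cutoff (T n) (h n) t s.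

Lemma cutsumS h T N : cutsum h T N.+1 = fun t s => cutsum h T N t s + cutoff (T N) (h N) t s.
Proof. by apply/funext => t; apply/funext => s; rewrite /cutsum big_ord_recr. Qed.

Lemma tens_cutsum h T N : (forall n, formal n.+2 (h n)) -> tens smooth1 (cutsum h T N).
Proof.
move=> hk; elim: N => [|N IH].
  apply: tens_eq (tens0 _); apply/funext => t; apply/funext => s.
  by rewrite /cutsum big_ord0.
rewrite cutsumS; apply: tensD => //; apply: tens_cutoff; exact: formal_smooth (hk N).
Qed.

(** When [T n <= - n.+2%:R], the n-th term vanishes once log r >= - n - 1, so the infinite sum can
    be written as a finite one whose length depends on the radius. *)
Definition borel_sum h T x : R := pol (cutsum h T (Num.truncn (- logr x))) x.

Lemma cutsum_stable h T N M t s : (forall n, T n <= - n.+2%:R) -> (N <= M)%N ->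
  - N%:R - 1 <= t -> cutsum h T M t s = cutsum h T N t s.
Proof.
move=> hT /subnK <- tN; elim: (M - N)%N => [//|d IH].
rewrite addSn cutsumS IH cutoff0 ?addr0//; apply: le_trans tN.
have := hT (d + N)%N; rewrite -!natr1 natrD.
have : (0 : R) <= d%:R by exact: ler0n.
lra.
Qed.

Lemma borel_sum_eq h T N x : (forall n, T n <= - n.+2%:R) -> - N%:R - 1 <= logr x ->
  borel_sum h T x = pol (cutsum h T N) x.
Proof.
move=> hT xN; rewrite /borel_sum /pol; set M := Num.truncn _.
have xM : - M%:R - 1 <= logr x.
  rewrite -[leLHS]opprK -[leRHS]opprK lerN2 opprB opprK addrC natr1.
  by apply: ltW; exact: truncnS_gt.
have [NM|MN] := leqP N M; first by rewrite (cutsum_stable _ _ hT NM).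
by rewrite (cutsum_stable _ _ hT (ltnW MN)).
Qed.

Lemma borel_sum_near h T x : (forall n, T n <= - n.+2%:R) -> halfplane x ->
  exists N, forall M, (N <= M)%N -> \near x, borel_sum h T x = pol (cutsum h T M) x.
Proof.
move=> hT Hx; exists (Num.truncn (- logr x)) => M NM.
have xN : - M%:R - 1 < logr x.
  rewrite -[ltLHS]opprK -[ltRHS]opprK ltrN2 opprB opprK addrC natr1.
  apply: lt_le_trans (truncnS_gt _) _; by rewrite ler_nat ltnS.
apply: filterS (near_logr_gt Hx xN) => y /ltW; exact: borel_sum_eq.
Qed.

Lemma borel_sum_smooth h T : (forall n, formal n.+2 (h n)) ->
  (forall n, T n <= - n.+2%:R) -> smoothOm (borel_sum h T).
Proof.
move=> hk hT; apply: smoothOm_near => x Hx; have [N hN] := borel_sum_near h hT Hx.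
exists (pol (cutsum h T N)); last exact: hN.
by apply: smoothOm_pol; exact: tens_cutsum.
Qed.

(** Every term from index N on is controlled in N + 3 derivatives with weight at least 2N + 3, and
    the constants form a geometric series. *)
Lemma borel_tail_wb h T eta N : 0 < eta -> (forall n, formal n.+2 (h n)) ->
  (forall n, T n <= - n.+2%:R) ->
  (forall n, wb corner n.+3 (n.*2%:R + 3) (eta / 2 ^+ n) (pol (cutoff (T n) (h n)))) ->
  wb corner N.+3 (N.*2%:R + 3) (2 * eta)
    (fun x => borel_sum h T x - pol (cutsum h T N) x).
Proof.
move=> eta0 hk hT hw w x sw Zx; have Hx := corner_halfplane Zx.
have [_ _ t0] := Zx.
have [M0 hM] := borel_sum_near h hT Hx.
have /nbhs_singleton -> : \near x, iter_partial w (fun x => borel_sum h T x - pol (cutsum h T N) x) x =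
    iter_partial w (fun x => pol (cutsum h T (M0 + N)) x - pol (cutsum h T N) x) x.
  by apply: near_eq_iter; apply: filterS (hM _ (leq_addr N M0)) => y ->.
have sc M : smoothOm (pol (cutsum h T M)) by apply: smoothOm_pol; exact: tens_cutsum.
(* The factor 2 - 2 / 2^d is the sum of 1 / 2^n over n < d; the term of index d + N is estimated by
   eta / 2^d. *)
have tail d : `|iter_partial w (fun x => pol (cutsum h T (d + N)) x - pol (cutsum h T N) x) x| <=
    (2 - (2 ^+ d)^-1 * 2) * eta * expR ((N.*2%:R + 3 - (size w)%:R) * logr x).
  elim: d => [|d IH].
    rewrite add0n; have -> : (fun x => pol (cutsum h T N) x - pol (cutsum h T N) x) = fun=> 0.
      by apply/funext => y; rewrite subrr.
    by rewrite iter_partial0 normr0 expr0 invr1 mul1r subrr !mul0r.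
  have -> : (fun x => pol (cutsum h T (d.+1 + N)) x - pol (cutsum h T N) x) =
    (fun x => (pol (cutsum h T (d + N)) x - pol (cutsum h T N) x) +
      pol (cutoff (T (d + N)%N) (h (d + N)%N)) x).
    by apply/funext => y; rewrite addSn cutsumS /pol; ring.
  rewrite iter_partialD//; last 2 first.
    by apply: smoothOmB.
    by apply: smoothOm_pol; apply: tens_cutoff; exact: formal_smooth.
  apply: le_trans (ler_normD _ _) _.
  have sw' : (size w <= (d + N).+3)%N by apply: leq_trans sw _; rewrite !ltnS leq_addl.
  have B := hw (d + N)%N w x sw' Zx.
  have -> : (2 - (2 ^+ d.+1)^-1 * 2) * eta * expR ((N.*2%:R + 3 - (size w)%:R) * logr x) =
     (2 - (2 ^+ d)^-1 * 2) * eta * expR ((N.*2%:R + 3 - (size w)%:R) * logr x) +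
     eta / 2 ^+ d * expR ((N.*2%:R + 3 - (size w)%:R) * logr x).
    by rewrite exprS invfM; field; rewrite expf_neq0.
  apply: lerD => //; apply: le_trans B _; apply: ler_pM.
  - by rewrite divr_ge0 ?exprn_ge0// ltW.
  - exact: expR_ge0.
  - by rewrite (ler_wpM2l (ltW eta0))// lef_pV2 ?posrE ?exprn_gt0// ler_weXn2l ?ler1n// leq_addr.
  - by rewrite ler_expR (ler_wnM2r (ltW t0))// !lerD2r ler_nat leq_double leq_addl.
apply: le_trans (tail M0) _.
rewrite (ler_wpM2r (expR_ge0 _))// (ler_wpM2r (ltW eta0))//.
by rewrite gerBl mulr_ge0// invr_ge0 exprn_ge0.
Qed.

End BorelSum.

(** * Flatness of the Monge-Ampere error at the corner *)

Section CornerPotential.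
Context {R : realType}.
Implicit Types (x y : R * R) (w : seq 'I_2) (i j : 'I_2) (H K : R -> R -> R)
  (t s tau eta m C : R) (k n N M : nat) (h : nat -> R -> R -> R) (T : nat -> R)
  (v f g : R * R -> R) (Z : set (R * R)).

Definition wbound Z k m f := smoothOm f /\ exists2 C, 0 <= C & wb Z k m C f.

Lemma wboundD Z k m f g : Z `<=` @halfplane R -> wbound Z k m f -> wbound Z k m g ->
  wbound Z k m (fun x => f x + g x).
Proof.
move=> ZH [sf [C C0 fC]] [sg [C' C0' gC]]; split; first exact: smoothOmD.
by exists (C + C'); [exact: addr_ge0|exact: wb_add].
Qed.

Lemma wboundM Z k m m' f g : Z `<=` @halfplane R -> wbound Z k m f -> wbound Z k m' g ->
  wbound Z k (m + m') (fun x => f x * g x).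
Proof.
move=> ZH [sf [C C0 fC]] [sg [C' C0' gC]]; split; first exact: smoothOmM.
exists (2 ^+ k * (C * C')); last exact: wb_mul.
by rewrite mulr_ge0 ?exprn_ge0// mulr_ge0.
Qed.

Lemma wboundWm Z k m m' f : Z `<=` corner -> m' <= m -> wbound Z k m f -> wbound Z k m' f.
Proof. by move=> ZZ mm [sf [C C0 fC]]; split=> //; exists C => //; exact: wbWm fC. Qed.

Lemma wbound_cst Z k C : Z `<=` corner -> wbound Z k 0 (fun=> C).
Proof.
by move=> ZZ; split; [exact: smoothOm_cst|exists `|C| => //; exact: wb_cst].
Qed.

Lemma wboundB Z k m f g : Z `<=` corner -> wbound Z k m f -> wbound Z k m g ->
  wbound Z k m (fun x => f x - g x).
Proof.
move=> ZZ fb gb.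
have ZH : Z `<=` @halfplane R by move=> x /ZZ; exact: corner_halfplane.
have -> : (fun x => f x - g x) = (fun x => f x + -1 * g x).
  by apply/funext => x; rewrite mulN1r.
apply: wboundD => //; rewrite -[m]add0r.
by apply: wboundM => //; exact: wbound_cst.
Qed.

Lemma wboundD2 Z k m i j f : wbound Z k.+2 m f ->
  wbound Z k (m - 2) ('D_(basis_vec i) ('D_(basis_vec j) f)).
Proof.
move=> [sf [C C0 fC]]; split; first by do 2!apply: smoothOm_D.
exists C => //; have -> : m - 2 = m - 1 - 1 by ring.
by apply: wbD1; exact: wbD1.
Qed.

Lemma wbound_eq Z k m f g : Z `<=` @halfplane R -> (forall x, halfplane x -> f x = g x) ->
  wbound Z k m g -> wbound Z k m f.
Proof.
move=> ZH fg [sg [C C0 gC]]; split; first exact: smoothOm_eq fg sg.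
by exists C => //; exact: wb_eq fg gC.
Qed.

Definition detD2 v x : R :=
  (1 + 'D_(basis_vec 0) ('D_(basis_vec 0) v) x) *
  (1 + 'D_(basis_vec 1) ('D_(basis_vec 1) v) x) -
  'D_(basis_vec 0) ('D_(basis_vec 1) v) x * 'D_(basis_vec 1) ('D_(basis_vec 0) v) x.

Lemma smoothOm_detD2 v : smoothOm v -> smoothOm (detD2 v).
Proof.
move=> sv; have sD i j := smoothOm_D i (smoothOm_D j sv).
apply: smoothOmB; last exact: smoothOmM.
by apply: smoothOmM; apply: smoothOmD => //; exact: smoothOm_cst.
Qed.

Lemma partial2_pol i j H x : tens smooth1 H -> halfplane x ->
  'D_(basis_vec i) ('D_(basis_vec j) (pol H)) x = pol (polD i (polD j H)) x.
Proof.
move=> sH Hx; rewrite -(partial_pol i (tens_polD_smooth j sH) Hx).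
have := @iter_partial_eq _ [:: i] ('D_(basis_vec j) (pol H)) (pol (polD j H)).
by apply=> // y Hy; exact: partial_pol.
Qed.

Lemma detD2_pol H x : tens smooth1 H -> halfplane x -> detD2 (pol H) x = pol (hdet H) x.
Proof.
move=> sH Hx; have P i j := partial2_pol i j sH Hx.
transitivity ((1 + polD 0 (polD 0 H) (logr x) (ang x)) *
  (1 + polD 1 (polD 1 H) (logr x) (ang x)) -
  polD 0 (polD 1 H) (logr x) (ang x) * polD 1 (polD 0 H) (logr x) (ang x)).
  rewrite /detD2; congr ((1 + _) * (1 + _) - _ * _); exact: P.
exact: (hdetE (logr x) (ang x) sH).
Qed.

Lemma polar_coordM x : halfplane x ->
  pol (fun t s => expR (2 * t) * (cos s * sin s)) x = x.1 * x.2.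
Proof.
move=> Hx; rewrite /pol mulr_natl mulr2n expRD expR_logr//.
have [-> ->] := ang_cos_sin Hx; field; by rewrite gt_eqF// enorm_gt0.
Qed.

Definition detD2_error v x : R := detD2 v x - 1 + 12 * pi * (x.1 * x.2).

Lemma near_partial2 i j f g x : (\near x, f x = g x) ->
  'D_(basis_vec i) ('D_(basis_vec j) f) x = 'D_(basis_vec i) ('D_(basis_vec j) g) x.
Proof. by move=> fg; exact: (nbhs_singleton (near_eq_iter [:: i; j] fg)). Qed.

Lemma partialD2 i j f g x : smoothOm f -> smoothOm g -> halfplane x ->
  'D_(basis_vec i) ('D_(basis_vec j) (fun y => f y + g y)) x =
  'D_(basis_vec i) ('D_(basis_vec j) f) x + 'D_(basis_vec i) ('D_(basis_vec j) g) x.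
Proof. by move=> sf sg Hx; exact: (@iter_partialD _ [:: i; j]). Qed.

(** Close to the corner [v] is the formal partial sum plus a tail of weight 2k + 5. The Hessian of
    the tail has weight 2k + 3, that of the partial sum is bounded in weight 0, and the error of the
    partial sum, of order r^(2k+4) up to logarithms, has weight 2k + 3 as well. *)
Lemma borel_flat h T k : (forall n, formal n.+2 (h n)) ->
  formal k.+2 (hdet_error (psum h k)) -> (forall n, T n <= - n.+2%:R) ->
  forall eta, 0 < eta ->
  (forall n, wb corner n.+3 (n.*2%:R + 3) (eta / 2 ^+ n) (pol (cutoff (T n) (h n)))) ->
  exists2 sigma, sigma < 0 & exists2 C, 0 <= C &
   wb (corner `&` [set x | logr x < sigma]) k (k%:R + 1) C
     (detD2_error (borel_sum h T)).
Proof.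
move=> hk herr hT eta eta0 hw.
(* Below the smallest of the first k + 1 cutoff levels these cutoffs equal 1, so the truncated sum
   is [psum h k] itself. *)
have [sigma sT s0] : exists2 sigma : R, forall n, (n < k.+1)%N -> sigma <= T n & sigma < 0.
  elim: (k.+1) => [|n [sg IH s0]]; first by exists (-1) => //; rewrite ltrN10.
  exists (Num.min sg (T n)); last by rewrite gt_min s0.
  move=> l; rewrite ltnS leq_eqVlt => /predU1P[->|ln]; first by rewrite ge_min lexx orbT.
  by rewrite ge_min IH.
exists sigma => //; set Z := _ `&` _.
have ZZ : Z `<=` corner by move=> x [].
have ZH : Z `<=` @halfplane R by move=> x /ZZ; exact: corner_halfplane.
set v := borel_sum h T; pose S := psum h k.
have sv : smoothOm v by exact: borel_sum_smooth.
have kS : formal 2 S.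
  rewrite /S /psum; elim: (k.+1) => [|n IH].
    apply: tens_eq (tens0 _); apply/funext => t; apply/funext => s.
    by rewrite big_ord0.
  have -> : (fun t s => \sum_(i < n.+1) h i t s) =
      fun t s => \sum_(i < n) h i t s + h n t s.
    by apply/funext => t; apply/funext => s; rewrite big_ord_recr.
  by apply: tensD => //; exact: formal_le (hk n).
have sS := formal_smooth kS; have sPS := smoothOm_pol sS.
pose r x := v x - pol S x.
have sr : smoothOm r by exact: smoothOmB.
have rb : wbound Z k.+2 (k.*2%:R + 5) r.
  split=> //; exists (2 * eta); first by rewrite mulr_ge0// ltW.
  have h1 := borel_tail_wb (N := k.+1) eta0 hk hT hw.
  have E : k.+1.*2%:R + 3 = k.*2%:R + 5 :> R by rewrite doubleS -addn2 natrD; ring.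
  rewrite E in h1.
  apply: (@wbWk _ _ k.+4); first by rewrite !ltnS -addn2 leq_addr.
  apply: wb_near (wbWZ ZZ h1) => x [cx xs].
  apply: filterS (near_logr_lt (corner_halfplane cx) xs) => y ys.
  rewrite /r; congr (_ - _); rewrite /pol /S /psum /cutsum.
  apply: eq_bigr => n _; rewrite cutoff1//.
  by apply: le_trans (ltW ys) _; exact: sT.
have Sb : wbound Z k.+2 3 (pol S).
  split=> //; have h34 : (3 : R) < 2.*2%:R by rewrite ltr_nat.
  by have [C C0 hC] := formal_wb k.+2 h34 kS; exists C => //; exact: wbWZ hC.
have rb2 i j := wboundD2 i j rb.
have E2 : k.*2%:R + 5 - 2 = k.*2%:R + 3 :> R by ring.
have {}rb2 i j : wbound Z k (k.*2%:R + 3) ('D_(basis_vec i) ('D_(basis_vec j) r)).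
  by rewrite -E2.
have Sb2 i j : wbound Z k 0 ('D_(basis_vec i) ('D_(basis_vec j) (pol S))).
  by apply: wboundWm (wboundD2 i j Sb) => //; lra.
have eb : wbound Z k (k.*2%:R + 3) (pol (hdet_error S)).
  split; first by apply: smoothOm_pol; exact: formal_smooth herr.
  have mk : k.*2%:R + 3 < k.+2.*2%:R :> R.
    by rewrite 2!doubleS -(addn4 k.*2) natrD ltrD2l ltr_nat.
  by have [C C0 hC] := formal_wb k mk herr; exists C => //; exact: wbWZ hC.
pose A i j := 'D_(basis_vec i) ('D_(basis_vec j) (pol S)).
pose B i j := 'D_(basis_vec i) ('D_(basis_vec j) r).
have vE i j x : halfplane x -> 'D_(basis_vec i) ('D_(basis_vec j) v) x = A i j x + B i j x.
  move=> Hx; have -> : v = (fun y => pol S y + r y).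
    apply/funext => y; rewrite /r. by rewrite addrCA subrr addr0.
  exact: partialD2.
have AB i j i' j' : wbound Z k (k.*2%:R + 3) (fun x => A i j x * B i' j' x).
  by have := wboundM ZH (Sb2 i j) (rb2 i' j'); rewrite add0r.
have BB i j i' j' : wbound Z k (k.*2%:R + 3) (fun x => B i j x * B i' j' x).
  apply: (@wboundWm _ _ (k.*2%:R + 3 + (k.*2%:R + 3))) => //.
    by rewrite lerDl addr_ge0// ler0n.
  exact: (wboundM ZH (rb2 i j) (rb2 i' j')).
(* The bracket expands det(I + A + B) - det(I + A); each of its terms contains an entry of [B], the
   Hessian of the tail. *)
pose E x := pol (hdet_error S) x + (B 0 0 x + B 1 1 x +
  (A 0 0 x * B 1 1 x + A 1 1 x * B 0 0 x + B 0 0 x * B 1 1 x) -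
  (A 0 1 x * B 1 0 x + A 1 0 x * B 0 1 x + B 0 1 x * B 1 0 x)).
have Eb : wbound Z k (k.*2%:R + 3) E.
  exact: (wboundD ZH eb (wboundB ZZ (wboundD ZH (wboundD ZH (rb2 0 0) (rb2 1 1))
    (wboundD ZH (wboundD ZH (AB 0 0 1 1) (AB 1 1 0 0)) (BB 0 0 1 1)))
    (wboundD ZH (wboundD ZH (AB 0 1 1 0) (AB 1 0 0 1)) (BB 0 1 1 0)))).
have vEb : forall x, halfplane x -> detD2_error v x = E x.
  move=> x Hx.
  transitivity ((1 + (A 0 0 x + B 0 0 x)) * (1 + (A 1 1 x + B 1 1 x)) -
      (A 0 1 x + B 0 1 x) * (A 1 0 x + B 1 0 x) - 1 + 12 * pi * (x.1 * x.2)).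
    by rewrite /detD2_error /detD2; congr ((1 + _) * (1 + _) - _ * _ - 1 + _); exact: vE.
  have EE : pol (hdet_error S) x = (1 + A 0 0 x) * (1 + A 1 1 x) - A 0 1 x * A 1 0 x - 1 +
      12 * pi * (x.1 * x.2).
    transitivity (pol (hdet S) x - 1 +
      12 * pi * pol (fun t s => expR (2 * t) * (cos s * sin s)) x); first by [].
    by rewrite -(detD2_pol sS Hx) (polar_coordM Hx).
  rewrite /E EE; move: (A 0 0 x) (A 0 1 x) (A 1 0 x) (A 1 1 x).
  by move: (B 0 0 x) (B 0 1 x) (B 1 0 x) (B 1 1 x) => *; ring.
have mk : k%:R + 1 <= k.*2%:R + 3 :> R.
  by rewrite -addnn natrD; have := ler0n R k; lra.
by have [_ [C C0 hC]] := wboundWm ZZ mk (wbound_eq ZH vEb Eb); exists C.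
Qed.

End CornerPotential.

(** * Existence of the corner potential *)

Section CornerPotentialExists.
Context {R : realType}.
Implicit Types (x y : R * R) (w : seq 'I_2) (i j : 'I_2) (H K : R -> R -> R)
  (t s r u tau eta m C : R) (k n N M : nat) (h : nat -> R -> R -> R) (T : nat -> R)
  (v f g : R * R -> R) (Z : set (R * R)).

Lemma iter_pol w H : tens smooth1 H -> exists2 K, tens smooth1 K &
  forall x, halfplane x -> iter_partial w (pol H) x = pol K x.
Proof.
move=> sH; elim: w => [|i w [K sK hK]]; first by exists H.
exists (polD i K); first exact: tens_polD_smooth.
move=> x Hx; rewrite -(partial_pol i sK Hx).
exact: (iter_partial_eq [:: i] hK).
Qed.

Lemma partialC_pol H x : tens smooth1 H -> halfplane x ->
  'D_(basis_vec 0) ('D_(basis_vec 1) (pol H)) x =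
  'D_(basis_vec 1) ('D_(basis_vec 0) (pol H)) x.
Proof.
move=> sH Hx; transitivity (pol (polD 0 (polD 1 H)) x); first exact: partial2_pol.
by rewrite (polDC 1 0 sH); apply/esym; exact: partial2_pol.
Qed.

Lemma ang_fst_axis r : 0 < r -> ang (r, 0) = 0 :> R.
Proof. by move=> r0; rewrite /ang /= mul0r atan0 mulr0. Qed.

Lemma enorm_fst_axis r : 0 < r -> enorm (r, 0) = r :> R.
Proof. by move=> r0; rewrite /enorm /= expr0n addr0 sqrtr_sqr gtr0_norm. Qed.

Lemma ang_snd_axis r : 0 < r -> ang (0, r) = pi / 2 :> R.
Proof.
move=> r0; rewrite /ang /enorm /= expr0n !add0r sqrtr_sqr gtr0_norm// divff ?gt_eqF//.
by rewrite atan1; field.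
Qed.

Lemma halfplane_fst_axis r : 0 < r -> halfplane (r, 0 : R).
Proof. by move=> r0; rewrite /halfplane /= addr0. Qed.

Lemma halfplane_snd_axis r : 0 < r -> halfplane (0 : R, r).
Proof. by move=> r0; rewrite /halfplane /= add0r. Qed.

Lemma dS_cutsum h T N t s : (forall n, formal n.+2 (h n)) ->
  (forall n t, dS (h n) t s = 0) -> dS (cutsum h T N) t s = 0.
Proof.
move=> hk h0; elim: N => [|N IH].
  by apply: derive1_is; rewrite /cutsum; under eq_fun do rewrite big_ord0; exact: is_derive_cst.
have sh := formal_smooth (hk N); have sc := tens_cutoff (T N) sh.
rewrite cutsumS (dSD (tens_cutsum T N hk) sc) IH add0r.
apply: derive1_is.
have hd := is_derive_mul (is_derive_cst (step (t - T N)) s 1) (tens_dS t s sh).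
by apply: (is_derive_eq hd); rewrite h0 mul0r mulr0 addr0.
Qed.

Lemma partial_fst_axis (g g' : R -> R) f : smoothOm f ->
  (forall r, 0 < r -> f (r, 0) = g r) -> (forall r, 0 < r -> is_derive r 1 g (g' r)) ->
  forall r, 0 < r -> 'D_(basis_vec 0) f (r, 0) = g' r.
Proof.
move=> sf fg dg r r0.
have /is_derive_line hf := smoothOm_is_derive 0 sf (halfplane_fst_axis r0).
have /is_derive_line hg := dg r r0.
have {}hf : is_derive (0 : R) 1 (fun h : R => g (h *: (1 : R) + r)) ('D_(basis_vec 0) f (r, 0)).
  apply: near_eq_is_derive hf; near=> u.
  have -> : u *: basis_vec 0 + (r, 0) = (u *: (1 : R) + r, 0).
    by rewrite [LHS]surjective_pairing /= scaler0 addr0.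
  apply: fg; rewrite [_%:A]mulr1 -ltrBlDr sub0r; near: u; apply: lt_nbhsr.
  by rewrite oppr_lt0.
by rewrite -(@derive_val _ _ _ _ _ _ _ hf) (@derive_val _ _ _ _ _ _ _ hg).
Unshelve. all: by end_near. Qed.

Lemma lead_fst_axis r : 0 < r -> pol (@lead R) (r, 0) = r ^+ 4 * ln r.
Proof.
move=> r0; rewrite /pol ang_fst_axis// /logr enorm_fst_axis// /lead /lead_ang.
rewrite !mulr0 cos0 sin0 mul0r oppr0 !expr0n /= !mulr0 subr0 addr0 mulr1.
by rewrite expRM_natl lnK.
Qed.

(** On the axis s = 0 the leading term is r^4 log r, and four differentiations leave the logarithm:
    this is the source of the blow-up. *)
Lemma lead_partial4 r : 0 < r ->
  iter_partial [:: 0; 0; 0; 0] (pol (@lead R)) (r, 0) = 24 * ln r + 50.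
Proof.
have s0 := smoothOm_pol (formal_smooth (@formal_lead R)).
have dl u : 0 < u -> is_derive u 1 (@ln R) u^-1 by exact: is_derive1_ln.
have dX n u : is_derive u 1 (fun u => u ^+ n) (n%:R * u ^+ n.-1).
  by have := smooth1_isd u (@smooth1_exp R n); rewrite derive1_exp.
have step n (a b u : R) : 0 < u ->
    is_derive u 1 (fun u => a * (u ^+ n.+1 * ln u) + b * u ^+ n.+1)
      (a * n.+1%:R * (u ^+ n * ln u) + (a + b * n.+1%:R) * u ^+ n).
  move=> u0; have h := is_derive_add
    (is_derive_mul (is_derive_cst a u 1) (is_derive_mul (dX n.+1 u) (dl u u0)))
    (is_derive_mul (is_derive_cst b u 1) (dX n.+1 u)).
  apply: (is_derive_eq h); rewrite /cst /= [u ^+ n.+1]exprSr mulfK ?gt_eqF//.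
  by ring.
have h0 u : 0 < u -> pol lead (u, 0) = 1 * (u ^+ 4 * ln u) + 0 * u ^+ 4.
  by move=> u0; rewrite lead_fst_axis// mul1r mul0r addr0.
have s1 := smoothOm_D 0 s0; have s2 := smoothOm_D 0 s1; have s3 := smoothOm_D 0 s2.
have h1 := partial_fst_axis s0 h0 (step 3%N 1 0).
have h2 := partial_fst_axis s1 h1 (step 2%N _ _).
have h3 := partial_fst_axis s2 h2 (step 1%N _ _).
have h4 := partial_fst_axis s3 h3 (step 0%N _ _).
by move=> r0; rewrite /= (h4 r r0) expr0; ring.
Qed.

(** Each item has its use: vanishing for r >= 1/e and the Neumann conditions fix the boundary
    behaviour of the map; smallness [eta] gives a positive density and a convex potential; the
    weights 3 + alpha give Hoelder regularity; the flat error gives smoothness of the density; the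
    blow-up excludes C^3. *)
Theorem corner_potential eta : 0 < eta -> exists v,
  [/\ [/\ smoothOm v, (forall x, -1 <= logr x -> v x = 0) &
       forall w x, halfplane x -> 'D_(basis_vec 0) ('D_(basis_vec 1) (iter_partial w v)) x =
         'D_(basis_vec 1) ('D_(basis_vec 0) (iter_partial w v)) x],
   (forall r, 0 < r -> 'D_(basis_vec 0) v (0, r) = 0 /\ 'D_(basis_vec 1) v (r, 0) = 0),
   wb corner 3 3 eta v /\
     (forall alpha, alpha < 1 -> exists2 C, 0 <= C & wb corner 4 (3 + alpha) C v),
   (forall k, exists2 sigma, sigma < 0 & exists2 C, 0 <= C &
     wb (corner `&` [set x | logr x < sigma]) k (k%:R + 1) C (detD2_error v)) &
   forall B e, 0 < e -> exists x, [/\ openQ x, enorm x < e &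
     B < `|iter_partial [:: 0; 0; 0; 0] v x|]].
Proof.
move=> eta0; have [h [h0 hk hN hE]] := @formal_solution R.
have e2 : 0 < eta / 2 by exact: divr_gt0.
have /choice[T hT] n : exists tau, tau <= - n.+2%:R /\
    wb corner n.+3 (n.*2%:R + 3) (eta / 2 / 2 ^+ n) (pol (cutoff tau (h n))).
  have en : 0 < eta / 2 / 2 ^+ n by rewrite divr_gt0// exprn_gt0.
  by have [tau t1 t2] := cutoff_wb (hk n) en; exists tau.
have T1 n : T n <= - n.+2%:R by have [] := hT n.
have T2 n := (hT n).2.
have tail N := borel_tail_wb (N := N) e2 hk T1 T2.
have E2 : 2 * (eta / 2) = eta by field.
rewrite {}E2 in tail.
set v := borel_sum h T.
have sv : smoothOm v by exact: borel_sum_smooth.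
have sc N := tens_cutsum T N hk.
exists v; split.
- split; first exact: sv.
    move=> x x1; rewrite /v (borel_sum_eq (N := 0) h T1) ?oppr0 ?add0r//.
    by rewrite /pol /cutsum big_ord0.
  move=> w x Hx; have [N hvN] := borel_sum_near h T1 Hx.
  have [K sK hK] := iter_pol w (sc N).
  have E : \near x, iter_partial w v x = pol K x.
    have := near_eq_iter w (hvN N (leqnn N)); apply: filterS2 (near_halfplane Hx) => y Hy ->.
    exact: hK.
  transitivity ('D_(basis_vec 0) ('D_(basis_vec 1) (pol K)) x); first exact: near_partial2.
  rewrite (partialC_pol sK Hx); apply/esym; exact: near_partial2.
- move=> r r0; split.
    have Hx := halfplane_snd_axis r0; have [N hvN] := borel_sum_near h T1 Hx.
    have /nbhs_singleton -> := near_eq_D 0 (hvN N (leqnn N)).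
    rewrite (partial_pol 0 (sc N) Hx) /pol /polD ang_snd_axis// (dS_cutsum _ _ _ hk).
      by rewrite /dircos /= cos_pihalf mul0r mulr0 addr0 mulr0.
    by move=> n t; have [] := hN n t.
  have Hx := halfplane_fst_axis r0; have [N hvN] := borel_sum_near h T1 Hx.
  have /nbhs_singleton -> := near_eq_D 1 (hvN N (leqnn N)).
  rewrite (partial_pol 1 (sc N) Hx) /pol /polD ang_fst_axis// (dS_cutsum _ _ _ hk).
    by rewrite /dircos /= sin0 mul0r mulr0 addr0 mulr0.
  by move=> n t; have [] := hN n t.
- split.
    (* The tail after zero terms is the whole sum. *)
    have := tail 0%N; rewrite double0 add0r => t0.
    apply: wb_near t0 => x _; apply: filterE => y.
    by rewrite /pol /cutsum big_ord0 subr0.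
  move=> alpha a1.
  (* The tail from index 1 has weight 5; only the cut-off leading term, of size r^4 log r, keeps the
     weight below 4. *)
  have m1 : 3 + alpha < 2.*2%:R by rewrite -ltrBrDl; apply: (lt_le_trans a1); rewrite -[2.*2]/4%N; lra.
  have [C1 C10 h1] := formal_wb 4 m1 (hk 0%N).
  have [C2 C20 h2] := steplike_wb 4 (@steplike_step R).
  have s1 : smoothOm (pol (fun t _ : R => step (t - T 0%N))).
    by apply: smoothOm_pol; apply: tens_a; apply: smooth1_shift; exact: smooth1_step.
  have s2 : smoothOm (pol (h 0%N)) by apply: smoothOm_pol; exact: formal_smooth (hk 0%N).
  have hm := wb_mul corner_halfplane s1 s2 C20 C10 (h2 (T 0%N)) h1.
  exists (eta + 2 ^+ 4 * (C2 * C1)).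
    by rewrite (addr_ge0 (ltW eta0))// mulr_ge0 ?exprn_ge0// mulr_ge0.
  have sr : smoothOm (fun x => v x - pol (cutsum h T 1) x).
    by apply: smoothOmB => //; apply: smoothOm_pol.
  have t1 : wb corner 4 (3 + alpha) eta (fun x => v x - pol (cutsum h T 1) x).
    apply: wbWm (tail 1%N) => //; first exact: ltW.
    by rewrite -[1.*2]/2%N; lra.
  have := wb_add corner_halfplane sr (smoothOmM s1 s2) t1; rewrite add0r in hm.
  move=> /(_ _ hm); apply: wb_near => x _; apply: filterE => y.
  have -> : pol (cutsum h T 1) y = pol (fun t _ : R => step (t - T 0%N)) y * pol (h 0%N) y.
    by rewrite /pol /cutsum big_ord_recl big_ord0 addr0.
  by rewrite subrK.
- move=> k; exact: (borel_flat hk (hE k) T1 e2 T2).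
- move=> B e e0.
  (* The second bound puts the point where the cutoff of the leading term is 1; the third makes 24
     log r + 50 exceed [B] in absolute value even after a perturbation of size [eta] by the other
     terms. *)
  pose r := Num.min (e / 2) (Num.min (expR (T 0%N - 1)) (expR (- (`|B| + eta + 50)))).
  have r0 : 0 < r by rewrite !lt_min !expR_gt0 divr_gt0.
  have re : r < e.
    apply: (@le_lt_trans _ _ (e / 2)); first by rewrite ge_min lexx.
    by lra.
  have rT : ln r <= T 0%N - 1.
    by rewrite -[leRHS]expRK ler_ln ?posrE ?expR_gt0// !ge_min lexx !orbT.
  have rB : ln r <= - (`|B| + eta + 50).
    by rewrite -[leRHS]expRK ler_ln ?posrE ?expR_gt0// !ge_min lexx !orbT.
  have T0 := T1 0%N.
  have lr0 : ln r < 0.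
    by apply: (le_lt_trans rT); apply: (@le_lt_trans _ _ (- 2 - 1)); [rewrite lerD2r|lra].
  have r1 : r < 1 by rewrite -[r]lnK ?posrE// expR_lt1.
  have Hx := halfplane_fst_axis r0.
  have lrE : logr (r, 0) = ln r by rewrite /logr enorm_fst_axis.
  have cx : corner (r, 0).
    split; rewrite ?lrE//.
      by rewrite /closedQ /= !in_itv /= !lexx ler01 !ltW.
    by apply/eqP => -[r00]; move: r0; rewrite r00 ltxx.
  have s1 : smoothOm (fun x => v x - pol (cutsum h T 1) x).
    by apply: smoothOmB => //; apply: smoothOm_pol.
  have sl := smoothOm_pol (sc 1%N).
  have D4 : B < `|iter_partial [:: 0; 0; 0; 0] v (r, 0)|.
    have -> : v = fun x => (v x - pol (cutsum h T 1) x) + pol (cutsum h T 1) x.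
      by apply/funext => x; rewrite subrK.
    rewrite (iter_partialD [:: 0; 0; 0; 0] s1 sl Hx).
    have /nbhs_singleton -> : \forall y \near (r, 0 : R), iter_partial [:: 0; 0; 0; 0] (pol (cutsum h T 1)) y =
       iter_partial [:: 0; 0; 0; 0] (pol lead) y.
      apply: near_eq_iter.
      have rT' : logr (r, 0) < T 0%N by rewrite lrE; apply: (le_lt_trans rT); lra.
      apply: filterS (near_logr_lt Hx rT') => y yT.
      by rewrite /pol /cutsum big_ord_recl big_ord0 addr0 cutoff1 ?h0// ltW.
    rewrite lead_partial4//.
    have := tail 1%N [:: 0; 0; 0; 0] (r, 0) isT cx.
    move: (iter_partial _ _ _) => z; rewrite lrE.
    have -> : 1.*2%:R + 3 - (size [:: (0 : 'I_2); 0; 0; 0])%:R = 1 :> R.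
      by rewrite -[1.*2]/2%N -[size _]/4%N; ring.
    rewrite mul1r => hz.
    have {}hz : `|z| <= eta.
      by apply: le_trans hz _; rewrite ger_pMr// expR_le1 ltW.
    have hB := ler_norm B.
    rewrite -[X in B < `|X|]opprK normrN.
    apply: lt_le_trans _ (ler_norm _).
    have := ler_norm z; have := normr_ge0 B; lra.
  (* The point (r, 0) lies on a side; the estimate moves to interior points (r, d) by continuity as
     d decreases to 0. *)
  have sv4 := smoothOm_iter [:: 0; 0; 0; 0] sv.
  have c4 : {for (r, 0), continuous (fun x => `|iter_partial [:: 0; 0; 0; 0] v x|)}.
    by apply: (@continuous_comp _ _ _ (iter_partial [:: 0; 0; 0; 0] v) Num.norm);
      [exact: (smoothOm_cont sv4)|exact: norm_continuous].
  have n1 : \forall y \near (r, 0 : R), B < `|iter_partial [:: 0; 0; 0; 0] v y|.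
    exact: (c4 _ (lt_nbhsr D4)).
  have n2 : \forall y \near (r, 0 : R), enorm y < e.
    have re' : enorm (r, 0 : R) < e by rewrite enorm_fst_axis.
    exact: (@enorm_continuous R (r, 0) _ (lt_nbhsl re')).
  have cp : (fun d : R => (r, d)) @ (0 : R)^'+ --> (r, 0 : R).
    apply: (@cvg_pair _ _ _ _ (nbhs r) (nbhs (0 : R))); first exact: cvg_cst.
    exact: (@cvg_within _ (nbhs (0 : R))).
  have : \forall d \near (0 : R)^'+, [/\ openQ (r, d), enorm (r, d) < e &
      B < `|iter_partial [:: 0; 0; 0; 0] v (r, d)|].
    near=> d; split.
    - rewrite /openQ /= !in_itv /= r0 r1; split=> //; apply/andP; split; near: d.
        exact: nbhs_right_gt.
      by apply: nbhs_right_lt.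
    - by near: d; exact: (cp _ n2).
    - by near: d; exact: (cp _ n1).
  move=> near0; have nex := @filter_ex _ ((0 : R)^'+) (at_right_proper_filter 0) _ near0.
  by case: nex => d hd; exists (r, d).
Unshelve. all: by end_near. Qed.

End CornerPotentialExists.

(** * Extension to the corner *)

Section ClosedSquare.
Context {R : realType}.
Implicit Types (x y z : R * R) (w : seq 'I_2) (i j : 'I_2)
  (t s r eta m C M : R) (k n : nat) (f g h v : R * R -> R).

Definition lim0 h := forall e, 0 < e -> exists2 d, 0 < d &
  forall x, closedQ x -> x != 0 -> enorm x < d -> `|h x| < e.

(** Expressions in [logr] and [ang] take meaningless default values at the corner; the functions
    patched in this way tend to 0 there. *)
Definition patch0 h x : R := if x == 0 then 0 else h x.

Lemma patch0E h x : x != 0 -> patch0 h x = h x.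
Proof. by rewrite /patch0 => /negPf ->. Qed.

Lemma near_patch0 h x : halfplane x -> \near x, patch0 h x = h x.
Proof.
move=> Hx; apply: filterS (near_halfplane Hx) => y Hy; apply: patch0E.
by apply: contraTN Hy => /eqP ->; rewrite /halfplane /= addr0 ltxx.
Qed.

Lemma continuous_patch0 h : (forall x, halfplane x -> {for x, continuous h}) -> lim0 h ->
  {within closedQ, continuous (patch0 h)}.
Proof.
move=> ch h0; apply/subspace_continuousP => x cx; rewrite /from_subspace.
have [->|xn0] := eqVneq x 0.
  have p0 : patch0 h 0 = 0 by rewrite /patch0 eqxx.
  rewrite p0; apply/cvgr0Pnorm_lt => e e0.
  have [d d0 hd] := h0 e e0.
  have nd : \forall y \near (0 : R * R), enorm y < d.
    have e0' : enorm (0 : R * R) < d by rewrite /enorm /= expr0n addr0 sqrtr0.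
    exact: (@enorm_continuous R 0 _ (lt_nbhsl e0')).
  near=> y; rewrite /patch0; case: ifPn => [_|yn0]; first by rewrite normr0.
  apply: hd => //; last by near: y; exact: cvg_within nd.
  by near: y; exact: withinT.
have Hx := closedQ_halfplane cx xn0.
apply: cvg_within_filter; rewrite (patch0E _ xn0).
apply: cvg_trans (ch x Hx); apply: near_eq_cvg.
by apply: filterS (near_patch0 h Hx) => y ->.
Unshelve. all: by end_near. Qed.

(** Closed under partial derivatives and large enough for the explicit parts of the data: both
    coordinates, the constant 1, and 1 - 12 pi x_1 x_2. *)
Definition bil (c0 c1 c2 c3 : R) x : R := c0 + c1 * x.1 + c2 * x.2 + c3 * (x.1 * x.2).

Lemma bil_is_derive c0 c1 c2 c3 i x : is_derive x (basis_vec i) (bil c0 c1 c2 c3)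
  (if i == ord0 then bil c1 0 c3 0 x else bil c2 c3 0 0 x).
Proof.
have h1 := is_derive_fst x (basis_vec i); have h2 := is_derive_snd x (basis_vec i).
have cst c : is_derive x (basis_vec i) (fun=> c : R) 0 by exact: is_derive_cst.
have h := is_derive_add (is_derive_add (is_derive_add (cst c0) (is_derive_mul (cst c1) h1))
  (is_derive_mul (cst c2) h2)) (is_derive_mul (cst c3) (is_derive_mul h1 h2)).
apply: (is_derive_eq h); rewrite /basis_vec /bil; case: ifP => _ /=; ring.
Qed.

Lemma iter_bil w c0 c1 c2 c3 : exists d0 d1 d2 d3,
  iter_partial w (bil c0 c1 c2 c3) = bil d0 d1 d2 d3.
Proof.
elim: w => [|i w [d0 [d1 [d2 [d3 IH]]]]]; first by exists c0, c1, c2, c3.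
rewrite /= IH.
have E x := @derive_val _ _ _ _ _ _ _ (bil_is_derive d0 d1 d2 d3 i x).
case: (eqVneq i ord0) E => _ E.
  by exists d1, 0, d3, 0; apply/funext => x; rewrite E.
by exists d2, d3, 0, 0; apply/funext => x; rewrite E.
Qed.

Lemma bil_continuous c0 c1 c2 c3 : continuous (bil c0 c1 c2 c3).
Proof.
move=> x.
have c1c : {for x, continuous (fst : R * R -> R)} by exact: cvg_fst.
have c2c : {for x, continuous (snd : R * R -> R)} by exact: cvg_snd.
suff : {for x, continuous (fun x => c0 + c1 * x.1 + c2 * x.2 + c3 * (x.1 * x.2))} by [].
apply: continuousD; last by apply: continuousM; [exact: cvg_cst|exact: continuousM].
apply: continuousD; last by apply: continuousM; [exact: cvg_cst|].
by apply: continuousD; [exact: cvg_cst|apply: continuousM; [exact: cvg_cst|]].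
Qed.

Lemma smoothOm_bil c0 c1 c2 c3 : smoothOm (bil c0 c1 c2 c3).
Proof.
apply: (@smoothOm_coind _ (fun h => exists d0 d1 d2 d3, h = bil d0 d1 d2 d3)); last first.
  by exists c0, c1, c2, c3.
move=> _ [d0 [d1 [d2 [d3 ->]]]]; split=> [x _|i]; first exact: bil_continuous.
split=> [x _|]; first by have := bil_is_derive d0 d1 d2 d3 i x => ?; exact: ex_derive.
have [e0 [e1 [e2 [e3 E]]]] := iter_bil [:: i] d0 d1 d2 d3.
by exists (bil e0 e1 e2 e3) => [|x _]; [exists e0, e1, e2, e3|rewrite -E].
Qed.

Lemma near_iter_bil_patch0 w c0 c1 c2 c3 h x : smoothOm h -> halfplane x ->
  \near x, iter_partial w (fun x => bil c0 c1 c2 c3 x + patch0 h x) x =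
     iter_partial w (bil c0 c1 c2 c3) x + iter_partial w h x.
Proof.
move=> sh Hx.
have := @near_eq_iter _ w (fun x => bil c0 c1 c2 c3 x + patch0 h x)
  (fun x => bil c0 c1 c2 c3 x + h x) x.
have -> : (\near x, bil c0 c1 c2 c3 x + patch0 h x = bil c0 c1 c2 c3 x + h x) = True.
  by apply/propext; split=> // _; apply: filterS (near_patch0 h Hx) => y ->.
move=> /(_ I); apply: filterS2 (near_halfplane Hx) => y Hy ->.
by rewrite iter_partialD//; exact: smoothOm_bil.
Qed.

Lemma extension_bil_patch0 w c0 c1 c2 c3 h : smoothOm h -> lim0 (iter_partial w h) ->
  continuous_extension (iter_partial w (fun x => bil c0 c1 c2 c3 x + patch0 h x))
   (fun x => iter_partial w (bil c0 c1 c2 c3) x + patch0 (iter_partial w h) x).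
Proof.
move=> sh h0; split; last first.
  move=> x Qx; have Hx := openQ_halfplane Qx.
  rewrite (nbhs_singleton (near_iter_bil_patch0 w c0 c1 c2 c3 sh Hx)).
  by rewrite (nbhs_singleton (near_patch0 (iter_partial w h) Hx)).
have [d0 [d1 [d2 [d3 ->]]]] := iter_bil w c0 c1 c2 c3.
have cb : {within closedQ, continuous (bil d0 d1 d2 d3)}.
  by apply: continuous_subspaceT; exact: bil_continuous.
have cp : {within closedQ, continuous (patch0 (iter_partial w h))}.
  by apply: continuous_patch0 => // x Hx; apply: smoothOm_cont => //; exact: smoothOm_iter.
by move=> x; apply: continuousD; [exact: cb|exact: cp].
Qed.

(** The common form of the density, of the components of the map and of the constant 1. Regularity
    on the closed square reduces to limits at the single point 0, because the half-plane covers the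
    rest of the boundary. *)
Lemma Ck_bil_patch0 k c0 c1 c2 c3 h : smoothOm h ->
  (forall w, (size w <= k)%N -> lim0 (iter_partial w h)) ->
  Ck k (fun x => bil c0 c1 c2 c3 x + patch0 h x).
Proof.
move=> sh h0; split.
- by have [+ _] := extension_bil_patch0 (w := [::]) c0 c1 c2 c3 sh (h0 [::] isT).
- move=> w i x _ Qx; have Hx := openQ_halfplane Qx.
  apply: (near_eq_derivable (f := fun x => iter_partial w (bil c0 c1 c2 c3) x + iter_partial w h x)).
    apply: filterS (near_iter_bil_patch0 w c0 c1 c2 c3 sh Hx) => y E; exact: esym.
  apply: derivableD; apply: smoothOm_derivable => //; apply: smoothOm_iter => //.
  exact: smoothOm_bil.
- move=> w wk; eexists; exact: extension_bil_patch0 (h0 w wk).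
Qed.

Lemma wb_lim0 (sigma : R) k m C h w : 0 <= C ->
  wb (corner `&` [set x | logr x < sigma]) k m C h -> (size w <= k)%N ->
  (size w)%:R < m -> lim0 (iter_partial w h).
Proof.
move=> C0 hw wk wm e e0; pose a := m - (size w)%:R.
have a0 : 0 < a by rewrite subr_gt0.
have C1 : 0 < C + 1 by rewrite ltr_wpDl.
pose t := Num.min (Num.min 0 sigma) (ln (e / (C + 1)) / a).
exists (expR t); first exact: expR_gt0.
move=> x cx xn0 xt; have Hx := closedQ_halfplane cx xn0.
have {}xt : logr x < t by rewrite -[t]expRK ltr_ln ?posrE ?enorm_gt0// expR_gt0.
move: xt; rewrite !lt_min => /andP[/andP[x0 xs] xa].
have Zx : (corner `&` [set x | logr x < sigma]) x by split.
apply: (le_lt_trans (hw w x wk Zx)); rewrite -/a.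
apply: (@le_lt_trans _ _ ((C + 1) * expR (a * logr x))).
  by rewrite ler_wpM2r ?expR_ge0// lerDl.
rewrite mulrC -ltr_pdivlMr// -[ltRHS]lnK ?posrE ?divr_gt0// ltr_expR.
by rewrite mulrC -ltr_pdivlMr.
Qed.

Lemma wb_near0_lim0 k m C h w : 0 <= C -> wb corner k m C h -> (size w <= k)%N ->
  (size w)%:R < m -> lim0 (iter_partial w h).
Proof.
move=> C0 hw; apply: (@wb_lim0 0 k m C) => //.
by apply: wbWZ hw => x [].
Qed.

End ClosedSquare.

(** * Mean value and Hoelder estimates on the closed square *)

Section MeanValue.
Context {R : realType}.
Implicit Types (x y z : R * R) (w : seq 'I_2) (i j : 'I_2)
  (a b q t s r eta m C M : R) (k n : nat) (f g h v : R * R -> R).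

Lemma enormD x y : enorm (x + y) <= enorm x + enorm y.
Proof.
rewrite -(@ler_pXn2r _ 2) ?nnegrE ?addr_ge0 ?sqrtr_ge0// sqrrD !sqr_enorm.
have CS : x.1 * y.1 + x.2 * y.2 <= enorm x * enorm y.
  apply: le_trans (ler_norm _) _.
  rewrite -(@ler_pXn2r _ 2) ?nnegrE ?mulr_ge0 ?sqrtr_ge0// real_normK ?num_real//.
  rewrite exprMn !sqr_enorm -subr_ge0.
  have -> : (x.1 ^+ 2 + x.2 ^+ 2) * (y.1 ^+ 2 + y.2 ^+ 2) - (x.1 * y.1 + x.2 * y.2) ^+ 2 =
    (x.1 * y.2 - x.2 * y.1) ^+ 2 by ring.
  exact: sqr_ge0.
rewrite /=; move: CS; lra.
Qed.

Lemma enormN x : enorm (- x) = enorm x.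
Proof. by rewrite /enorm /= !sqrrN. Qed.

Lemma le_enorm x y : `|x.1| <= `|y.1| -> `|x.2| <= `|y.2| -> enorm x <= enorm y.
Proof.
move=> h1 h2; rewrite ler_wsqrtr// lerD//.
  by rewrite -[x.1 ^+ 2]real_normK ?num_real// -[y.1 ^+ 2]real_normK ?num_real// lerXn2r ?nnegrE.
by rewrite -[x.2 ^+ 2]real_normK ?num_real// -[y.2 ^+ 2]real_normK ?num_real// lerXn2r ?nnegrE.
Qed.

Lemma fst_le_enorm x : `|x.1| <= enorm x.
Proof.
by rewrite -sqrtr_sqr ler_wsqrtr// lerDl sqr_ge0.
Qed.

Lemma snd_le_enorm x : `|x.2| <= enorm x.
Proof.
by rewrite -sqrtr_sqr ler_wsqrtr// lerDr sqr_ge0.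
Qed.

Lemma enorm0 : enorm (0 : R * R) = 0.
Proof. by rewrite /enorm /= expr0n addr0 sqrtr0. Qed.

Lemma enorm_eq0 x : enorm x = 0 -> x = 0.
Proof.
move=> x0; rewrite [x]surjective_pairing.
have := fst_le_enorm x; have := snd_le_enorm x.
by rewrite x0 !normr_le0 => /eqP -> /eqP ->.
Qed.

Lemma is_derive_row g s q : smoothOm g -> halfplane (s, q) ->
  is_derive s 1 (fun s => g (s, q)) ('D_(basis_vec 0) g (s, q)).
Proof.
move=> sg Hx; have /is_derive_line h := smoothOm_is_derive 0 sg Hx.
apply/is_derive_line; apply: near_eq_is_derive h; apply: filterE => u.
by congr g; rewrite [LHS]surjective_pairing /= scaler0 add0r.
Qed.

Lemma is_derive_column g s q : smoothOm g -> halfplane (q, s) ->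
  is_derive s 1 (fun s => g (q, s)) ('D_(basis_vec 1) g (q, s)).
Proof.
move=> sg Hx; have /is_derive_line h := smoothOm_is_derive 1 sg Hx.
apply/is_derive_line; apply: near_eq_is_derive h; apply: filterE => u.
by congr g; rewrite [LHS]surjective_pairing /= scaler0 add0r.
Qed.

Lemma row_within g a b q : 0 <= a -> b <= 1 -> 0 <= q <= 1 ->
  {within closedQ, continuous g} -> {within `[a, b], continuous (fun s => g (s, q))}.
Proof.
move=> a0 b1 q01 /subspace_continuousP cg; apply/subspace_continuousP => s.
rewrite /= in_itv /= => /andP[as_ sb].
have cQ : closedQ (s, q).
  by rewrite /closedQ /= !in_itv /= q01 (le_trans a0 as_) (le_trans sb b1).
move=> P nP; have {}nP := cg _ cQ P nP.
have cp : (fun s : R => (s, q)) @ s --> (s, q).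
  by apply: (@cvg_pair _ _ _ _ (nbhs s) (nbhs q)); [exact: cvg_id|exact: cvg_cst].
have {}nP : \forall u \near s, closedQ (u, q) -> P (g (u, q)) := cp _ nP.
have H : \forall u \near s, u \in `[a, b] -> P (g (u, q)).
  apply: filterS nP => u /= hu; rewrite in_itv /= => /andP[au ub]; apply: hu.
  by rewrite /closedQ /= !in_itv /= q01 (le_trans a0 au) (le_trans ub b1).
exact: H.
Qed.

Lemma column_within g a b q : 0 <= a -> b <= 1 -> 0 <= q <= 1 ->
  {within closedQ, continuous g} -> {within `[a, b], continuous (fun s => g (q, s))}.
Proof.
move=> a0 b1 q01 /subspace_continuousP cg; apply/subspace_continuousP => s.
rewrite /= in_itv /= => /andP[as_ sb].
have cQ : closedQ (q, s).
  by rewrite /closedQ /= !in_itv /= q01 (le_trans a0 as_) (le_trans sb b1).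
move=> P nP; have {}nP := cg _ cQ P nP.
have cp : (fun s : R => (q, s)) @ s --> (q, s).
  by apply: (@cvg_pair _ _ _ _ (nbhs q) (nbhs s)); [exact: cvg_cst|exact: cvg_id].
have {}nP : \forall u \near s, closedQ (q, u) -> P (g (q, u)) := cp _ nP.
have H : \forall u \near s, u \in `[a, b] -> P (g (q, u)).
  apply: filterS nP => u /= hu; rewrite in_itv /= => /andP[au ub]; apply: hu.
  by rewrite /closedQ /= !in_itv /= q01 (le_trans a0 au) (le_trans ub b1).
exact: H.
Qed.

Definition between a b s := (a <= s <= b) || (b <= s <= a).

Lemma MVT_between (f df : R -> R) a b :
  (forall s, 0 < s < 1 -> is_derive s 1 f (df s)) -> 0 <= a <= 1 -> 0 <= b <= 1 ->
  {within `[0, 1], continuous f} -> a != b ->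
  exists c, [/\ 0 < c < 1, between a b c & f b - f a = df c * (b - a)].
Proof.
move=> dd /andP[a0 a1] /andP[b0 b1] cf ab.
wlog ab' : a b a0 a1 b0 b1 ab / a < b => [H|].
  move: (ab); rewrite neq_lt => /orP[|] ab'; first exact: H.
  have ab2 : b != a by rewrite eq_sym.
  have [c [c1 c2 c3]] := H b a b0 b1 a0 a1 ab2 ab'; exists c; split=> //.
    by rewrite /between orbC.
  by rewrite -opprB c3; ring.
have cf' : {within `[a, b], continuous f}.
  apply: continuous_subspaceW cf => s /=; rewrite !in_itv /= => /andP[as_ sb].
  by rewrite (le_trans a0 as_) (le_trans sb b1).
have dd' s : s \in `]a, b[ -> is_derive s 1 f (df s).
  rewrite in_itv /= => /andP[as_ sb]; apply: dd.
  by rewrite (le_lt_trans a0 as_) (lt_le_trans sb b1).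
have [c cab E] := MVT ab' dd' cf'.
move: cab; rewrite in_itv /= => /andP[ac cb]; exists c; split=> //.
  by rewrite (le_lt_trans a0 ac) (lt_le_trans cb b1).
by apply/orP; left; rewrite (ltW ac) (ltW cb).
Qed.

Lemma row_increment h a b q : smoothOm h -> {within closedQ, continuous (patch0 h)} ->
  0 <= a <= 1 -> 0 <= b <= 1 -> 0 <= q <= 1 -> a != b ->
  exists c, [/\ 0 < c < 1, between a b c &
   patch0 h (b, q) - patch0 h (a, q) = 'D_(basis_vec 0) h (c, q) * (b - a)].
Proof.
move=> sh ch a01 b01 q01 ab.
apply: (@MVT_between (fun s => patch0 h (s, q)) (fun s => 'D_(basis_vec 0) h (s, q))) => //.
  move=> s /andP[s0 s1]; have Hx : halfplane (s, q).
    by rewrite /halfplane /= ltr_wpDr//; case/andP: q01.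
  apply: near_eq_is_derive (is_derive_row sh Hx).
  near=> u; apply/esym/patch0E; apply/eqP => -[u0 _].
  have : 0 < u by near: u; exact: lt_nbhsr.
  by rewrite u0 ltxx.
exact: (row_within (g := patch0 h) (lexx 0) (lexx 1) q01 ch).
Unshelve. all: by end_near. Qed.

Lemma column_increment h a b q : smoothOm h -> {within closedQ, continuous (patch0 h)} ->
  0 <= a <= 1 -> 0 <= b <= 1 -> 0 <= q <= 1 -> a != b ->
  exists c, [/\ 0 < c < 1, between a b c &
   patch0 h (q, b) - patch0 h (q, a) = 'D_(basis_vec 1) h (q, c) * (b - a)].
Proof.
move=> sh ch a01 b01 q01 ab.
apply: (@MVT_between (fun s => patch0 h (q, s)) (fun s => 'D_(basis_vec 1) h (q, s))) => //.
  move=> s /andP[s0 s1]; have Hx : halfplane (q, s).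
    by rewrite /halfplane /= ltr_wpDl//; case/andP: q01.
  apply: near_eq_is_derive (is_derive_column sh Hx).
  near=> u; apply/esym/patch0E; apply/eqP => -[_ u0].
  have : 0 < u by near: u; exact: lt_nbhsr.
  by rewrite u0 ltxx.
exact: (column_within (g := patch0 h) (lexx 0) (lexx 1) q01 ch).
Unshelve. all: by end_near. Qed.

(* The points (c, x.2) and (y.1, c) of the broken line from x to y. *)
Lemma broken_line_bound h x y M : smoothOm h -> {within closedQ, continuous (patch0 h)} ->
  closedQ x -> closedQ y ->
  (forall z i, closedQ z -> halfplane z -> between x.1 y.1 z.1 -> between x.2 y.2 z.2 ->
     `|'D_(basis_vec i) h z| <= M) ->
  `|patch0 h y - patch0 h x| <= M * (`|y.1 - x.1| + `|y.2 - x.2|).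
Proof.
move=> sh ch cx cy hM.
move: x y cx cy hM => [x1 x2] [y1 y2].
rewrite {1 2}/closedQ /= !in_itv /= => -[x101 x201] [y101 y201] hM.
have bl a b : between a b a by rewrite /between lexx /=; case: leP => //= /ltW ->.
have br a b : between a b b by rewrite /between lexx /= andbT; case: leP => //= /ltW ->.
have h1 : `|patch0 h (y1, x2) - patch0 h (x1, x2)| <= M * `|y1 - x1|.
  have [->|xy] := eqVneq x1 y1; first by rewrite !subrr normr0 mulr0.
  have [c [c01 cb ->]] := row_increment sh ch x101 y101 x201 xy.
  rewrite normrM ler_wpM2r//; apply: hM => //.
    by rewrite /closedQ /= !in_itv /= x201; case/andP: c01 => ? ?; rewrite !ltW.
  by rewrite /halfplane /=; case/andP: c01 => ? ?; case/andP: x201 => ? ?; rewrite ltr_wpDr.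
have h2 : `|patch0 h (y1, y2) - patch0 h (y1, x2)| <= M * `|y2 - x2|.
  have [->|xy] := eqVneq x2 y2; first by rewrite !subrr normr0 mulr0.
  have [c [c01 cb ->]] := column_increment sh ch x201 y201 y101 xy.
  rewrite normrM ler_wpM2r//; apply: hM => //.
    by rewrite /closedQ /= !in_itv /= y101; case/andP: c01 => ? ?; rewrite !ltW.
  by rewrite /halfplane /=; case/andP: c01 => ? ?; case/andP: y101 => ? ?; rewrite ltr_wpDl.
have -> : patch0 h (y1, y2) - patch0 h (x1, x2) =
  (patch0 h (y1, y2) - patch0 h (y1, x2)) + (patch0 h (y1, x2) - patch0 h (x1, x2)) by ring.
by rewrite mulrDr addrC (le_trans (ler_normD _ _))// lerD.
Qed.

(** The mean value theorem is applied on the horizontal and then the vertical leg from x to y, and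
    each derivative is moved back to x by its Lipschitz bound. The intermediate points have a
    positive coordinate, so they avoid the corner. *)
Lemma first_order_remainder h x y M : smoothOm h -> {within closedQ, continuous (patch0 h)} ->
  (forall i, {within closedQ, continuous (patch0 ('D_(basis_vec i) h))}) ->
  closedQ x -> closedQ y ->
  (forall z i j, closedQ z -> halfplane z ->
     `|'D_(basis_vec i) ('D_(basis_vec j) h) z| <= M) ->
  `|patch0 h y - patch0 h x - (patch0 ('D_(basis_vec 0) h) x * (y.1 - x.1) +
      patch0 ('D_(basis_vec 1) h) x * (y.2 - x.2))| <=
   M * (`|y.1 - x.1| + `|y.2 - x.2|) ^+ 2.
Proof.
move=> sh ch chD cx cy hM.
have lip i z : closedQ z -> `|patch0 ('D_(basis_vec i) h) z - patch0 ('D_(basis_vec i) h) x| <=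
    M * (`|z.1 - x.1| + `|z.2 - x.2|).
  move=> cz; apply: broken_line_bound => //; first exact: smoothOm_D.
  by move=> u j cu Hu _ _; exact: hM.
have M0 : 0 <= M.
  have h11 : halfplane (1 : R, 1 : R) by rewrite /halfplane /= addr_gt0.
  have c11 : closedQ (1 : R, 1 : R) by rewrite /closedQ /= !in_itv /= lexx ler01.
  exact: le_trans (normr_ge0 _) (hM _ 0 0 c11 h11).
move: x y cx cy lip => [x1 x2] [y1 y2].
rewrite {1 2}/closedQ /= !in_itv /= => -[x101 x201] [y101 y201] lip.
have bd a b c : between a b c -> `|c - a| <= `|b - a|.
  rewrite /between => /orP[|] /andP[h1 h2].
    by rewrite !ger0_norm ?subr_ge0// ?lerD2r//; exact: le_trans h2.
  by rewrite !ler0_norm ?subr_le0// ?lerN2 ?lerD2r//; exact: le_trans h2.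
set D := `|y1 - x1| + `|y2 - x2|.
have h1 : `|patch0 h (y1, x2) - patch0 h (x1, x2) -
    patch0 ('D_(basis_vec 0) h) (x1, x2) * (y1 - x1)| <= M * D * `|y1 - x1|.
  have [->|xy] := eqVneq x1 y1; first by rewrite !subrr mulr0 subr0 normr0 mulr0.
  have [c [c01 cb ->]] := row_increment sh ch x101 y101 x201 xy.
  case/andP: (c01) => c0 c1.
  have cz : closedQ (c, x2) by rewrite /closedQ /= !in_itv /= x201 !ltW.
  have cn0 : (c, x2) != 0 :> R * R by apply/eqP => -[c00 _]; rewrite c00 ltxx in c0.
  have -> : 'D_(basis_vec 0) h (c, x2) = patch0 ('D_(basis_vec 0) h) (c, x2) by rewrite patch0E.
  rewrite -mulrBl normrM ler_wpM2r//.
  apply: le_trans (lip 0 _ cz) _; rewrite ler_wpM2l//= subrr normr0 addr0.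
  by rewrite /D (le_trans (bd _ _ _ cb))// lerDl.
have h2 : `|patch0 h (y1, y2) - patch0 h (y1, x2) -
    patch0 ('D_(basis_vec 1) h) (x1, x2) * (y2 - x2)| <= M * D * `|y2 - x2|.
  have [->|xy] := eqVneq x2 y2; first by rewrite !subrr mulr0 subr0 normr0 mulr0.
  have [c [c01 cb ->]] := column_increment sh ch x201 y201 y101 xy.
  case/andP: (c01) => c0 c1.
  have cz : closedQ (y1, c) by rewrite /closedQ /= !in_itv /= y101 !ltW.
  have cn0 : (y1, c) != 0 :> R * R by apply/eqP => -[_ c00]; rewrite c00 ltxx in c0.
  have -> : 'D_(basis_vec 1) h (y1, c) = patch0 ('D_(basis_vec 1) h) (y1, c) by rewrite patch0E.
  rewrite -mulrBl normrM ler_wpM2r//.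
  apply: le_trans (lip 1 _ cz) _; rewrite ler_wpM2l//= /D lerD2l.
  exact: bd.
rewrite /=; move: (patch0 h (y1, y2)) (patch0 h (y1, x2)) (patch0 h (x1, x2)) h1 h2 => A B E h1 h2.
move: h1 h2.
move: (patch0 ('D_(basis_vec 0) h) (x1, x2)) => p.
move: (patch0 ('D_(basis_vec 1) h) (x1, x2)) => p' h1 h2.
have -> : A - E - (p * (y1 - x1) + p' * (y2 - x2)) =
  (B - E - p * (y1 - x1)) + (A - B - p' * (y2 - x2)) by ring.
apply: le_trans (ler_normD _ _) _.
have -> : M * D ^+ 2 = M * D * `|y1 - x1| + M * D * `|y2 - x2| by rewrite /D; ring.
exact: lerD.
Qed.

Lemma powR_enorm_logr (alpha : R) x : halfplane x -> enorm x `^ alpha = expR (alpha * logr x).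
Proof. by move=> Hx; rewrite /powR gt_eqF ?enorm_gt0. Qed.

(** Let d be the distance and x the point farther from the corner. If |x| <= 2d the size bound on
    both values suffices; otherwise the broken line from y to x stays away from the corner and the
    gradient bound can be integrated. *)
Lemma patch0_holder g C (alpha : R) : smoothOm g -> {within closedQ, continuous (patch0 g)} ->
  0 < alpha < 1 -> 0 <= C ->
  (forall x, closedQ x -> halfplane x -> `|g x| <= C * expR (alpha * logr x)) ->
  (forall x i, closedQ x -> halfplane x ->
     `|'D_(basis_vec i) g x| <= C * expR ((alpha - 1) * logr x)) ->
  forall x y, closedQ x -> closedQ y ->
  `|patch0 g x - patch0 g y| <= 4 * C * enorm (x - y) `^ alpha.
Proof.
move=> sg cg /andP[a0 a1] C0 g0 gD x y cx cy.
wlog yx : x y cx cy / enorm y <= enorm x => [H|].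
  have [yx|/ltW xy] := leP (enorm y) (enorm x); first exact: H.
  by rewrite distrC -enormN opprB; exact: H.
have [->|xy] := eqVneq x y; first by rewrite subrr normr0 mulr_ge0 ?powR_ge0// mulr_ge0.
set d := enorm (x - y).
have d0 : 0 < d.
  rewrite lt_neqAle sqrtr_ge0 andbT eq_sym; apply: contra xy => /eqP/enorm_eq0 xy0.
  by rewrite -subr_eq0 xy0.
have xn0 : x != 0.
  apply: contra xy => /eqP x0; rewrite x0 enorm0 in yx; rewrite x0 eq_sym; apply/eqP.
  by apply: enorm_eq0; apply/eqP; rewrite eq_le yx sqrtr_ge0.
have Hx := closedQ_halfplane cx xn0; have r0 := enorm_gt0 Hx.
have p0 z : closedQ z -> enorm z <= enorm x -> `|patch0 g z| <= C * enorm x `^ alpha.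
  move=> cz zx; have [->|zn0] := eqVneq z 0.
    by rewrite /patch0 eqxx normr0 mulr_ge0// powR_ge0.
  have Hz := closedQ_halfplane cz zn0.
  rewrite patch0E//; apply: le_trans (g0 z cz Hz) _.
  rewrite -powR_enorm_logr// ler_wpM2l// ge0_ler_powR// ?nnegrE ?sqrtr_ge0//; exact: ltW.
have [rd|dr] := leP (enorm x) (2 * d).
  apply: le_trans (ler_normB _ _) _.
  have h : C * enorm x `^ alpha <= 2 * C * d `^ alpha.
    rewrite [2 * C]mulrC -mulrA ler_wpM2l//.
    apply: (@le_trans _ _ ((2 * d) `^ alpha)).
      rewrite ge0_ler_powR// ?nnegrE ?sqrtr_ge0// ?mulr_ge0//; exact: ltW.
    rewrite powRM//; last exact: ltW.
    rewrite ler_wpM2r ?powR_ge0//; apply: ler1_powR; rewrite ?ler1n//; exact: ltW.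
  have -> : 4 * C * d `^ alpha = 2 * C * d `^ alpha + 2 * C * d `^ alpha by ring.
  by apply: lerD; apply: le_trans h; apply: p0.
(* Points of the rectangle spanned by x and y lie within d of x, hence at distance at least d from
   the corner, where the gradient is at most C d^(alpha - 1). *)
have near_x z i : closedQ z -> halfplane z -> between y.1 x.1 z.1 -> between y.2 x.2 z.2 ->
    `|'D_(basis_vec i) g z| <= C * expR ((alpha - 1) * ln d).
  move=> cz Hz b1 b2; apply: le_trans (gD z i cz Hz) _.
  have bd a b c : between a b c -> `|b - c| <= `|b - a|.
    rewrite /between => /orP[|] /andP[h1 h2].
      rewrite !ger0_norm ?subr_ge0// ?lerD2l ?lerN2//; exact: le_trans h2.
    rewrite !ler0_norm ?subr_le0// ?lerN2 ?lerD2l ?lerN2//; exact: le_trans h2.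
  have xz : enorm (x - z) <= d by apply: le_enorm; exact: bd.
  have zd : d <= enorm z.
    have := enormD (x - z) z; rewrite subrK => h; lra.
  rewrite ler_wpM2l// ler_expR ler_wnM2l//; first by rewrite subr_le0 ltW.
  by rewrite ler_ln ?posrE// enorm_gt0.
apply: le_trans (broken_line_bound sg cg cy cx near_x) _.
have dd : `|x.1 - y.1| + `|x.2 - y.2| <= 2 * d.
  by have := fst_le_enorm (x - y); have := snd_le_enorm (x - y); rewrite -/d /=; lra.
have E : expR ((alpha - 1) * ln d) * d = d `^ alpha.
  have -> : (alpha - 1) * ln d = alpha * ln d - ln d by ring.
  by rewrite expRB lnK ?posrE// /powR gt_eqF// divfK// gt_eqF.
apply: (@le_trans _ _ (C * expR ((alpha - 1) * ln d) * (2 * d))).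
  by rewrite ler_wpM2l// mulr_ge0// expR_ge0.
have -> : C * expR ((alpha - 1) * ln d) * (2 * d) = 2 * C * d `^ alpha by rewrite -E; ring.
rewrite ler_wpM2r ?powR_ge0// ler_wpM2r// ler_nat//.
Qed.

End MeanValue.

(** * Push-forward of a density as a measure *)

Section DensityPushforward.
Context d1 d2 (X : measurableType d1) (Y : measurableType d2) (R : realType)
  (mu : {measure set X -> \bar R}) (D : set X) (mD : measurable D)
  (F : X -> R) (mF : measurable_fun D F) (F0 : forall x, D x -> 0 <= F x)
  (S : X -> Y) (mS : measurable_fun D S).
Local Open Scope ereal_scope.

Definition density_pushforward (B : set Y) : \bar R :=
  \int[mu]_(x in D `&` S @^-1` B) (F x)%:E.

Let pushforward0 : density_pushforward set0 = 0.
Proof. by rewrite /density_pushforward preimage_set0 setI0 integral_set0. Qed.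

Let pushforward_ge0 B : 0 <= density_pushforward B.
Proof. by apply: integral_ge0 => x [Dx _]; rewrite lee_fin F0. Qed.

Let pushforward_sigma_additive : semi_sigma_additive density_pushforward.
Proof.
move=> /= A mA tA mUA; rewrite /density_pushforward preimage_bigcup setI_bigcupr.
rewrite ge0_integral_bigcup//=.
- by apply: is_cvg_ereal_nneg_natsum_cond => // n _ _; exact: pushforward_ge0.
- by move=> n; exact: mS.
- by apply/measurable_EFinP; apply: measurable_funS mF => // x [n _ []].
- by move=> x [n _ [Dx _]]; rewrite lee_fin F0.
- move=> i j _ _ [x [[_ Ai] [_ Aj]]]; apply: tA => //; by exists (S x).
Qed.

HB.instance Definition _ := isMeasure.Build _ _ _ density_pushforward
  pushforward0 pushforward_ge0 pushforward_sigma_additive.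

Definition density_pushforward_measure : {measure set Y -> \bar R} := density_pushforward.

Import HBNNSimple.

(** For indicators this is the definition of the push-forward; linearity and monotone convergence
    along [nnsfun_approx] do the rest. *)
Lemma integral_density_pushforward (psi : Y -> \bar R) :
  measurable_fun setT psi -> (forall y, 0 <= psi y) ->
  \int[density_pushforward]_y psi y = \int[mu]_(x in D) (psi (S x) * (F x)%:E).
Proof.
move=> mpsi psi0; pose h := nnsfun_approx measurableT mpsi.
have cvgh y : (EFin \o h n) y @[n --> \oo] --> psi y.
  by apply: cvg_nnsfun_approx.
have mFe : measurable_fun D (fun x => (F x)%:E) by exact/measurable_EFinP.
have mhS n : measurable_fun D (fun x => (h n (S x))%:E).
  by apply/measurable_EFinP; apply: measurableT_comp.
transitivity (limn (fun n => \int[density_pushforward]_y (h n y)%:E)).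
  rewrite -monotone_convergence//.
  - by apply: eq_integral => y _; apply/esym/cvg_lim => //; exact: cvgh.
  - by move=> n; exact/measurable_EFinP/measurable_funP.
  - by move=> n y _; rewrite lee_fin.
  - by move=> y _ m n mn; rewrite lee_fin; exact/lefP/nd_nnsfun_approx.
rewrite [X in limn X](_ : _ =
    (fun n => \int[mu]_(x in D) ((h n (S x))%:E * (F x)%:E))).
  rewrite -monotone_convergence//.
  - apply: eq_integral => x /[!inE] Dx; apply/cvg_lim => //.
    by apply: cvgeZr => //; exact: cvgh.
  - by move=> n; exact: emeasurable_funM.
  - by move=> n x Dx; rewrite mule_ge0 ?lee_fin ?F0.
  - move=> x Dx m n mn; rewrite lee_wpmul2r ?lee_fin ?F0//.
    exact/lefP/nd_nnsfun_approx.
apply/funext => n.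
have mI r : measurable_fun setT (fun y => (r * \1_(h n @^-1` [set r]) y)%:E).
  by apply/measurable_EFinP/measurable_funM.
transitivity (\sum_(k \in range (h n)) \int[density_pushforward]_y
    (k * \1_(h n @^-1` [set k]) y)%:E).
  rewrite -ge0_integral_fsum//.
    by apply: eq_integral => y _; rewrite fimfunE -fsumEFin.
  by move=> r y _; rewrite nnfun_muleindic_ge0.
transitivity (\int[mu]_(x in D) (\sum_(k \in range (h n))
    (k * \1_(h n @^-1` [set k]) (S x))%:E * (F x)%:E)); last first.
  apply: eq_integral => x /[!inE] Dx.
  rewrite -ge0_mule_fsuml => [|y]; last exact: nnfun_muleindic_ge0.
  by rewrite fsumEFin// -(fimfunE _ (S x)).
rewrite ge0_integral_fsum//; last 2 first.
- move=> r; apply: emeasurable_funM => //; exact: (measurableT_comp (mI r)).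
- by move=> r x Dx; rewrite mule_ge0 ?lee_fin ?F0// -lee_fin nnfun_muleindic_ge0.
apply: eq_fsbigr => r _; rewrite integralZl_indic_nnsfun// integral_indic//= setIT.
have mr : measurable (D `&` S @^-1` (h n @^-1` [set r])) by exact: mS.
have [r0|r0] := ltP r 0%R.
  rewrite preimage_nnfun0// measure0 mule0.
  rewrite integral0_eq// => x Dx; rewrite indicE.
  by rewrite memNset ?mulr0 ?mul0e// => hr; have : (0 <= h n (S x))%R by []; rewrite hr leNgt r0.
rewrite /density_pushforward -ge0_integralZl//; last 2 first.
- by apply: measurable_funS mFe => // x [].
- by move=> x [Dx _]; rewrite lee_fin F0.
rewrite integral_mkcondr; apply: eq_integral => x /[!inE] Dx.
rewrite /patch indicE; have [hx|hx] := boolP (h n (S x) == r).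
  by rewrite !mem_set ?mulr1//; exact/eqP.
by rewrite !memNset ?mulr0 ?mul0e//; apply/eqP.
Qed.

End DensityPushforward.

Lemma eq_integral_density_pushforward d1 d2 (X : measurableType d1) (Y : measurableType d2)
    (R : realType) (mu : {measure set X -> \bar R}) (D : set X) (F G : X -> R) (S T : X -> Y)
    (psi : Y -> \bar R) : measurable D ->
  measurable_fun D F -> (forall x, D x -> 0 <= F x) -> measurable_fun D S ->
  measurable_fun D G -> (forall x, D x -> 0 <= G x) -> measurable_fun D T ->
  (forall B, measurable B ->
     density_pushforward mu D F S B = density_pushforward mu D G T B) ->
  measurable_fun setT psi -> (forall y, 0 <= psi y)%E ->
  (\int[mu]_(x in D) (psi (S x) * (F x)%:E) = \int[mu]_(x in D) (psi (T x) * (G x)%:E))%E.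
Proof.
move=> mD mF F0 mS mG G0 mT FG mpsi psi0.
rewrite -(integral_density_pushforward mu mD mF F0 mS mpsi psi0).
rewrite -(integral_density_pushforward mu mD mG G0 mT mpsi psi0).
by apply: eq_measure_integral => A mA _; exact: FG.
Qed.

(** * Borel sets of the plane *)

Section PlaneMeasurability.
Context {R : realType}.

(** Links the product topology to the product sigma-algebra: [U] is the union of the rational boxes
    contained in it, of which there are countably many. *)
Lemma open_plane_measurable (U : set (R * R)) : open U -> measurable (U : set (plane R)).
Proof.
move=> oU.
pose box (i : (rat * rat) * (rat * rat)) : set (plane R) :=
  `]ratr i.1.1, ratr i.1.2[%classic `*` `]ratr i.2.1, ratr i.2.2[%classic.
have -> : U = \bigcup_i [set x | (box i `<=` U) /\ box i x].
  apply/seteqP; split=> [x Ux|x [i _ [+ ?]]]; last exact.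
  have : nbhs x U by apply: open_nbhs_nbhs.
  case=> -[A B] /= [nA nB] AB.
  have rat_itv (c : R) (V : set R) : nbhs c V ->
      exists p : rat * rat, ratr p.1 < c < ratr p.2 /\ (`]ratr p.1, ratr p.2[%classic `<=` V).
    rewrite -nbhs_ballE => -[e /= e0 eV].
    have [p1] := @rat_in_itvoo R (c - e) c ltac:(by rewrite ltrBlDr ltrDl).
    have [p2] := @rat_in_itvoo R c (c + e) ltac:(by rewrite ltrDl).
    rewrite !in_itv /= => /andP[p21 p22] /andP[p11 p12].
    exists (p1, p2); rewrite /= p12 p21; split=> // y.
    rewrite /= in_itv /= => /andP[y1 y2]; apply: eV; rewrite /ball /= ltr_distlC.
    by rewrite (lt_trans p11 y1) (lt_trans y2 p22).
  have [p [px pA]] := rat_itv _ _ nA; have [q [qx qB]] := rat_itv _ _ nB.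
  exists (p, q) => //; split; last by split; rewrite /= in_itv.
  by move=> y [y1 y2]; apply: AB; split; [exact: pA|exact: qB].
apply: countable_bigcupT_measurable => [|i]; first exact: countableP.
have [iU|niU] := pselect (box i `<=` U).
  rewrite (_ : [set x | _] = box i); first exact: measurableX.
  by apply/seteqP; split=> [x []|x].
rewrite (_ : [set x | _] = set0); first exact: measurable0.
by apply/seteqP; split=> [x []|x].
Qed.

Lemma measurable_openQ : measurable (openQ : set (plane R)).
Proof. exact: measurableX. Qed.

Lemma continuous_plane_measurable (D : set (R * R)) (h : R * R -> R) : open D ->
  (forall x, D x -> {for x, continuous h}) ->
  measurable_fun (D : set (plane R)) (h : plane R -> measurableTypeR R).
Proof.
move=> oD ch; apply: (measurability _ (RGenOInfty.measurableE R)).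
move=> _ [_ [c ->] <-]; apply: open_plane_measurable.
rewrite openE => x [Dx hx].
have h1 : \forall y \near x, D y by apply: open_nbhs_nbhs; split.
have h2 : \forall y \near x, c < h y.
  have hx' : c < h x by move: hx; rewrite /= in_itv /= andbT.
  exact: (ch x Dx _ (lt_nbhsr hx')).
by apply: filterS2 h1 h2 => y Dy cy; split=> //=; rewrite in_itv /= cy.
Qed.

(** These quadrants form a generating pi-system, and their indicators are limits of products a(x_1)
    b(x_2), the test functions for which the boundary flux is computable. *)
Definition ray2 (c : R * R) : set (plane R) := `]-oo, c.1[ `*` `]-oo, c.2[.

Lemma measurable_ray2 c : measurable (ray2 c).
Proof. exact: measurableX. Qed.

Lemma plane_measurableE : @measurable _ (plane R) = <<s range ray2 >>.
Proof.
apply/seteqP; split; last first.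
  apply: smallest_sub; first exact: sigma_algebra_measurable.
  by move=> _ [c _ <-]; exact: measurable_ray2.
pose GT := g_sigma_algebraType (range ray2).
have mf : measurable_fun [set: GT] (fst : GT -> measurableTypeR R).
  apply: (measurability _ (RGenInftyO.measurableE R)) => _ [_ [c ->] <-].
  rewrite setTI (_ : _ @^-1` _ = \bigcup_n ray2 (c, n%:R)).
    by apply: bigcupT_measurable => n; apply: sub_sigma_algebra; exists (c, n%:R).
  apply/seteqP; split=> [x /= xc|x [n _ []]]; last by rewrite /= !in_itv.
  exists (Num.truncn x.2).+1 => //; split => //=; rewrite in_itv /=; exact: truncnS_gt.
have ms : measurable_fun [set: GT] (snd : GT -> measurableTypeR R).
  apply: (measurability _ (RGenInftyO.measurableE R)) => _ [_ [c ->] <-].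
  rewrite setTI (_ : _ @^-1` _ = \bigcup_n ray2 (n%:R, c)).
    by apply: bigcupT_measurable => n; apply: sub_sigma_algebra; exists (n%:R, c).
  apply/seteqP; split=> [x /= xc|x [n _ []]]; last by rewrite /= !in_itv.
  exists (Num.truncn x.1).+1 => //; split => //=; rewrite in_itv /=; exact: truncnS_gt.
apply: smallest_sub; first exact: smallest_sigma_algebra.
by rewrite subUset; split=> _ [A mA <-]; [exact: mf|exact: ms].
Qed.

Lemma plane_measure_unique (m1 m2 : {measure set (plane R) -> \bar R}) :
  (forall c, m1 (ray2 c) = m2 (ray2 c)) -> (forall c, m1 (ray2 c) < +oo)%E ->
  forall B, measurable B -> m1 B = m2 B.
Proof.
move=> m12 m1oo; apply: (measure_unique (range ray2) (fun n => ray2 (n%:R, n%:R))).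
- exact: plane_measurableE.
- move=> _ _ [a _ <-] [b _ <-]; exists (Num.min a.1 b.1, Num.min a.2 b.2) => //.
  apply/seteqP; split=> x; rewrite /ray2 /= !in_itv /= !lt_min.
    by move=> [/andP[-> ->] /andP[-> ->]].
  by move=> [[-> ->] [-> ->]].
- by move=> n; exists (n%:R, n%:R).
- apply/seteqP; split=> // x _.
  exists (Num.truncn (Num.max x.1 x.2)).+1 => //; have := truncnS_gt (Num.max x.1 x.2).
  by rewrite gt_max /ray2 /= !in_itv /= => /andP[].
- by move=> _ [c _ <-]; exact: m12.
- by move=> n; exact: m1oo.
Qed.

End PlaneMeasurability.

(** * Legendre duality on the square *)

Section Duality.
Context {R : realType}.
Implicit Types (x y X Y : R * R) (f u : R * R -> R) (S T : R * R -> R * R).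

Definition dot x y : R := x.1 * y.1 + x.2 * y.2.

(** The Legendre conjugate of [u] restricted to the closed square. For bounded [u] it is finite and
    Lipschitz on the whole plane, so its composition with any transport map is measurable. *)
Definition conj_potential u X : R := sup [set dot y X - u y | y in closedQ].

Lemma closedQ_abs y : closedQ y -> `|y.1| <= 1 /\ `|y.2| <= 1.
Proof.
rewrite /closedQ /= !in_itv /= => -[/andP[a0 a1] /andP[b0 b1]].
by rewrite !ger0_norm.
Qed.

Lemma dot_le y X : closedQ y -> dot y X <= `|X.1| + `|X.2|.
Proof.
move=> /closedQ_abs[y1 y2]; rewrite /dot (le_trans (ler_norm _))// (le_trans (ler_normD _ _))//.
by rewrite !normrM lerD// ler_piMl.
Qed.

Section ConjPotential.
Context (u : R * R -> R) (M : R) (uM : forall y, closedQ y -> `|u y| <= M).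

Let closedQ0 : closedQ (0 : R * R).
Proof. by rewrite /closedQ /= !in_itv /= lexx ler01. Qed.

Lemma le_conj_potential X y : closedQ y -> dot y X - u y <= conj_potential u X.
Proof.
move=> cy; apply: ub_le_sup; last by exists y.
exists (`|X.1| + `|X.2| + M) => _ [z cz <-].
rewrite lerD ?dot_le//; have := uM cz; rewrite ler_norml; lra.
Qed.

Lemma conj_potential_le X b : (forall y, closedQ y -> dot y X - u y <= b) ->
  conj_potential u X <= b.
Proof.
move=> h; apply: ge_sup; last by move=> _ [y cy <-]; exact: h.
by exists (dot 0 X - u 0); exists 0.
Qed.

Lemma conj_potential_lipschitz X Y :
  `|conj_potential u X - conj_potential u Y| <= `|X.1 - Y.1| + `|X.2 - Y.2|.
Proof.
have H A B : conj_potential u A <= conj_potential u B + (`|A.1 - B.1| + `|A.2 - B.2|).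
  apply: conj_potential_le => y cy.
  have := le_conj_potential B cy; have := dot_le (A - B) cy.
  rewrite /dot /=; lra.
have := H X Y; have := H Y X; rewrite (distrC Y.1) (distrC Y.2) ler_norml; lra.
Qed.

Lemma conj_potential_continuous : continuous (conj_potential u).
Proof.
move=> X; apply/cvgrPdist_lt => e e0.
have e2 : 0 < e / 2 by rewrite divr_gt0.
have h1 : \forall Y \near X, `|X.1 - Y.1| < e / 2.
  have /cvgrPdist_lt h : {for X, continuous (fst : R * R -> R)} by exact: cvg_fst.
  exact: h.
have h2 : \forall Y \near X, `|X.2 - Y.2| < e / 2.
  have /cvgrPdist_lt h : {for X, continuous (snd : R * R -> R)} by exact: cvg_snd.
  exact: h.
apply: filterS2 h1 h2 => Y Y1 Y2.
by apply: (le_lt_trans (conj_potential_lipschitz X Y)); rewrite [e]splitr ltrD.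
Qed.

Lemma conj_potential_bound X : closedQ X -> `|conj_potential u X| <= 2 + M.
Proof.
move=> cX; have [X1 X2] := closedQ_abs cX; rewrite ler_norml; apply/andP; split.
  have := le_conj_potential X closedQ0; have := uM closedQ0; rewrite ler_norml /dot /=; lra.
apply: conj_potential_le => y cy; have := dot_le X cy; have := uM cy; rewrite ler_norml; lra.
Qed.

Context (T : R * R -> R * R)
  (uT : forall x y, closedQ x -> closedQ y -> dot (T x) (y - x) <= u y - u x).

Lemma conj_potentialE x : closedQ x -> conj_potential u (T x) = dot x (T x) - u x.
Proof.
move=> cx; apply/eqP; rewrite eq_le le_conj_potential// andbT.
by apply: conj_potential_le => y cy; have := uT cx cy; rewrite /dot /=; lra.
Qed.

Context (K : R) (K0 : 0 < K) (uK : forall x y, closedQ x -> closedQ y ->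
   u y - u x <= dot (T x) (y - x) + K * ((y - x).1 ^+ 2 + (y - x).2 ^+ 2)).

(** Equality in Fenchel-Young makes X a subgradient of [u] at x. Testing it at x + s p with p = X -
    T x against the quadratic upper bound gives s |p|^2 <= K s^2 |p|^2, and s K < 1 leaves only p =
    0. *)
Lemma conj_potential_eq x X : openQ x -> conj_potential u X = dot x X - u x -> X = T x.
Proof.
move=> Qx E; set p := X - T x.
have cx := openQ_closedQ Qx.
have [s [s0 sK cs]] : exists s, [/\ 0 < s, s * K < 1 & closedQ (x + s *: p)].
  have h1 : \forall s \near (0:R)^'+, 0 < s by exact: nbhs_right_gt.
  have h2 : \forall s \near (0:R)^'+, s < K^-1 by apply: nbhs_right_lt; rewrite invr_gt0.
  have h3 : \forall s \near (0:R)^'+, openQ (x + s *: p).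
    have hc : (fun s : R => x + s *: p) @ (0 : R) --> x + (0 : R) *: p.
      apply: (@continuousD _ _ _ (fun=> x) (fun s : R => s *: p)); first exact: cvg_cst.
      exact: scalel_continuous.
    have Q0 : openQ (x + (0 : R) *: p) by rewrite scale0r addr0.
    have h0 : \forall s \near (0:R), openQ (x + s *: p) := hc _ (near_openQ Q0).
    by near=> s; near: s; apply: cvg_within h0.
  have [s [hs1 hs2 hs3]] := @filter_ex _ ((0:R)^'+) (at_right_proper_filter 0) _
     (filterS3 _ (fun s a b c => And3 a b c) h1 h2 h3).
  exists s; split=> //; last exact: openQ_closedQ.
  by rewrite -ltr_pdivlMr// div1r.
have h := le_conj_potential X cs; rewrite E in h.
have h' := uK cx cs.
have q1 : (s *: p).1 = s * p.1 by [].
have q2 : (s *: p).2 = s * p.2 by [].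
have p2 : p.1 ^+ 2 + p.2 ^+ 2 <= s * K * (p.1 ^+ 2 + p.2 ^+ 2).
  rewrite -(@ler_pM2l _ s)//.
  have -> : s * (p.1 ^+ 2 + p.2 ^+ 2) = dot (s *: p) X - dot (T x) (s *: p).
    by rewrite /dot q1 q2 /p /=; ring.
  have -> : s * (s * K * (p.1 ^+ 2 + p.2 ^+ 2)) = K * ((s *: p).1 ^+ 2 + (s *: p).2 ^+ 2).
    by rewrite q1 q2; ring.
  move: h h'; rewrite (addrC x) addrK; move: (s *: p) => q.
  rewrite /dot /=; lra.
have p20 : p.1 ^+ 2 + p.2 ^+ 2 <= 0.
  have : (1 - s * K) * (p.1 ^+ 2 + p.2 ^+ 2) <= 0 by rewrite mulrBl mul1r subr_le0.
  by rewrite pmulr_rle0// subr_gt0.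
have : p.1 ^+ 2 + p.2 ^+ 2 == 0 by rewrite eq_le p20 addr_ge0 ?sqr_ge0.
rewrite paddr_eq0 ?sqr_ge0// !sqrf_eq0 => /andP[/eqP p1 /eqP p2'].
by apply/eqP; rewrite -subr_eq0 -/p [p]surjective_pairing p1 p2'.
Unshelve. all: by end_near. Qed.

End ConjPotential.
End Duality.

(** * Optimality and uniqueness from the duality gap *)

Section Optimality.
Context {R : realType}.
Implicit Types (x y X Y : R * R) (S T : R * R -> R * R).

Lemma leb2_openQ : leb2 R openQ = 1%E.
Proof.
rewrite /openQ product_measure1E; [|exact: measurable_itv|exact: measurable_itv].
have h : @lebesgue_measure R `]0, 1[%classic = 1%E.
  by rewrite lebesgue_measure_itv /= lte_fin ltr01 sube0.
have E (a : \bar R) : a = 1%E -> (a * a = 1)%E by move=> ->; rewrite mule1.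
exact: E h.
Qed.

Context (f : R * R -> R) (mf : measurable_fun (openQ : set (plane R)) (f : plane R -> R))
  (f0 : forall x, openQ x -> 0 < f x).

Local Open Scope ereal_scope.

Lemma transports_integral S (psi : plane R -> \bar R) : transports f (fun=> 1%R) S ->
  measurable_fun setT psi -> (forall y, 0 <= psi y) ->
  \int[leb2 R]_(x in openQ) (psi (S x) * (f x)%:E) = \int[leb2 R]_(x in openQ) psi x.
Proof.
move=> [mS tS] mpsi psi0.
have f0' x : openQ x -> (0 <= f x)%R by move=> /f0/ltW.
have m1 : measurable_fun (openQ : set (plane R)) (fun _ : plane R => 1%R : R).
  exact: measurable_cst.
have p1 (x : plane R) : openQ x -> (0 <= (fun _ : plane R => 1%R : R) x)%R by [].
have mi : measurable_fun (openQ : set (plane R)) (@idfun (plane R)) by exact: measurable_id.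
have mQ := @measurable_openQ R.
rewrite (eq_integral_density_pushforward mQ mf f0' mS m1 p1 mi tS mpsi psi0).
by apply: eq_integral => x _; rewrite mule1.
Qed.

(** The indicator of the complement of the square has integral 0 against the target, and [f] is
    positive. *)
Lemma transports_openQ S : transports f (fun=> 1%R) S ->
  {ae leb2 R, forall x, openQ x -> openQ (S x)}.
Proof.
move=> tS; have mS := tS.1.
pose psi (x : plane R) : \bar R := (\1_(~` openQ) x)%:E.
have mpsi : measurable_fun setT psi.
  apply/measurable_EFinP; apply: measurable_indic.
  by apply: measurableC; exact: measurable_openQ.
have psi0 x : 0 <= psi x by rewrite lee_fin.
have mFe : measurable_fun (openQ : set (plane R)) (fun x => psi (S x) * (f x)%:E).
  apply: emeasurable_funM; first exact: (measurableT_comp mpsi mS).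
  exact/measurable_EFinP.
have /(ae_eq_integral_abs (leb2 R) measurable_openQ mFe) h :
    \int[leb2 R]_(x in openQ) `|psi (S x) * (f x)%:E| = 0.
  transitivity (\int[leb2 R]_(x in openQ) (psi (S x) * (f x)%:E)).
    apply: eq_integral => x /[!inE] Qx; rewrite gee0_abs// mule_ge0// lee_fin ltW//.
    exact: f0.
  rewrite transports_integral// integral0_eq// => x Qx.
  by rewrite /psi indicE memNset//= => /(_ Qx).
apply: filterS h => x h Qx; have := h Qx; rewrite /psi indicE.
case: (boolP (S x \in ~` openQ)) => [_|]; last by rewrite notin_setE /= => /contrapT.
by rewrite mul1e => -[fx0]; have := f0 Qx; rewrite fx0 ltxx.
Qed.

Local Open Scope ring_scope.

Context (u : R * R -> R) (T : R * R -> R * R) (M K : R)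
  (mu : measurable_fun (openQ : set (plane R)) (u : plane R -> R))
  (uM : forall y, closedQ y -> `|u y| <= M)
  (uT : forall x y, closedQ x -> closedQ y -> dot (T x) (y - x) <= u y - u x)
  (K0 : 0 < K) (uK : forall x y, closedQ x -> closedQ y ->
   u y - u x <= dot (T x) (y - x) + K * ((y - x).1 ^+ 2 + (y - x).2 ^+ 2))
  (tT : transports f (fun=> 1) T).

(** Bounds [W] and [V] on the square, as |X|^2 <= 2 there and the conjugate is at most 2 + M in
    absolute value. Adding [B] makes the integrands nonnegative, so that integrals can be split
    without integrability conditions. *)
Let B := 6 + 2 * M.
Let W x := x.1 ^+ 2 + x.2 ^+ 2 - 2 * u x.
Let V X := X.1 ^+ 2 + X.2 ^+ 2 - 2 * conj_potential u X.
(** Twice the deficit in the Fenchel-Young inequality at (x, S x). *)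
Let gap S x := enorm (x - S x) ^+ 2 - W x - V (S x).

Let gapE S x : gap S x = 2 * (u x + conj_potential u (S x) - dot x (S x)).
Proof. by rewrite /gap sqr_enorm /W /V /dot /=; ring. Qed.

Let gap_ge0 S x : closedQ x -> 0 <= gap S x.
Proof. by move=> cx; rewrite gapE; have := le_conj_potential uM (S x) cx; lra. Qed.

Let gap_T x : closedQ x -> gap T x = 0.
Proof. by move=> cx; rewrite gapE (conj_potentialE uM uT cx); ring. Qed.

Let gap_eq0 S x : openQ x -> gap S x = 0 -> S x = T x.
Proof.
move=> Qx; rewrite gapE => h; apply: (conj_potential_eq uM K0 uK Qx).
by move: h; lra.
Qed.

Let sq_bound x : closedQ x -> 0 <= x.1 ^+ 2 + x.2 ^+ 2 <= 2.
Proof.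
move=> cx; have [x1 x2] := closedQ_abs cx.
rewrite addr_ge0 ?sqr_ge0//= -[2]/(1 + 1) lerD// -real_normK ?num_real//; exact: exprn_ile1.
Qed.

Let W_bound x : closedQ x -> - B <= W x <= B.
Proof. move=> cx; have := sq_bound cx; have := uM cx; rewrite /W /B ler_norml; lra. Qed.

Let V_bound x : closedQ x -> - B <= V x <= B.
Proof.
by move=> cx; have := sq_bound cx; have := conj_potential_bound uM cx; rewrite /V /B ler_norml; lra.
Qed.

Let mfst : measurable_fun [set: plane R] (fun x => x.1 : R).
Proof. exact: measurable_fst. Qed.

Let msnd : measurable_fun [set: plane R] (fun x => x.2 : R).
Proof. exact: measurable_snd. Qed.

Let msq : measurable_fun [set: plane R] (fun x => x.1 ^+ 2 + x.2 ^+ 2 : R).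
Proof. by apply: measurable_funD; apply: measurable_funX. Qed.

Let mV : measurable_fun [set: plane R] V.
Proof.
apply: measurable_funB; first exact: msq.
apply: measurable_funM; first exact: measurable_cst.
apply: (@continuous_plane_measurable _ setT); first exact: openT.
by move=> X _; exact: (conj_potential_continuous uM).
Qed.

Let mW : measurable_fun (openQ : set (plane R)) W.
Proof.
apply: measurable_funB; first exact: measurable_funTS msq.
by apply: measurable_funM; first exact: measurable_cst.
Qed.

Let mcost S : transports f (fun=> 1) S ->
  measurable_fun (openQ : set (plane R)) (fun x : plane R => enorm (x - S x) ^+ 2).
Proof.
move=> [mS _].
have -> : (fun x : plane R => enorm (x - S x) ^+ 2) =
    (fun x : plane R => (x.1 - (S x).1) ^+ 2 + (x.2 - (S x).2) ^+ 2).
  by apply/funext => x; rewrite sqr_enorm.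
have m1 := measurableT_comp mfst mS; have m2 := measurableT_comp msnd mS.
apply: measurable_funD; apply: measurable_funX; apply: measurable_funB => //;
  exact: measurable_funTS.
Qed.

Let mgap S : transports f (fun=> 1) S ->
  measurable_fun (openQ : set (plane R)) (gap S : plane R -> R).
Proof.
move=> tS; apply: measurable_funB; last exact: (measurableT_comp mV tS.1).
by apply: measurable_funB; [exact: mcost|exact: mW].
Qed.

Local Open Scope ereal_scope.

Let B0 : (0 <= B)%R.
Proof.
have c0 : closedQ (0%R : R * R) by rewrite /closedQ /= !in_itv /= lexx ler01.
by have := uM c0; rewrite ler_norml /B; lra.
Qed.

Let const_mass : \int[leb2 R]_(x in openQ) ((2 * B)%:E * (f x)%:E) = (2 * B)%:E.
Proof.
rewrite (@transports_integral T (fun=> (2 * B)%:E)) //.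
  rewrite integral_cst; last exact: measurable_openQ.
  by rewrite [X in _ * X]leb2_openQ mule1.
by move=> _; rewrite lee_fin mulr_ge0.
Qed.

Let alpha := \int[leb2 R]_(x in openQ) ((W x + B)%:E * (f x)%:E).
(** An integral against the target density 1, hence the same for all transport maps. The indicator
    is there because [V + B] is known to be nonnegative only on the square. *)
Let beta := \int[leb2 R]_(x in openQ) (((V x + B) * \1_openQ x)%:E).

Let mfe : measurable_fun (openQ : set (plane R)) (fun x => (f x)%:E).
Proof. exact/measurable_EFinP. Qed.

Let f0e x : openQ x -> 0 <= (f x)%:E.
Proof. by move=> /f0/ltW; rewrite lee_fin. Qed.

Let mb : measurable_fun setT (fun x : plane R => ((V x + B) * \1_openQ x)%:E).
Proof.
apply/measurable_EFinP; apply: measurable_funM; last first.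
  by apply: measurable_indic; exact: measurable_openQ.
by apply: measurable_funD; [exact: mV|exact: measurable_cst].
Qed.

Let b_bound (x : plane R) : 0 <= ((V x + B) * \1_openQ x)%:E <= (2 * B)%:E.
Proof.
rewrite !lee_fin indicE; case: (boolP (x \in openQ)) => [/set_mem/openQ_closedQ/V_bound|_].
  by rewrite mulr1; lra.
by rewrite mulr0 lexx mulr_ge0.
Qed.

Let mWB : measurable_fun (openQ : set (plane R)) (fun x => (W x + B)%:E).
Proof. by apply/measurable_EFinP; apply: measurable_funD; [exact: mW|exact: measurable_cst]. Qed.

Let WB_bound x : openQ x -> 0 <= (W x + B)%:E <= (2 * B)%:E.
Proof. by move=> /openQ_closedQ/W_bound; rewrite !lee_fin; lra. Qed.

(** The squared distance is W(x) + V(S x) plus the gap. Integrated against [f], the second part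
    becomes [beta] by the push-forward property, so the cost depends on [S] only through the gap.
    The constant 2B accounts for the two shifts by [B], the mass of [f] being 1. *)
Let cost_split S : transports f (fun=> 1%R) S ->
  transport_cost f S + (2 * B)%:E =
  \int[leb2 R]_(x in openQ) ((gap S x)%:E * (f x)%:E) + (alpha + beta).
Proof.
move=> tS; have mQ := @measurable_openQ R.
have b0 x : 0 <= ((V x + B) * \1_openQ x)%:E by case/andP: (b_bound x).
have WB0 x : openQ x -> 0 <= (W x + B)%:E by move=> /WB_bound/andP[].
rewrite -const_mass /beta -(transports_integral tS mb b0) /transport_cost /alpha.
have mbS := measurableT_comp mb tS.1.
have mg : measurable_fun (openQ : set (plane R)) (fun x => (gap S x)%:E).
  by apply/measurable_EFinP; exact: mgap.
have g0 x : openQ x -> 0 <= (gap S x)%:E.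
  by move=> /openQ_closedQ/(gap_ge0 S); rewrite lee_fin.
have mc : measurable_fun (openQ : set (plane R)) (fun x => (enorm (x - S x) ^+ 2)%:E).
  by apply/measurable_EFinP; exact: mcost.
have c0 x : openQ x -> 0 <= (enorm (x - S x) ^+ 2)%:E by move=> _; rewrite lee_fin sqr_ge0.
have mcst : measurable_fun (openQ : set (plane R)) (fun=> (2 * B)%:E) by exact: measurable_cst.
have cst0 : 0 <= (2 * B)%:E by rewrite lee_fin mulr_ge0.
under [X in X + _ = _]eq_integral do rewrite EFinM.
rewrite -ge0_integralD//; [|by move=> x Qx; rewrite mule_ge0 ?c0 ?f0e|exact: emeasurable_funM
  |by move=> x Qx; rewrite mule_ge0 ?f0e|exact: emeasurable_funM].
rewrite -ge0_integralD//; [|by move=> x Qx; rewrite mule_ge0 ?WB0 ?f0e|exact: emeasurable_funM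
  |by move=> x Qx; rewrite mule_ge0 ?b0 ?f0e|exact: emeasurable_funM].
rewrite -ge0_integralD//; [|by move=> x Qx; rewrite mule_ge0 ?g0 ?f0e|exact: emeasurable_funM
  |by move=> x Qx; rewrite adde_ge0// mule_ge0 ?WB0 ?b0 ?f0e
  |by apply: emeasurable_funD; exact: emeasurable_funM].
apply: ge0_ae_eq_integral => //.
- by apply: emeasurable_funD; exact: emeasurable_funM.
- apply: emeasurable_funD; first exact: emeasurable_funM.
  by apply: emeasurable_funD; exact: emeasurable_funM.
- by move=> x Qx; rewrite adde_ge0// mule_ge0 ?c0 ?f0e.
- by move=> x Qx; rewrite !adde_ge0// mule_ge0 ?g0 ?WB0 ?b0 ?f0e.
apply: (@filterS _ _ (ae_filter_ringOfSetsType (leb2 R)) _ _ _ (transports_openQ tS)) => x h Qx; have QS := h Qx.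
rewrite -!EFinM -!EFinD; congr _%:E; rewrite indicE mem_set// /gap.
by move: (enorm _ ^+ 2)%R (W x) (V (S x)) => a b c; rewrite mulr1; ring.
Qed.

Let gap_T0 : \int[leb2 R]_(x in openQ) ((gap T x)%:E * (f x)%:E) = 0.
Proof. by apply: integral0_eq => x /openQ_closedQ/gap_T ->; rewrite mul0e. Qed.

Let gap_int_ge0 S : 0 <= \int[leb2 R]_(x in openQ) ((gap S x)%:E * (f x)%:E).
Proof.
apply: integral_ge0 => x Qx; rewrite mule_ge0 ?lee_fin//; last exact/ltW/f0.
exact/gap_ge0/openQ_closedQ.
Qed.

Let alpha_beta_fin : alpha + beta \is a fin_num.
Proof.
have fin (a : \bar R) : 0 <= a -> a <= (2 * B)%:E -> a \is a fin_num.
  by move=> a0 aB; rewrite ge0_fin_numE// (le_lt_trans aB)// ltry.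
have cst0 : 0 <= (2 * B)%:E by rewrite lee_fin mulr_ge0.
have mcst : measurable_fun (openQ : set (plane R)) (fun=> (2 * B)%:E) by exact: measurable_cst.
have mQ := @measurable_openQ R.
rewrite fin_numD; apply/andP; split; apply: fin.
- by apply: integral_ge0 => x Qx; have /andP[? _] := WB_bound Qx; rewrite mule_ge0 ?f0e.
- rewrite -const_mass; apply: ge0_le_integral => //.
  + by move=> x Qx; have /andP[? _] := WB_bound Qx; rewrite mule_ge0 ?f0e.
  + exact: emeasurable_funM.
  + exact: emeasurable_funM.
  + by move=> x Qx; have /andP[_ ?] := WB_bound Qx; rewrite lee_wpmul2r ?f0e.
- by apply: integral_ge0 => x Qx; case/andP: (b_bound x).
- have <- : \int[leb2 R]_(x in openQ) (2 * B)%:E = (2 * B)%:E.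
    by rewrite integral_cst// [X in _ * X]leb2_openQ mule1.
  apply: ge0_le_integral => //.
  + by move=> x _; case/andP: (b_bound x).
  + exact: measurable_funTS.
  + by move=> x _; case/andP: (b_bound x).
Qed.

(** The gap is nonnegative and zero for [T], so [T] minimises. Any other minimiser has zero gap
    a.e., and [gap_eq0] identifies it with [T]. *)
Lemma optimal_of_potential : optimal_transport f (fun=> 1%R) T.
Proof.
have cT := cost_split tT; rewrite gap_T0 add0e in cT.
have le S : transports f (fun=> 1%R) S -> transport_cost f T <= transport_cost f S.
  move=> tS; rewrite -(@leeD2rE _ (2 * B)%:E)// cT (cost_split tS).
  by rewrite leeDr.
split=> [|S [tS minS]]; first by split.
have g0 : \int[leb2 R]_(x in openQ) ((gap S x)%:E * (f x)%:E) = 0.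
  apply/eqP; rewrite eq_le gap_int_ge0 andbT.
  have := minS _ tT; rewrite -(@leeD2rE _ (2 * B)%:E)// cT (cost_split tS).
  by rewrite -[leRHS]add0e leeD2rE.
have mg : measurable_fun (openQ : set (plane R)) (fun x => (gap S x)%:E * (f x)%:E).
  by apply: emeasurable_funM; apply/measurable_EFinP => //; exact: mgap.
have /(ae_eq_integral_abs (leb2 R) measurable_openQ mg) h :
    \int[leb2 R]_(x in openQ) `|(gap S x)%:E * (f x)%:E| = 0.
  rewrite -g0; apply: eq_integral => x /[!inE] Qx; rewrite gee0_abs// mule_ge0 ?lee_fin//.
    exact/gap_ge0/openQ_closedQ.
  exact/ltW/f0.
apply: filterS h => x h Qx; apply: gap_eq0 => //.
have := h Qx; rewrite -EFinM => -[/eqP].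
by rewrite mulf_eq0 (gt_eqF (f0 Qx)) orbF => /eqP.
Qed.

End Optimality.

(** * Integration over the square by rows and columns *)

Section ChangeOfVariables.
Context {R : realType}.
Implicit Types (x y : R * R) (g h : R * R -> R) (a b A : R -> R) (s q : R).

Lemma smoothOm_comp a g : smooth1 a -> smoothOm g -> smoothOm (fun x => a (g x)).
Proof.
move=> sa sg n; elim: n a sa => [|n IH] a sa; (split=> [x Hx|//]);
  try (apply: (continuous_comp (smoothOm_cont sg Hx)); exact: smooth1_cont).
move=> i; have da x : halfplane x -> is_derive x (basis_vec i) (fun x => a (g x))
    (derive1 a (g x) * 'D_(basis_vec i) g x).
  by move=> Hx; apply: is_derive_compV; [exact: smooth1_isd|exact: smoothOm_is_derive].
split=> [x Hx|]; first by have ? := da x Hx; exact: ex_derive.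
apply: (diffOm_eq _ (diffOmM (IH _ (smooth1_derive sa)) (smoothOm_D i sg n))) => x Hx.
exact: (@derive_val _ _ _ _ _ _ _ (da x Hx)).
Qed.

Lemma integral_unit_derive (p dp : R -> R) :
  (forall s, 0 <= s <= 1 -> is_derive s 1 p (dp s)) ->
  (forall s, 0 <= s <= 1 -> {for s, continuous dp}) ->
  (\int[@lebesgue_measure R]_(s in `]0%R, 1%R[) (dp s)%:E = (p 1 - p 0)%:E)%E.
Proof.
move=> pd cdp.
have cp s : 0 <= s <= 1 -> {for s, continuous p}.
  by move=> /pd ?; apply/differentiable_continuous/derivable1_diffP/ex_derive.
have cdp' : {within `[0, 1], continuous dp}.
  by apply: continuous_in_subspaceT => s; rewrite inE /= in_itv /=; exact: cdp.
have E : (\int[@lebesgue_measure R]_(s in `[0%R, 1%R]) (dp s)%:E = (p 1)%:E - (p 0)%:E)%E.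
  apply: continuous_FTC2 => //.
    split.
    - by move=> s; rewrite in_itv /= => /andP[s0 s1]; have ? := pd s ltac:(by rewrite !ltW); exact: ex_derive.
    - by apply: cvg_at_right_filter; apply: cp; rewrite lexx ler01.
    - by apply: cvg_at_left_filter; apply: cp; rewrite lexx ler01.
  move=> s; rewrite in_itv /= => /andP[s0 s1]; rewrite derive1E.
  exact: (@derive_val _ _ _ _ _ _ _ (pd s ltac:(by rewrite !ltW))).
have m01 : measurable_fun (`[0, 1]%classic : set R) dp.
  by apply: subspace_continuous_measurable_fun; [exact: measurable_itv|].
have m01' : measurable_fun (`]0, 1[%classic : set R) dp.
  apply: measurable_funS m01; first exact: measurable_itv.
  by apply: subset_itv; rewrite bnd_simp.
by rewrite EFinB -E [RHS]integral_itv_bndoo//; exact/measurable_EFinP.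
Qed.

Lemma row_continuous g s q : smoothOm g -> halfplane (s, q) ->
  {for s, continuous (fun s => g (s, q))}.
Proof.
move=> sg Hx; apply: (@continuous_comp _ _ _ (fun s => (s, q)) g); last exact: smoothOm_cont.
by apply: (@cvg_pair _ _ _ _ (nbhs s) (nbhs q)); [exact: cvg_id|exact: cvg_cst].
Qed.

Lemma column_continuous g s q : smoothOm g -> halfplane (q, s) ->
  {for s, continuous (fun s => g (q, s))}.
Proof.
move=> sg Hx; apply: (@continuous_comp _ _ _ (fun s => (q, s)) g); last exact: smoothOm_cont.
by apply: (@cvg_pair _ _ _ _ (nbhs q) (nbhs s)); [exact: cvg_cst|exact: cvg_id].
Qed.

Definition bddQ h := exists M, forall x, openQ x -> `|h x| <= M.

Lemma bddQD g h : bddQ g -> bddQ h -> bddQ (fun x => g x + h x).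
Proof.
move=> [M hM] [N hN]; exists (M + N) => x Qx.
by rewrite (le_trans (ler_normD _ _))// lerD ?hM ?hN.
Qed.

Lemma bddQM g h : bddQ g -> bddQ h -> bddQ (fun x => g x * h x).
Proof.
by move=> [M hM] [N hN]; exists (M * N) => x Qx; rewrite normrM ler_pM ?hM ?hN.
Qed.

Lemma bddQ_cst (c : R) : bddQ (fun=> c).
Proof. by exists `|c|. Qed.

Lemma bddQ_comp a g : continuous a -> bddQ g -> bddQ (fun x => a (g x)).
Proof.
move=> ca [M hM]; have [M0|M0] := leP 0 M; last first.
  by exists 0 => x Qx; have := hM x Qx; rewrite leNgt (lt_le_trans M0).
have c1 : {within `[- M, M], continuous (fun s => `|a s|)}.
  by apply: continuous_subspaceT => s; apply: (continuous_comp (ca s)); exact: norm_continuous.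
have MM : - M <= M by move: M0; lra.
have [c cM hc] := EVT_max MM c1.
by exists `|a c| => x Qx; apply: hc; rewrite in_itv /= -ler_norml hM.
Qed.

Lemma bddQ_eq g h : (forall x, openQ x -> g x = h x) -> bddQ h -> bddQ g.
Proof. by move=> gh [M hM]; exists M => x Qx; rewrite gh// hM. Qed.

Lemma smoothOm_measurable h : smoothOm h ->
  measurable_fun (openQ : set (plane R)) (h : plane R -> R).
Proof.
move=> sh; apply: continuous_plane_measurable => [|x Qx].
  by rewrite openE => x; exact: near_openQ.
exact/smoothOm_cont/openQ_halfplane.
Qed.

Lemma bddQ_integrable (h : plane R -> R) : measurable_fun (openQ : set (plane R)) h ->
  bddQ h -> (leb2 R).-integrable openQ (EFin \o h).
Proof.
move=> mh [M hM]; apply: measurable_bounded_integrable => //.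
- exact: measurable_openQ.
- by apply: (@le_lt_trans _ _ 1%E); [rewrite -leb2_openQ; exact: lexx|exact: ltry].
- by exists M; split; [exact: num_real|move=> N /ltW MN x Qx; exact: le_trans (hM x Qx) MN].
Qed.

Local Open Scope ereal_scope.

Lemma integral_rows (h : plane R -> R) : measurable_fun (openQ : set (plane R)) h -> bddQ h ->
  \int[leb2 R]_(x in openQ) (h x)%:E =
  \int[@lebesgue_measure R]_(q in `]0%R, 1%R[)
    \int[@lebesgue_measure R]_(s in `]0%R, 1%R[) (h (s, q))%:E.
Proof.
move=> mh bh; have ih := bddQ_integrable mh bh.
move: (ih) => /(iffLR (integrable_mkcond _ measurable_openQ)) {}ih.
rewrite integral_mkcond -(integral21_prod_meas1 ih) [RHS]integral_mkcond.
apply: eq_integral => q _; rewrite /fubini_G patchE.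
have [q01|q01] := boolP (q \in `]0%R, 1%R[%classic).
  rewrite [RHS]integral_mkcond; apply: eq_integral => s _; rewrite !patchE /=.
  rewrite [X in if X then _ else _](_ : _ = (s \in `]0%R, 1%R[%classic))//.
  by apply/idP/idP => [/set_mem[]|s01]; rewrite ?inE//=; split=> /=; exact/set_mem.
rewrite integral0_eq// => s _; rewrite patchE memNset// => -[_ /= q01'].
by rewrite mem_set in q01.
Qed.

Lemma integral_columns (h : plane R -> R) : measurable_fun (openQ : set (plane R)) h -> bddQ h ->
  \int[leb2 R]_(x in openQ) (h x)%:E =
  \int[@lebesgue_measure R]_(s in `]0%R, 1%R[)
    \int[@lebesgue_measure R]_(q in `]0%R, 1%R[) (h (s, q))%:E.
Proof.
move=> mh bh; have ih := bddQ_integrable mh bh.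
move: (ih) => /(iffLR (integrable_mkcond _ measurable_openQ)) {}ih.
rewrite integral_mkcond -(integral12_prod_meas1 ih) [RHS]integral_mkcond.
apply: eq_integral => s _; rewrite /fubini_F patchE.
have [s01|s01] := boolP (s \in `]0%R, 1%R[%classic).
  rewrite [RHS]integral_mkcond; apply: eq_integral => q _; rewrite !patchE /=.
  rewrite [X in if X then _ else _](_ : _ = (q \in `]0%R, 1%R[%classic))//.
  by apply/idP/idP => [/set_mem[]|q01]; rewrite ?inE//=; split=> /=; exact/set_mem.
rewrite integral0_eq// => q _; rewrite patchE memNset// => -[/= s01' _].
by rewrite mem_set in s01.
Qed.

End ChangeOfVariables.

(** * The Jacobian integral as a boundary flux *)

Section Pushforward.
Context {R : realType}.
Implicit Types (x y : R * R) (F f g h : R * R -> R) (a b A : R -> R) (s q r c : R).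

Definition jac f g x : R :=
  'D_(basis_vec 0) f x * 'D_(basis_vec 1) g x - 'D_(basis_vec 1) f x * 'D_(basis_vec 0) g x.

Lemma integral_D0 h (k : R -> R) : smoothOm h -> bddQ ('D_(basis_vec 0) h) ->
  (forall q, 0 < q < 1 -> h (1, q) - h (0, q) = k q) ->
  (\int[leb2 R]_(x in openQ) ('D_(basis_vec 0) h x)%:E =
   \int[@lebesgue_measure R]_(q in `]0%R, 1%R[) (k q)%:E)%E.
Proof.
move=> sh bh hk; have sD := smoothOm_D 0 sh.
rewrite (integral_rows (smoothOm_measurable sD) bh).
apply: eq_integral => q; rewrite inE /= in_itv /= => q01; have [q0 q1] := andP q01.
have H s : 0 <= s -> halfplane (s, q) by move=> s0; rewrite /halfplane /= ltr_wpDl.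
rewrite -hk//; apply: (integral_unit_derive (p := fun s => h (s, q))) => s /andP[s0 _].
  exact: is_derive_row sh (H s s0).
exact: row_continuous sD (H s s0).
Qed.

Lemma integral_D1 h (k : R -> R) : smoothOm h -> bddQ ('D_(basis_vec 1) h) ->
  (forall q, 0 < q < 1 -> h (q, 1) - h (q, 0) = k q) ->
  (\int[leb2 R]_(x in openQ) ('D_(basis_vec 1) h x)%:E =
   \int[@lebesgue_measure R]_(q in `]0%R, 1%R[) (k q)%:E)%E.
Proof.
move=> sh bh hk; have sD := smoothOm_D 1 sh.
rewrite (integral_columns (smoothOm_measurable sD) bh).
apply: eq_integral => q; rewrite inE /= in_itv /= => q01; have [q0 q1] := andP q01.
have H s : 0 <= s -> halfplane (q, s) by move=> s0; rewrite /halfplane /= ltr_wpDr.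
rewrite -hk//; apply: (integral_unit_derive (p := fun s => h (q, s))) => s /andP[s0 _].
  exact: is_derive_column sh (H s s0).
exact: column_continuous sD (H s s0).
Qed.

(** Here [f] and [g] are the two components of a map. The conditions on the sides are exactly the
    data that enter the flux, and the identity satisfies them too; the bounds provide
    integrability. *)
Definition square_map f g : Prop :=
  [/\ smoothOm f /\ smoothOm g,
   forall x, halfplane x -> 'D_(basis_vec 0) ('D_(basis_vec 1) g) x =
     'D_(basis_vec 1) ('D_(basis_vec 0) g) x,
   forall r, 0 < r < 1 -> [/\ f (0, r) = 0, f (1, r) = 1, g (1, r) = r &
     'D_(basis_vec 1) g (1, r) = 1],
   forall r, 0 < r < 1 -> 'D_(basis_vec 0) g (r, 0) = 0 /\ 'D_(basis_vec 0) g (r, 1) = 0 &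
   [/\ bddQ f /\ bddQ g, forall i, bddQ ('D_(basis_vec i) f) /\ bddQ ('D_(basis_vec i) g) &
    forall i j, bddQ ('D_(basis_vec i) ('D_(basis_vec j) g))]].

(* Multiplying by a (f x) * b (g x) turns the Jacobian into the divergence of
   A (f x) * b (g x) * (d_1 g, - d_0 g), where A' = a. *)
Lemma integral_jac f g a b A : square_map f g ->
  smooth1 b -> smooth1 A -> derive1 A = a -> A 0 = 0 ->
  (\int[leb2 R]_(x in openQ) (a (f x) * b (g x) * jac f g x)%:E =
   \int[@lebesgue_measure R]_(q in `]0%R, 1%R[) (A 1 * b q)%:E)%E.
Proof.
move=> [[sf sg] gC fv gh [[bf bg] bDfg bDDg]] sb sA dA A0.
have bDf i := (bDfg i).1; have bDg i := (bDfg i).2.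
pose P j x := A (f x) * (b (g x) * 'D_(basis_vec j) g x).
pose dP j i x := a (f x) * 'D_(basis_vec i) f x * (b (g x) * 'D_(basis_vec j) g x) +
  A (f x) * (derive1 b (g x) * 'D_(basis_vec i) g x * 'D_(basis_vec j) g x +
             b (g x) * 'D_(basis_vec i) ('D_(basis_vec j) g) x).
have sP j : smoothOm (P j).
  apply: smoothOmM; first exact: smoothOm_comp.
  by apply: smoothOmM; [exact: smoothOm_comp|exact: smoothOm_D].
have DP j i x : halfplane x -> 'D_(basis_vec i) (P j) x = dP j i x.
  move=> Hx.
  have h1 : is_derive x (basis_vec i) (fun x => A (f x)) (a (f x) * 'D_(basis_vec i) f x).
    by apply: is_derive_compV; [rewrite -dA; exact: smooth1_isd|exact: smoothOm_is_derive].
  have h2 : is_derive x (basis_vec i) (fun x => b (g x)) (derive1 b (g x) * 'D_(basis_vec i) g x).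
    by apply: is_derive_compV; [exact: smooth1_isd|exact: smoothOm_is_derive].
  have h3 := smoothOm_is_derive i (smoothOm_D j sg) Hx.
  exact: (@derive_val _ _ _ _ _ _ _ (is_derive_mul h1 (is_derive_mul h2 h3))).
have ca : continuous a by rewrite -dA; apply: smooth1_cont; exact: smooth1_derive.
have bP j i : bddQ ('D_(basis_vec i) (P j)).
  apply: (@bddQ_eq _ _ (dP j i)) => [x /openQ_halfplane|]; first exact: DP.
  have b0 := bddQ_comp (smooth1_cont sb) bg.
  have b1 := bddQ_comp (smooth1_cont (smooth1_derive sb)) bg.
  have b2 := bddQ_comp (smooth1_cont sA) bf.
  have b3 := bddQ_comp ca bf.
  apply: bddQD; first exact: bddQM (bddQM b3 (bDf i)) (bddQM b0 (bDg j)).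
  exact: bddQM b2 (bddQD (bddQM (bddQM b1 (bDg i)) (bDg j)) (bddQM b0 (bDDg i j))).
have mP j i := smoothOm_measurable (smoothOm_D i (sP j)).
have iP j i := bddQ_integrable (mP j i) (bP j i).
have [h0 [E0 i0 I0]] : exists h0 : plane R -> R, [/\ forall x, halfplane x -> h0 x = dP 1 0 x,
    (leb2 R).-integrable openQ (EFin \o h0) &
    (\int[leb2 R]_(x in openQ) (h0 x)%:E =
     \int[@lebesgue_measure R]_(q in `]0%R, 1%R[) (A 1 * b q)%:E)%E].
  exists ('D_(basis_vec 0) (P 1)); split; [exact: DP|exact: iP|].
  apply: integral_D0 (sP 1) (bP 1 0) _ => q q01.
  by have [f0 f1 g1 h1] := fv q q01; rewrite /P f0 f1 g1 h1 A0 mul0r subr0 mulr1.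
have [h1 [E1 i1 I1]] : exists h1 : plane R -> R, [/\ forall x, halfplane x -> h1 x = dP 0 1 x,
    (leb2 R).-integrable openQ (EFin \o h1) &
    (\int[leb2 R]_(x in openQ) (h1 x)%:E =
     \int[@lebesgue_measure R]_(q in `]0%R, 1%R[) (0 : R)%:E)%E].
  exists ('D_(basis_vec 1) (P 0)); split; [exact: DP|exact: iP|].
  apply: integral_D1 (sP 0) (bP 0 1) _ => q q01.
  by have [g0 g1] := gh q q01; rewrite /P g0 g1 !mulr0 subr0.
transitivity (\int[leb2 R]_(x in openQ) ((h0 x)%:E - (h1 x)%:E)%E)%E.
  apply: eq_integral => x /[!inE] Qx; have Hx := openQ_halfplane Qx.
  rewrite (E0 x Hx) (E1 x Hx) -EFinB /dP (gC x Hx) /jac; congr EFin; ring.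
by rewrite (integralB_EFin (@measurable_openQ R) i0 i1) I0 I1 integral0 sube0.
Qed.

(** Smooth approximations of the indicator of s < c: the base of the power is 1 for s >= c and lies
    strictly between 0 and 1 for s < c, so its powers tend to 0 there. *)
Definition cut c (n : nat) s : R := 1 - (1 - flat (c - s)) ^+ n.

Lemma smooth1_cut c n : smooth1 (cut c n).
Proof.
have sf : smooth1 (fun s => 1 - flat (c - s)).
  apply: smooth1D; first exact: smooth1_cst.
  apply: smooth1N; apply: smooth1_comp; first exact: smooth1_flat.
  by apply: smooth1D; [exact: smooth1_cst|apply: smooth1N; exact: smooth1_id].
apply: smooth1D; first exact: smooth1_cst.
by apply: smooth1N; exact: smooth1X.
Qed.

Lemma cut_bound c n s : `|cut c n s| <= 1.
Proof.
have f0 := flat_ge0 (c - s); have f1 := flat_lt1 (c - s).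
have h0 : 0 <= (1 - flat (c - s)) ^+ n by rewrite exprn_ge0// subr_ge0 ltW.
have h1 : (1 - flat (c - s)) ^+ n <= 1 by rewrite exprn_ile1 ?subr_ge0 ?(ltW f1)// gerBl.
by rewrite /cut ler_norml; lra.
Qed.

Lemma cut_cvg c s : cut c n s @[n --> \oo] --> ((s < c)%R%:R : R).
Proof.
have [sc|cs] := ltP s c; last first.
  have -> : (fun n : nat => cut c n s) = fun=> 0 :> R.
    by apply/funext => n; rewrite /cut flat_le0 ?subr_le0// subr0 expr1n subrr.
  exact: cvg_cst.
have h : (1 - flat (c - s)) ^+ n @[n --> \oo] --> (0 : R).
  have f0 : 0 < flat (c - s) by rewrite flat_gt0// subr_gt0.
  have f1 := flat_lt1 (c - s).
  by apply: cvg_expr; rewrite ger0_norm ?subr_ge0 ?(ltW f1)// gtrBl.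
by rewrite -[X in _ --> X]subr0; apply: cvgB => //; exact: cvg_cst.
Qed.

(** Dominated convergence: the products of cuts are at most 1 in absolute value, so a bound for [F]
    dominates on the square, which has measure 1. *)
Lemma density_pushforward_ray2 (F : plane R -> R) (S : plane R -> plane R) (c : R * R) :
  measurable_fun (openQ : set (plane R)) F -> bddQ F ->
  measurable_fun (openQ : set (plane R)) S ->
  (density_pushforward (leb2 R) openQ F S (ray2 c) < +oo)%E /\
  (\int[leb2 R]_(x in openQ) (cut c.1 n (S x).1 * cut c.2 n (S x).2 * F x)%:E)%E
    @[n --> \oo] --> density_pushforward (leb2 R) openQ F S (ray2 c).
Proof.
move=> mF [M FM] mS.
pose phi (n : nat) (x : plane R) := (cut c.1 n (S x).1 * cut c.2 n (S x).2 * F x)%:E.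
pose lim x := (((S x).1 < c.1)%R%:R * ((S x).2 < c.2)%R%:R * F x)%:E.
have limE : density_pushforward (leb2 R) openQ F S (ray2 c) =
    (\int[leb2 R]_(x in openQ) lim x)%E.
  rewrite /density_pushforward integral_mkcondr; apply: eq_integral => x _.
  rewrite patchE /lim; have [h|h] := boolP (x \in S @^-1` ray2 c).
    by move/set_mem: h; rewrite /ray2 /= !in_itv /= => -[-> ->]; rewrite !mul1r.
  congr EFin; have [h1|_] := boolP ((S x).1 < c.1); last by rewrite !mul0r.
  have [h2|_] := boolP ((S x).2 < c.2); last by rewrite mulr0 mul0r.
  by rewrite mem_set in h; last by rewrite /ray2 /= !in_itv.
have mc (d : R) n : measurable_fun [set: R] (cut d n).
  by apply: continuous_measurable_fun; apply: smooth1_cont; exact: smooth1_cut.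
have m1 : measurable_fun (openQ : set (plane R)) (fun x => (S x).1) :=
  measurableT_comp measurable_fst mS.
have m2 : measurable_fun (openQ : set (plane R)) (fun x => (S x).2) :=
  measurableT_comp measurable_snd mS.
have mphi n : measurable_fun (openQ : set (plane R)) (phi n).
  apply/measurable_EFinP; apply: measurable_funM => //.
  apply: measurable_funM; first exact: (measurableT_comp (mc c.1 n) m1).
  exact: (measurableT_comp (mc c.2 n) m2).
have cphi x : phi n x @[n --> \oo] --> lim x.
  apply: cvg_EFin; first exact: nearW.
  by apply: cvgM; [apply: cvgM; exact: cut_cvg|exact: cvg_cst].
have mlim : measurable_fun (openQ : set (plane R)) lim.
  exact: (emeasurable_fun_cvg phi lim (fun n => mphi n) (fun x _ => cphi x)).
have ig : (leb2 R).-integrable openQ (EFin \o (fun=> M)).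
  by apply: bddQ_integrable; [exact: measurable_cst|exact: bddQ_cst].
have ae_lim : {ae leb2 R, forall x, openQ x -> phi ^~ x @ \oo --> lim x}.
  by apply: aeW => x _; exact: cphi.
have ae_le : {ae leb2 R, forall x n, openQ x -> (`|phi n x| <= M%:E)%E}.
  apply: aeW => x n Qx; rewrite lee_fin !normrM; apply: le_trans (FM x Qx).
  by rewrite ler_piMl// mulr_ile1//; exact: cut_bound.
have [il _ cl] := dominated_convergence (@measurable_openQ R) mphi mlim ae_lim ig ae_le.
rewrite limE; split; last exact: cl.
rewrite ltey_eq; apply/orP; left; exact: (integrable_fin_num (@measurable_openQ R) il).
Qed.

End Pushforward.

(** * Square maps push their Jacobian to Lebesgue measure *)

Section SquareMap.
Context {R : realType}.
Implicit Types (x y : R * R) (f g h : R * R -> R) (r : R).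

Let Dfst i x : 'D_(basis_vec i) (fun y : R * R => y.1) x = (basis_vec i).1 :> R.
Proof. exact: (@derive_val _ _ _ _ _ _ _ (is_derive_fst x (basis_vec i))). Qed.

Let Dsnd i x : 'D_(basis_vec i) (fun y : R * R => y.2) x = (basis_vec i).2 :> R.
Proof. exact: (@derive_val _ _ _ _ _ _ _ (is_derive_snd x (basis_vec i))). Qed.

Lemma jac_id x : jac (fun y => y.1) (fun y => y.2) x = 1.
Proof. by rewrite /jac !Dfst !Dsnd /basis_vec /= mulr1 mulr0 subr0. Qed.

Lemma bddQ_fst : bddQ (fun y : R * R => y.1).
Proof. by exists 1 => x /openQ_closedQ/closedQ_abs[]. Qed.

Lemma bddQ_snd : bddQ (fun y : R * R => y.2).
Proof. by exists 1 => x /openQ_closedQ/closedQ_abs[]. Qed.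

Lemma smoothOm_fst : smoothOm (fun y : R * R => y.1).
Proof.
have -> : (fun y : R * R => y.1) = bil 0 1 0 0; last exact: smoothOm_bil.
by apply/funext => y; rewrite /bil; ring.
Qed.

Lemma smoothOm_snd : smoothOm (fun y : R * R => y.2).
Proof.
have -> : (fun y : R * R => y.2) = bil 0 0 1 0; last exact: smoothOm_bil.
by apply/funext => y; rewrite /bil; ring.
Qed.

Lemma square_map_id : square_map (fun y => y.1) (fun y => y.2).
Proof.
have DDsnd i j x : 'D_(basis_vec i) ('D_(basis_vec j) (fun y : R * R => y.2)) x = 0.
  have -> : 'D_(basis_vec j) (fun y : R * R => y.2) = fun=> (basis_vec j).2.
    by apply/funext => y; exact: Dsnd.
  exact: derive_cst.
split.
- by split; [exact: smoothOm_fst|exact: smoothOm_snd].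
- by move=> x _; rewrite !DDsnd.
- by move=> r _; rewrite Dsnd.
- by move=> r _; rewrite !Dsnd.
- split; first by split; [exact: bddQ_fst|exact: bddQ_snd].
    move=> i; split; first by apply: (bddQ_eq (h := fun=> (basis_vec i).1)); [move=> x _; exact: Dfst|exact: bddQ_cst].
    by apply: (bddQ_eq (h := fun=> (basis_vec i).2)); [move=> x _; exact: Dsnd|exact: bddQ_cst].
  by move=> i j; apply: (bddQ_eq (h := fun=> 0)); [move=> x _; exact: DDsnd|exact: bddQ_cst].
Qed.

Lemma bddQ_jac f g : square_map f g -> bddQ (jac f g).
Proof.
move=> [_ _ _ _ [_ bD _]]; have [f0 g0] := bD 0; have [f1 g1] := bD 1.
apply: (bddQ_eq (h := fun x => 'D_(basis_vec 0) f x * 'D_(basis_vec 1) g x +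
  (-1) * ('D_(basis_vec 1) f x * 'D_(basis_vec 0) g x))).
  by move=> x _; rewrite /jac mulN1r.
apply: bddQD; first exact: bddQM.
by apply: bddQM; [exact: bddQ_cst|exact: bddQM].
Qed.

Lemma smoothOm_jac f g : square_map f g -> smoothOm (jac f g).
Proof.
move=> [[sf sg] _ _ _ _]; apply: smoothOmB; apply: smoothOmM; exact: smoothOm_D.
Qed.

Lemma measurable_square_map f g : square_map f g ->
  measurable_fun (openQ : set (plane R)) (fun x : plane R => (f x, g x) : plane R).
Proof.
move=> [[sf sg] _ _ _ _].
apply: (measurability _ (@plane_measurableE R)) => _ [_ [c _ <-] <-].
have mf := smoothOm_measurable sf; have mg := smoothOm_measurable sg.
have mQ := @measurable_openQ R.
rewrite (_ : _ `&` _ = (openQ `&` f @^-1` `]-oo, c.1[) `&` (openQ `&` g @^-1` `]-oo, c.2[)).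
  by apply: measurableI; [apply: mf|apply: mg] => //; exact: measurable_itv.
by apply/seteqP; split=> x /=; [move=> [Qx []]|move=> [[Qx h1] [_ h2]]].
Qed.

(** By [integral_jac] the smoothed mass of a quadrant depends only on the two cut functions, not on
    the map; comparing with the identity and passing to the limit gives the mass of the quadrant. *)
Lemma square_map_ray2 f g (c : R * R) : square_map f g ->
  density_pushforward (leb2 R) openQ (jac f g) (fun x => (f x, g x)) (ray2 c) =
  density_pushforward (leb2 R) openQ (jac (fun y => y.1) (fun y => y.2))
    (fun x => (x.1, x.2)) (ray2 c).
Proof.
move=> fg; have idm := square_map_id.
have [_ c1] := density_pushforward_ray2 c (smoothOm_measurable (smoothOm_jac fg)) (bddQ_jac fg)
  (measurable_square_map fg).
have [_ c2] := density_pushforward_ray2 c (smoothOm_measurable (smoothOm_jac idm)) (bddQ_jac idm)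
  (measurable_square_map idm).
apply: etrans (esym (cvg_lim (@ereal_hausdorff R) c1)) _.
apply: etrans (cvg_lim (@ereal_hausdorff R) c2).
apply: congr_lim; apply/funext => n.
have [A [A0 sA dA]] := smooth1_antiderivative (smooth1_cut c.1 n).
rewrite (integral_jac fg (smooth1_cut c.2 n) sA dA A0).
by rewrite (integral_jac idm (smooth1_cut c.2 n) sA dA A0).
Qed.

(** Nonnegativity of the Jacobian makes both sides measures, and finite measures that agree on
    quadrants agree on all Borel sets. *)
Lemma transports_square_map f g (F : R * R -> R) (T : R * R -> R * R) : square_map f g ->
  (forall x, openQ x -> T x = (f x, g x)) -> (forall x, openQ x -> F x = jac f g x) ->
  (forall x, openQ x -> 0 <= F x) -> transports F (fun=> 1) T.
Proof.
move=> fg TE FE F0; have idm := square_map_id; have mQ := @measurable_openQ R.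
have mT := measurable_square_map fg.
split; first by apply: eq_measurable_fun mT => x /set_mem/TE.
have J0 x : openQ x -> 0 <= jac f g x by move=> Qx; rewrite -FE// F0.
have J1 x : openQ x -> 0 <= jac (fun y => y.1) (fun y => y.2) x by rewrite jac_id.
have mJ := smoothOm_measurable (smoothOm_jac fg).
have mJ1 := smoothOm_measurable (smoothOm_jac idm).
have h B : measurable B ->
    density_pushforward (leb2 R) openQ (jac f g) (fun x => (f x, g x)) B =
    density_pushforward (leb2 R) openQ (jac (fun y => y.1) (fun y => y.2)) (fun x => (x.1, x.2)) B.
  apply: (@plane_measure_unique R (density_pushforward_measure (leb2 R) mQ mJ J0 mT)
    (density_pushforward_measure (leb2 R) mQ mJ1 J1 (measurable_square_map idm))) => c.
    exact: square_map_ray2.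
  by have [] := density_pushforward_ray2 c mJ (bddQ_jac fg) mT.
move=> B mB; transitivity (density_pushforward (leb2 R) openQ (jac f g) (fun x => (f x, g x)) B).
  rewrite /pushforward /density_mass /density_pushforward.
  rewrite (_ : openQ `&` T @^-1` B = openQ `&` (fun x => (f x, g x)) @^-1` B).
    by apply: eq_integral => x /set_mem[Qx _]; rewrite FE.
  by apply/seteqP; split=> x [Qx /= Bx]; split=> //=; [rewrite -TE|rewrite TE].
rewrite h// /density_mass /density_pushforward.
rewrite (_ : (fun x => (x.1, x.2)) @^-1` B = B); last by apply/seteqP; split=> -[].
by apply: eq_integral => x _; rewrite jac_id.
Qed.

End SquareMap.

(** * The map, its density and their regularity *)

Section CornerMap.
Context {R : realType}.
Implicit Types (x y : R * R) (h : R * R -> R) (w : seq 'I_2) (i j : 'I_2) (r : R).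

Lemma iter_bil_affine w c0 c1 c2 : (1 < size w)%N ->
  iter_partial w (bil c0 c1 c2 0) = fun=> 0 :> R.
Proof.
have D1 i (d0 d1 d2 : R) : exists d, 'D_(basis_vec i) (bil d0 d1 d2 0) = bil d 0 0 0.
  by exists (if i == ord0 then d1 else d2); apply/funext => x;
     rewrite (@derive_val _ _ _ _ _ _ _ (bil_is_derive d0 d1 d2 0 i x)); case: ifP.
have D2 i (d : R) : 'D_(basis_vec i) (bil d 0 0 0) = bil 0 0 0 0.
  by apply/funext => x; rewrite (@derive_val _ _ _ _ _ _ _ (bil_is_derive d 0 0 0 i x)); case: ifP.
elim/last_ind: w => [//|w j _]; rewrite size_rcons iter_partial_rcons.
have [d ->] := D1 j c0 c1 c2; elim/last_ind: w => [//|w i _] _.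
rewrite iter_partial_rcons D2 -[RHS](iter_partial0 w); congr iter_partial.
by apply/funext => x; rewrite /bil !mul0r !addr0.
Qed.

Context (v : R * R -> R) (sv : smoothOm v) (v0 : forall x, -1 <= logr x -> v x = 0)
  (vC : forall w x, halfplane x ->
    'D_(basis_vec 0) ('D_(basis_vec 1) (iter_partial w v)) x =
    'D_(basis_vec 1) ('D_(basis_vec 0) (iter_partial w v)) x)
  (vN : forall r, 0 < r -> 'D_(basis_vec 0) v (0, r) = 0 /\ 'D_(basis_vec 1) v (r, 0) = 0)
  (v3 : wb corner 3 3 (16^-1 : R) v)
  (v4 : forall alpha : R, alpha < 1 -> exists2 C, 0 <= C & wb corner 4 (3 + alpha) C v).

Lemma iter_far0 w x : halfplane x -> 0 <= logr x -> iter_partial w v x = 0.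
Proof.
move=> Hx lx.
have n0 : \near x, v x = 0.
  have lx1 : -1 < logr x by rewrite (lt_le_trans _ lx)// ltrN10.
  have h : \forall y \near x, -1 < logr y := logr_continuous Hx (lt_nbhsr lx1).
  by apply: filterS h => y ly; apply: v0; exact: ltW.
by rewrite (nbhs_singleton (near_eq_iter w n0)) iter_partial0.
Qed.

Lemma wb_closedQ k m C w x : 0 <= C -> wb corner k m C v -> (size w <= k)%N ->
  closedQ x -> halfplane x -> `|iter_partial w v x| <= C * expR ((m - (size w)%:R) * logr x).
Proof.
move=> C0 hw wk cx Hx; have [lx|lx] := ltP (logr x) 0; last first.
  by rewrite iter_far0// normr0 mulr_ge0// expR_ge0.
apply: hw => //; split=> //; apply: contraTN Hx => /eqP ->.
by rewrite /halfplane /= addr0 ltxx.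
Qed.

(** For r < 1 the exponent 3 - |w| is nonnegative, so the power of r is at most 1; for r >= 1 the
    potential vanishes. *)
Lemma iter_bound w x : (size w <= 3)%N -> closedQ x -> halfplane x ->
  `|iter_partial w v x| <= 16^-1.
Proof.
move=> w3 cx Hx; have [lx|lx] := ltP (logr x) 0; last first.
  by rewrite iter_far0// normr0 invr_ge0.
apply: le_trans (wb_closedQ _ v3 w3 cx Hx) _; first by rewrite invr_ge0.
by rewrite ler_piMr ?invr_ge0// expR_le1 mulr_ge0_le0 ?(ltW lx)// subr_ge0 ler_nat.
Qed.

(** Weight 3 alone leaves third derivatives merely bounded; [v4] with alpha = 1/2 gives a positive
    power of r. *)
Lemma iter_lim0 w : (size w <= 3)%N -> lim0 (iter_partial w v).
Proof.
have h : (2^-1 : R) < 1 by rewrite invf_lt1// ltr1n.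
have [C C0 hC] := v4 h => w3.
apply: wb_near0_lim0 C0 hC (leqW w3) _.
by have : (size w)%:R <= 3 :> R; [rewrite ler_nat|lra].
Qed.

(* Abstract, because unification must not unfold them inside iterated derivatives. *)
Context (map1 map2 : R * R -> R) (map1E : map1 = fun x => x.1 + 'D_(basis_vec 0) v x)
  (map2E : map2 = fun x => x.2 + 'D_(basis_vec 1) v x).

Let Dmap1 i x : halfplane x ->
  'D_(basis_vec i) map1 x = (basis_vec i).1 + 'D_(basis_vec i) ('D_(basis_vec 0) v) x.
Proof.
rewrite map1E => Hx; have h := smoothOm_is_derive i (smoothOm_D 0 sv) Hx.
exact: (@derive_val _ _ _ _ _ _ _ (is_derive_add (is_derive_fst x (basis_vec i)) h)).
Qed.

Let Dmap2 i x : halfplane x ->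
  'D_(basis_vec i) map2 x = (basis_vec i).2 + 'D_(basis_vec i) ('D_(basis_vec 1) v) x.
Proof.
rewrite map2E => Hx; have h := smoothOm_is_derive i (smoothOm_D 1 sv) Hx.
exact: (@derive_val _ _ _ _ _ _ _ (is_derive_add (is_derive_snd x (basis_vec i)) h)).
Qed.

Let DDmap2 i j x : halfplane x -> 'D_(basis_vec i) ('D_(basis_vec j) map2) x =
  'D_(basis_vec i) ('D_(basis_vec j) ('D_(basis_vec 1) v)) x.
Proof.
move=> Hx; have sD := smoothOm_D j (smoothOm_D 1 sv).
have h := smoothOm_is_derive i sD Hx.
have hc := is_derive_cst ((basis_vec j).2 : R) x (basis_vec i).
have E := @derive_val _ _ _ _ _ _ _ (is_derive_add hc h); rewrite add0r in E.
rewrite -E; apply: near_eq_derive.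
by apply: filterS (near_halfplane Hx) => y Hy; exact: Dmap2.
Qed.

Let bdd_iter w : (size w <= 3)%N -> bddQ (iter_partial w v).
Proof.
move=> w3; exists 16^-1 => x Qx.
by apply: iter_bound => //; [exact: openQ_closedQ|exact: openQ_halfplane].
Qed.

Let logr_ge0 x : halfplane x -> 1 <= x.1 \/ 1 <= x.2 -> 0 <= logr x.
Proof.
move=> Hx h; rewrite ln_ge0//; case: h => h.
  by rewrite (le_trans h)// (le_trans (ler_norm _))// fst_le_enorm.
by rewrite (le_trans h)// (le_trans (ler_norm _))// snd_le_enorm.
Qed.

(** The sides x_1 = 1 and x_2 = 1 lie in r >= 1, where the map is the identity. On the sides through
    the corner the Neumann conditions apply; on x_2 = 0 their tangential derivative gives the
    vanishing of d_1 of the second component. *)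
Lemma corner_square_map : square_map map1 map2.
Proof.
split.
- by rewrite map1E map2E; split; apply: smoothOmD; [exact: smoothOm_fst|exact: smoothOm_D|exact: smoothOm_snd
    |exact: smoothOm_D].
- by move=> x Hx; rewrite (DDmap2 0 1 Hx) (DDmap2 1 0 Hx); exact: (vC [:: 1] Hx).
- move=> r /andP[r0 r1].
  have H1 : halfplane (1 : R, r) by rewrite /halfplane /= addr_gt0.
  have L1 : 0 <= logr (1 : R, r) by apply: logr_ge0 => //; left.
  have Z0 : 'D_(basis_vec 0) v (1 : R, r) = 0 := iter_far0 [:: 0] H1 L1.
  have Z1 : 'D_(basis_vec 1) v (1 : R, r) = 0 := iter_far0 [:: 1] H1 L1.
  have Z11 : 'D_(basis_vec 1) ('D_(basis_vec 1) v) (1 : R, r) = 0 := iter_far0 [:: 1; 1] H1 L1.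
  by split; [rewrite map1E (vN r0).1 addr0|rewrite map1E Z0 addr0|rewrite map2E Z1 addr0
    |rewrite (Dmap2 1 H1) Z11 addr0].
- move=> r /andP[r0 r1].
  have H0 : halfplane (r, 0 : R) by rewrite /halfplane /= addr0.
  have H1 : halfplane (r, 1 : R) by rewrite /halfplane /= addr_gt0.
  have L1 : 0 <= logr (r, 1 : R) by apply: logr_ge0 => //; right.
  have Z01 : 'D_(basis_vec 0) ('D_(basis_vec 1) v) (r, 1 : R) = 0 := iter_far0 [:: 0; 1] H1 L1.
  split; last by rewrite (Dmap2 0 H1) Z01 addr0.
  rewrite (Dmap2 0 H0) add0r -(@derive_val _ _ _ _ _ _ _ (is_derive_row (smoothOm_D 1 sv) H0)).
  transitivity ('D_1 (fun=> 0 : R) r); last exact: derive_cst.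
  apply: near_eq_derive.
  by apply: filterS (lt_nbhsr r0) => s /vN[].
split.
- rewrite map1E map2E; split; apply: bddQD; [exact: bddQ_fst|exact: (bdd_iter (w := [:: 0]))|exact: bddQ_snd
    |exact: (bdd_iter (w := [:: 1]))].
- move=> i; split.
  + apply: (bddQ_eq (h := fun x => (basis_vec i).1 + iter_partial [:: i; 0] v x)).
      by move=> x /openQ_halfplane; exact: Dmap1.
    by apply: bddQD; [exact: bddQ_cst|exact: bdd_iter].
  + apply: (bddQ_eq (h := fun x => (basis_vec i).2 + iter_partial [:: i; 1] v x)).
      by move=> x /openQ_halfplane; exact: Dmap2.
    by apply: bddQD; [exact: bddQ_cst|exact: bdd_iter].
- move=> i j; apply: (bddQ_eq (h := iter_partial [:: i; j; 1] v)); last exact: bdd_iter.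
  by move=> x /openQ_halfplane; exact: DDmap2.
Qed.

Lemma jac_corner x : halfplane x -> jac map1 map2 x = detD2 v x.
Proof.
move=> Hx; have E (a b c d a' b' c' d' : R) : a = 1 + a' -> b = 1 + b' -> c = 0 + c' -> d = 0 + d' ->
    a * b - c * d = (1 + a') * (1 + b') - d' * c' by move=> -> -> -> ->; ring.
exact: E (Dmap1 0 Hx) (Dmap2 1 Hx) (Dmap1 1 Hx) (Dmap2 0 Hx).
Qed.

(* det D^2 u for u = |x|^2 / 2 + v, with the value 1 at the corner. *)
Definition corner_density x : R := bil 1 0 0 (- (12 * pi)) x + patch0 (detD2_error v) x.

Definition corner_map x : R * R :=
  (bil 0 1 0 0 x + patch0 ('D_(basis_vec 0) v) x, bil 0 0 1 0 x + patch0 ('D_(basis_vec 1) v) x).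

Lemma halfplane_neq0 x : halfplane x -> x != 0.
Proof. by apply: contraTneq => ->; rewrite /halfplane /= addr0 ltxx. Qed.

Lemma corner_densityE x : halfplane x -> corner_density x = detD2 v x.
Proof.
move=> /halfplane_neq0 xn0; rewrite /corner_density patch0E// /detD2_error /bil; move: (detD2 v x) => d; ring.
Qed.

Lemma corner_mapE x : halfplane x -> corner_map x = (map1 x, map2 x).
Proof.
move=> /halfplane_neq0 xn0; rewrite /corner_map !patch0E// map1E map2E /bil.
move: ('D_(basis_vec 0) v x) ('D_(basis_vec 1) v x) => d0 d1.
by congr pair; ring.
Qed.

(** With second derivatives at most 1/16 the determinant is at least (15/16)^2 - (1/16)^2 = 7/8. *)
Lemma corner_density_ge x : closedQ x -> 2^-1 <= corner_density x.
Proof.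
move=> cx; have [->|xn0] := eqVneq x 0.
  rewrite /corner_density /patch0 eqxx /bil /= !mulr0 !addr0; lra.
have Hx := closedQ_halfplane cx xn0; rewrite corner_densityE// /detD2.
have b i j := iter_bound (w := [:: i; j]) isT cx Hx.
have H (p q s t : R) : `|p| <= 16^-1 -> `|q| <= 16^-1 -> `|s| <= 16^-1 -> `|t| <= 16^-1 ->
    2^-1 <= (1 + p) * (1 + q) - s * t.
  rewrite !(ler_norml p, ler_norml q) => p1 q1 s1 t1.
  have h1 : `|s * t| <= 16^-1 * 16^-1 by rewrite normrM ler_pM.
  have h2 : (1 - 16^-1) * (1 - 16^-1) <= (1 + p) * (1 + q) by apply: ler_pM; lra.
  by move: h1 h2; rewrite ler_norml; move: ((1 + p) * (1 + q)) (s * t) => A B; lra.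
exact: H (b 0 0) (b 1 1) (b 0 1) (b 1 0).
Qed.

(** For each order [k] the error has weight k + 1 near the corner, so its derivatives up to order
    [k] tend to 0 there. The neighbourhood [sigma] may shrink with [k]. *)
Lemma Cinfty_corner_density :
  (forall k, exists2 sigma : R, sigma < 0 & exists2 C, 0 <= C &
     wb (corner `&` [set x | logr x < sigma]) k (k%:R + 1) C (detD2_error v)) ->
  Cinfty corner_density.
Proof.
move=> vflat k; have [sigma _ [C C0 hC]] := vflat k.
apply: Ck_bil_patch0 => [|w wk].
  apply: (@smoothOm_eq _ _ (fun x => detD2 v x - bil 1 0 0 (- (12 * pi)) x)).
    by move=> x _; rewrite /detD2_error /bil; move: (detD2 v x) => d; ring.
  by apply: smoothOmB; [exact: smoothOm_detD2|exact: smoothOm_bil].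
by apply: (wb_lim0 C0 hC wk _); rewrite natr1 ltr_nat ltnS.
Qed.

Let iterD w i : iter_partial w ('D_(basis_vec i) v) = iter_partial (rcons w i) v.
Proof. by rewrite iter_partial_rcons. Qed.

(** Second derivatives of a component are third derivatives of [v], of weight alpha, and their
    gradient has weight alpha - 1: the two hypotheses of [patch0_holder]. *)
Let Ckalpha_component c0 c1 c2 i (alpha : R) : 0 < alpha < 1 ->
  Ckalpha 2 alpha (fun x => bil c0 c1 c2 0 x + patch0 ('D_(basis_vec i) v) x).
Proof.
move=> alpha01; have [alpha0 alpha1] := andP alpha01; have sD := smoothOm_D i sv.
have L w : (size w <= 2)%N -> lim0 (iter_partial w ('D_(basis_vec i) v)).
  by move=> w2; rewrite iterD; apply: iter_lim0; rewrite size_rcons.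
split; first exact: Ck_bil_patch0.
move=> w w2; have w2' : (size w <= 2)%N by rewrite w2.
eexists; split; first exact: extension_bil_patch0 (L w w2').
have [C C0 hC] := v4 alpha1; exists (4 * C) => x y cx cy.
rewrite !iter_bil_affine ?w2// !add0r iterD.
apply: patch0_holder => //.
- exact: smoothOm_iter.
- apply: continuous_patch0 => [z Hz|]; first exact/smoothOm_cont/Hz/smoothOm_iter.
  by rewrite -iterD; exact: L.
- move=> z cz Hz; have := wb_closedQ (w := rcons w i) C0 hC; rewrite size_rcons w2.
  by move=> /(_ z isT cz Hz); rewrite [3 + alpha]addrC addrK.
- move=> z j cz Hz; have := wb_closedQ (w := j :: rcons w i) C0 hC; rewrite /= size_rcons w2.
  move=> /(_ z isT cz Hz); have -> : 3 + alpha - 4%:R = alpha - 1 by ring.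
  exact.
Qed.

Lemma Ckalpha_corner_map (alpha : R) : 0 < alpha < 1 -> Ckalpha_map 2 alpha corner_map.
Proof. by move=> alpha01; split; exact: Ckalpha_component. Qed.

(** Inside the square d_1^3 of the first component is d_1^4 v, which is unbounded near the corner,
    whereas a continuous extension would be bounded there. *)
Lemma not_C3_corner_map :
  (forall B e : R, 0 < e -> exists x, [/\ openQ x, enorm x < e &
     B < `|iter_partial [:: 0; 0; 0; 0] v x|]) ->
  ~ Ck_map 3 corner_map.
Proof.
move=> blowup [[_ _ /(_ [:: 0; 0; 0] isT)[hbar [ch hE]]] _].
have c0 : closedQ (0 : R * R) by rewrite /closedQ /= !in_itv /= lexx ler01.
have /cvgrPdist_lt/(_ _ ltr01) := (iffLR (subspace_continuousP _ _) ch) _ c0.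
rewrite near_withinE => -[[U V] /= [nU nV] UV].
have [d1 /= d10 dU] := nU; have [d2 /= d20 dV] := nV.
have d0 : 0 < Num.min d1 d2 by rewrite lt_min d10.
have [x [Qx xd]] := blowup (`|hbar 0| + 1) _ d0; move: xd; rewrite lt_min => /andP[xd1 xd2].
have Ux : U x.1 by apply: dU; rewrite /= sub0r normrN (le_lt_trans _ xd1)// fst_le_enorm.
have Vx : V x.2 by apply: dV; rewrite /= sub0r normrN (le_lt_trans _ xd2)// snd_le_enorm.
have {UV} := UV x (conj Ux Vx) (openQ_closedQ Qx).
rewrite /from_subspace (hE x Qx).
have Hx := openQ_halfplane Qx.
rewrite (nbhs_singleton (near_iter_bil_patch0 [:: 0; 0; 0] 0 1 0 0 (smoothOm_D 0 sv) Hx)).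
rewrite iter_bil_affine// add0r iterD /=.
move: ('D_ _ ('D_ _ ('D_ _ _)) x) => d hd; apply/negP; rewrite -leNgt.
have := ler_normB (hbar 0) (hbar 0 - d); rewrite opprB addrC subrK => h.
by apply: (le_trans h); rewrite lerD2l ltW.
Qed.

Definition convex_potential x : R := 2^-1 * (x.1 ^+ 2 + x.2 ^+ 2) + patch0 v x.

Let continuous_iter w : (size w <= 3)%N -> {within closedQ, continuous (patch0 (iter_partial w v))}.
Proof.
move=> w3; apply: continuous_patch0 => [x Hx|]; last exact: iter_lim0.
exact/smoothOm_cont/Hx/smoothOm_iter.
Qed.

(** The quadratic part is exact, and the remainder of [v] is at most 1/16 times (|a| + |b|)^2 <= 2
    (a^2 + b^2). Since 1/8 < 1/2, this contains both the subgradient inequality and a quadratic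
    upper bound. *)
Lemma convex_potential_second_order x y : closedQ x -> closedQ y ->
  `|convex_potential y - convex_potential x - dot (corner_map x) (y - x) -
    2^-1 * ((y - x).1 ^+ 2 + (y - x).2 ^+ 2)| <=
  8^-1 * ((y - x).1 ^+ 2 + (y - x).2 ^+ 2).
Proof.
move=> cx cy.
have h := first_order_remainder sv (continuous_iter (w := [::]) isT)
  (fun i => continuous_iter (w := [:: i]) isT) cx cy
  (fun z i j cz Hz => iter_bound (w := [:: i; j]) isT cz Hz).
have sq : (`|y.1 - x.1| + `|y.2 - x.2|) ^+ 2 <= 2 * ((y.1 - x.1) ^+ 2 + (y.2 - x.2) ^+ 2).
  rewrite -[(y.1 - x.1) ^+ 2]real_normK ?num_real// -[(y.2 - x.2) ^+ 2]real_normK ?num_real//.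
  move: `|y.1 - x.1| `|y.2 - x.2| => a b; rewrite -subr_ge0.
  have -> : 2 * (a ^+ 2 + b ^+ 2) - (a + b) ^+ 2 = (a - b) ^+ 2 by ring.
  exact: sqr_ge0.
move: h; rewrite /convex_potential /dot /corner_map /bil /=.
move: (patch0 v x) (patch0 v y) (patch0 ('D_(basis_vec 0) v) x) (patch0 ('D_(basis_vec 1) v) x).
move=> p q d e h.
have -> : 2^-1 * (y.1 ^+ 2 + y.2 ^+ 2) + q - (2^-1 * (x.1 ^+ 2 + x.2 ^+ 2) + p) -
   ((0 + 1 * x.1 + 0 * x.2 + 0 * (x.1 * x.2) + d) * (y.1 - x.1) +
    (0 + 0 * x.1 + 1 * x.2 + 0 * (x.1 * x.2) + e) * (y.2 - x.2)) -
   2^-1 * ((y.1 - x.1) ^+ 2 + (y.2 - x.2) ^+ 2) =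
   q - p - (d * (y.1 - x.1) + e * (y.2 - x.2)) by field.
apply: (le_trans h); apply: le_trans (_ : 16^-1 * (2 * ((y.1 - x.1) ^+ 2 + (y.2 - x.2) ^+ 2)) <= _).
  by rewrite ler_wpM2l// invr_ge0.
by move: (_ + _) => c; lra.
Qed.

Let corner_density_pos x : closedQ x -> 0 < corner_density x.
Proof. by move=> /corner_density_ge; apply: lt_le_trans; rewrite invr_gt0. Qed.

Lemma transports_corner_map : transports corner_density (fun=> 1) corner_map.
Proof.
apply: (transports_square_map corner_square_map) => x Qx; have Hx := openQ_halfplane Qx.
- exact: corner_mapE.
- by rewrite corner_densityE// jac_corner.
- exact/ltW/corner_density_pos/openQ_closedQ.
Qed.

Lemma optimal_corner_map : optimal_transport corner_density (fun=> 1) corner_map.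
Proof.
have mQ (h k : R * R -> R) : smoothOm k -> (forall x, halfplane x -> h x = k x) ->
    measurable_fun (openQ : set (plane R)) (h : plane R -> R).
  move=> sk hk; apply: eq_measurable_fun (smoothOm_measurable sk) => x /set_mem Qx.
  exact/esym/hk/openQ_halfplane.
have mf := mQ _ _ (smoothOm_detD2 sv) corner_densityE.
have mu : measurable_fun (openQ : set (plane R)) (convex_potential : plane R -> R).
  apply: (mQ _ (fun x => 2^-1 * (x.1 * x.1 + x.2 * x.2) + v x)) => [|x Hx].
    apply: smoothOmD => //; apply: smoothOmM; first exact: smoothOm_cst.
    by apply: smoothOmD; apply: smoothOmM; (exact: smoothOm_fst || exact: smoothOm_snd).
  by rewrite /convex_potential patch0E// halfplane_neq0.
have uM y : closedQ y -> `|convex_potential y| <= 2.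
  move=> cy; have [y1 y2] := closedQ_abs cy.
  have b : `|patch0 v y| <= 16^-1.
    have [->|yn0] := eqVneq y 0; first by rewrite /patch0 eqxx normr0 invr_ge0.
    by rewrite patch0E//; apply: (iter_bound (w := [::])) => //; exact: closedQ_halfplane.
  have s1 : 0 <= y.1 ^+ 2 <= 1 by rewrite sqr_ge0 -real_normK ?num_real// exprn_ile1.
  have s2 : 0 <= y.2 ^+ 2 <= 1 by rewrite sqr_ge0 -real_normK ?num_real// exprn_ile1.
  move: b s1 s2; rewrite /convex_potential !ler_norml.
  by move: (patch0 v y) (y.1 ^+ 2) (y.2 ^+ 2) => p a b; lra.
have sq_ge0 x y : 0 <= (y - x).1 ^+ 2 + (y - x).2 ^+ 2 by rewrite addr_ge0 ?sqr_ge0.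
(* The bound 2 covers |x|^2 / 2 <= 1 plus |v| <= 1/16, and K = 1 exceeds 1/2 + 1/8. *)
apply: (@optimal_of_potential R corner_density mf _ convex_potential corner_map 2 1 mu uM).
- by move=> x /openQ_closedQ/corner_density_pos.
- move=> x y cx cy; have := convex_potential_second_order cx cy; have := sq_ge0 x y.
  by rewrite ler_norml; move: (_ ^+ 2 + _) (dot _ _) => a b; lra.
- exact: ltr01.
- move=> x y cx cy; have := convex_potential_second_order cx cy; have := sq_ge0 x y.
  by rewrite ler_norml; move: (_ ^+ 2 + _) (dot _ _) => a b; lra.
- exact: transports_corner_map.
Qed.

Lemma corner_density_mass : (\int[leb2 R]_(x in openQ) `|corner_density x|%:E =
  \int[leb2 R]_(x in openQ) `|(fun=> 1 : R) x|%:E)%E.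
Proof.
have := transports_corner_map.2 setT measurableT.
rewrite /pushforward /density_mass preimage_setT !setIT => h.
transitivity (\int[leb2 R]_(x in openQ) (corner_density x)%:E)%E.
  by apply: eq_integral => x /set_mem/openQ_closedQ/corner_density_pos/ltW/ger0_norm ->.
by rewrite h; apply: eq_integral => x _; rewrite normr1.
Qed.

End CornerMap.

Lemma Cinfty_cst1 (R : realType) : Cinfty (fun=> 1 : R).
Proof.
move=> k.
have -> : (fun=> 1) = (fun x : R * R => bil 1 0 0 0 x + patch0 (fun=> 0) x).
  by apply/funext => x; rewrite /patch0 /bil; case: ifP => _; ring.
apply: Ck_bil_patch0 => [|w _ e e0]; first exact: smoothOm_cst.
by exists 1 => // x _ _ _; rewrite iter_partial0 normr0.
Qed.

Theorem theorem3p7 (R : realType) :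
  exists f g : R * R -> R,
    [/\ Cinfty f /\ Cinfty g,
        (forall x, closedQ x -> 0 < f x /\ 0 < g x),
        (exists2 c : R, 0 < c & forall x, closedQ x -> c <= f x /\ c <= g x),
        (\int[leb2 R]_(x in openQ) `|f x|%:E = \int[leb2 R]_(x in openQ) `|g x|%:E)%E &
        exists T : R * R -> R * R,
          [/\ optimal_transport f g T,
              (forall alpha : R, 0 < alpha < 1 -> Ckalpha_map 2 alpha T) &
              ~ Ck_map 3 T]].
Proof.
(* The size 1/16 serves both the lower bound 1/2 of the density and the convexity estimate. *)
have eta0 : (0 : R) < 16^-1 by rewrite invr_gt0.
have [v [[sv v0 vC] vN [v3 v4] vflat blowup]] := corner_potential eta0.
have pos x : closedQ x -> (2^-1 : R) <= corner_density v x /\ (2^-1 : R) <= 1.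
  by move=> cx; split; [exact: corner_density_ge|rewrite invf_le1 ?ler1n].
exists (corner_density v), (fun=> 1); split.
- by split; [exact: Cinfty_corner_density|exact: Cinfty_cst1].
- by move=> x /pos[h _]; split=> //; apply: lt_le_trans h; rewrite invr_gt0.
- by exists 2^-1; [rewrite invr_gt0|exact: pos].
- exact: (corner_density_mass sv v0 vC vN v3 erefl erefl).
- exists (corner_map v); split.
  + exact: (optimal_corner_map sv v0 vC vN v3 v4 erefl erefl).
  + by move=> alpha; exact: Ckalpha_corner_map.
  + exact: not_C3_corner_map.
Qed.
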